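(* Let $n\ge 3$, $q=\frac{2n}{n-2}$, $\kappa=\frac{n-1}{n}$. Identify $S^1$ with $[-\pi,\pi]$ with endpoints identified, and let $\lambda=-1$ on $(-\pi,0)$, $\lambda=1$ on $(0,\pi)$. For $t\in\mathbb{R}$ let $\tau_t=t+\lambda$. Let $N$ be a smooth positive function on $S^1$, let $\gamma_N=-\frac{\int_{S^1}\lambda N}{\int_{S^1}N}$, and let $\eta,\mu\in\mathbb{R}$. Consider the system $$-2\kappa q\,\phi''-2\eta^2\phi^{-q-1}-\kappa\Big(\mu+\tfrac{1}{2N}w'\Big)^2\phi^{-q-1}+\kappa\tau_t^2\phi^{q-1}=0,\qquad \Big(\tfrac{1}{2N}w'\Big)'-\phi^q\tau_t'=0$$ on $S^1$. If $|t-\gamma_N|>2$, then a solution $(\phi,w)$ exists if and only if $\eta\neq0$ or $\mu\neq0$. If moreover $\mu=0$, the solution is unique.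
   Context: Here $\tau_t'=2(\delta_0-\delta_\pi)$ is the distributional derivative ($\delta_x$ the Dirac mass at $x$), and the second equation is understood in the sense of distributions. A solution is a pair $(\phi,w)\in W^{2,p}_+(S^1)\times W^{1,p}(S^1)$ for some $p>1$, where the subscript $+$ denotes positive functions. If $(\phi,w)$ is a solution, so is $(\phi,w+c)$ for any constant $c$; ''the solution is unique'' means every other solution is of the form $(\phi,w+c)$. *)

(* Defs.v *)
From HB Require Import structures.
From mathcomp Require Import all_boot all_order all_algebra.
From mathcomp Require Import all_classical all_reals all_analysis.
Set Implicit Arguments. Unset Strict Implicit. Unset Printing Implicit Defensive.
Import Order.TTheory GRing.Theory Num.Theory.
Import numFieldNormedType.Exports.
Local Open Scope classical_set_scope.
Local Open Scope ring_scope.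

Notation leb := (@lebesgue_measure _).

Section Defs.
Context {R : realType}.

(* S^1 is identified with [-pi, pi] (endpoints identified); functions on S^1
   are represented as 2*pi-periodic2pi functions R -> R. *)
Definition circI : set R := [set x : R | -pi <= x <= pi].


Definition periodic2pi (f : R -> R) : Prop := forall x, f (x + 2 * pi) = f x.

Definition smooth (f : R -> R) : Prop :=
  forall (k : nat) (x : R), derivable (derive1n k f) x 1.

Definition test_fun (psi : R -> R) : Prop := smooth psi /\ periodic2pi psi.

(* lambda = -1 on (-pi,0), 1 on (0,pi) (extended periodically; value 0 on
   the null set {0, pi} + 2 pi Z, which is irrelevant). *)
Definition lam (x : R) : R :=
  if sin x < 0 then -1 else if 0 < sin x then 1 else 0.

Definition tau (t : R) (x : R) : R := t + lam x.

Definition gammaN (N : R -> R) : R :=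
  - ((\int[leb]_(x in circI) (lam x * N x)) / (\int[leb]_(x in circI) N x)).

Definition Lp (p : R) (g : R -> R) : Prop :=
  measurable_fun circI g /\
  (\int[leb]_(x in circI) ((`|g x| `^ p)%:E) < +oo)%E.

Definition weak_deriv (f g : R -> R) : Prop :=
  forall psi, test_fun psi ->
    \int[leb]_(x in circI) (f x * derive1n 1 psi x)
    = - (\int[leb]_(x in circI) (g x * psi x)).

Definition qexp (n : nat) : R := (2 * n%:R) / (n%:R - 2).
Definition kappa (n : nat) : R := (n%:R - 1) / n%:R.

(* (phi, w) in W^{2,p}_+(S^1) x W^{1,p}(S^1) (continuous representatives)
   solves the system; phi1, phi2, w1 are the weak derivatives phi', phi'', w'.
   The first equation holds a.e. (phi'' in L^p), the second in the sense
   of distributions, with tau_t' = 2 (delta_0 - delta_pi), so that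
   phi^q tau_t' = 2 phi(0)^q delta_0 - 2 phi(pi)^q delta_pi. *)
Definition is_solution (n : nat) (N : R -> R) (eta mu t p : R)
    (phi w : R -> R) : Prop :=
  1 < p /\
  periodic2pi phi /\ continuous phi /\ (forall x, 0 < phi x) /\
  periodic2pi w /\ continuous w /\ Lp p phi /\ Lp p w /\
  exists phi1 phi2 w1 : R -> R,
    Lp p phi1 /\ Lp p phi2 /\ Lp p w1 /\
    weak_deriv phi phi1 /\ weak_deriv phi1 phi2 /\ weak_deriv w w1 /\
    {ae leb, forall x, circI x ->
       - 2 * kappa n * qexp n * phi2 x
       - 2 * eta ^+ 2 * phi x `^ (- qexp n - 1)
       - kappa n * (mu + w1 x / (2 * N x)) ^+ 2 * phi x `^ (- qexp n - 1)
       + kappa n * (tau t x) ^+ 2 * phi x `^ (qexp n - 1) = 0} /\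
    (forall psi, test_fun psi ->
       - (\int[leb]_(x in circI) (w1 x / (2 * N x) * derive1n 1 psi x))
       - (2 * phi 0 `^ qexp n * psi 0 - 2 * phi pi `^ qexp n * psi pi) = 0).

End Defs.

(* Main.v *)
(* Integrating the second equation gives w' / (2 N) = b (lambda + gamma_N) where
   b = phi(0)^q = phi(pi)^q, so everything reduces to an ODE for phi with coefficients
   constant on the two half circles and depending on the single unknown b.  For given b
   this ODE, phi'' = F(phi) with F increasing, has a unique positive solution; it is
   symmetric about the midpoints of the half circles, so it is encoded by two arms
   running from a midpoint to the junction.  A solution of the system is then a fixed
   point of b |-> phi_b(0)^q.

   Here |t| > 1 and |gamma_N| < 1.  If (eta, mu) <> (0, 0), constant subsolutions show
   phi_b(0)^q > b for small b, and energy conservation along an arm shows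
   phi_b(0)^q < b for large b, whence a fixed point.  If eta = mu = 0, the signs of the
   forcings at the junction, or the equality of the slopes of the two arms there,
   exclude a fixed point.

   For mu = 0, uniqueness follows because phi_b(0)^q - b changes sign from plus to minus
   at every fixed point: combining the generators of the scalings of phi and of the
   arm variable with translations yields a strict supersolution of the linearised
   problem whose value at the junction is less than phi_b(0) / q. *)
Require Import Defs.
From HB Require Import structures.
From mathcomp Require Import all_boot all_order all_algebra.
From mathcomp Require Import all_classical all_reals all_analysis.
From mathcomp Require Import measurable_realfun ring lra.
Import Order.TTheory GRing.Theory Num.Theory.
Import numFieldNormedType.Exports.
Local Open Scope classical_set_scope.
Local Open Scope ring_scope.

Set Implicit Arguments.
Unset Strict Implicit.
Unset Printing Implicit Defensive.

(** * Calculus and maximum principles *)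

Section Derivatives.
Context {R : realType}.
Implicit Types (f g u v w : R -> R) (a b c x y z : R).

(** For [mu = 0] uniqueness asks that phi_b(0) grow more slowly than b^(1/q). Exchanging the half
    circles allows t > 1. Moving phi in the direction phi / q leaves in the linearised equation a
    positive multiple of (q-2) (tau_t^2 phi^(2q) - b^2 (lambda + gamma_N)^2) plus a positive term
    due to eta. If t + gamma_N >= 2, the difference is nonnegative everywhere and this direction
    suffices. Choosing their weights is a finite linear problem; energy conservation and the
    matching of slopes reduce its solvability to the inequality [dagger]. There the hypotheses
    enter: |t - gamma_N| > 2 gives 1 + gamma_N < t - 1, which forces the eta term to be at least (1
    + gamma_N)^2 in units of b^2, and n >= 3 gives q <= 6, that is (q-2)/(q+2) <= 1/2. *)

Lemma derE f x d d' : is_derive x 1 f d -> d = d' -> is_derive x 1 f d'.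
Proof. by move=> + <-. Qed.

Lemma der_cst c x : is_derive x 1 (fun=> c) 0.
Proof. exact: is_derive_cst. Qed.

Lemma der_id x : is_derive x 1 (fun y => y) 1.
Proof. exact: is_derive_id. Qed.

Lemma derD f g x df dg : is_derive x 1 f df -> is_derive x 1 g dg ->
  is_derive x 1 (fun y => f y + g y) (df + dg).
Proof. by move=> hf hg; exact: is_deriveD. Qed.

Lemma derN f x df : is_derive x 1 f df -> is_derive x 1 (fun y => - f y) (- df).
Proof. by move=> hf; exact: is_deriveN. Qed.

Lemma derB f g x df dg : is_derive x 1 f df -> is_derive x 1 g dg ->
  is_derive x 1 (fun y => f y - g y) (df - dg).
Proof. by move=> hf hg; exact: is_deriveB. Qed.

Lemma derM f g x df dg : is_derive x 1 f df -> is_derive x 1 g dg ->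
  is_derive x 1 (fun y => f y * g y) (df * g x + f x * dg).
Proof.
move=> hf hg; have -> : (fun y => f y * g y) = f * g by [].
apply: (derE (is_deriveM hf hg)).
by rewrite /GRing.scale /=; ring.
Qed.

Lemma derZ c f x df : is_derive x 1 f df ->
  is_derive x 1 (fun y => c * f y) (c * df).
Proof. by move=> hf; exact: (@is_deriveZ _ _ _ f c). Qed.

Lemma der_comp f g x df dg : is_derive (g x) 1 f df -> is_derive x 1 g dg ->
  is_derive x 1 (fun y => f (g y)) (df * dg).
Proof. by move=> hf hg; exact: (@is_derive1_comp _ f g). Qed.

Lemma der_cont f x d : is_derive x 1 f d -> {for x, continuous f}.
Proof.
move=> h; apply: differentiable_continuous; apply/derivable1_diffP.
exact: ex_derive.
Qed.

Lemma der_within {f a b} {df : R -> R} :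
  (forall z, a <= z <= b -> is_derive z 1 f (df z)) -> {within `[a, b], continuous f}.
Proof.
move=> h; apply: continuous_in_subspaceT => z; rewrite inE /= in_itv /= => /h.
exact: der_cont.
Qed.

Lemma der_MVT f a b (df : R -> R) : a < b ->
  (forall z, a <= z <= b -> is_derive z 1 f (df z)) ->
  exists2 c, a < c < b & f b - f a = df c * (b - a).
Proof.
move=> ab h; have [||c] := @MVT _ f df a b ab.
- by move=> z; rewrite in_itv /= => /andP[az zb]; apply: h; rewrite !ltW.
- exact: der_within h.
- by rewrite in_itv /= => cab fE; exists c.
Qed.

Lemma der_gt0_lt f a b (df : R -> R) : a < b ->
  (forall z, a <= z <= b -> is_derive z 1 f (df z)) ->
  (forall z, a < z < b -> 0 < df z) -> f a < f b.
Proof.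
move=> ab h h0; have [c cab fE] := der_MVT ab h.
by rewrite -subr_gt0 fE mulr_gt0 ?h0 // subr_gt0.
Qed.

Lemma der_ge0_le f a b (df : R -> R) : a <= b ->
  (forall z, a <= z <= b -> is_derive z 1 f (df z)) ->
  (forall z, a < z < b -> 0 <= df z) -> f a <= f b.
Proof.
rewrite le_eqVlt => /orP[/eqP <- // | ab] h h0.
have [c cab fE] := der_MVT ab h.
by rewrite -subr_ge0 fE mulr_ge0 ?h0 // subr_ge0 ltW.
Qed.

Lemma der_eq0_cst f a b (df : R -> R) : a <= b ->
  (forall z, a <= z <= b -> is_derive z 1 f (df z)) ->
  (forall z, a < z < b -> df z = 0) -> f a = f b.
Proof.
move=> ab h h0; apply/eqP; rewrite eq_le; apply/andP; split.
  by apply: (der_ge0_le ab h) => z /h0 ->.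
rewrite -lerN2; apply: (@der_ge0_le (fun y => - f y) a b (fun z => - df z)) => //.
  by move=> z /h; exact: derN.
by move=> z /h0 ->; rewrite oppr0.
Qed.

Lemma der_global_cst f : (forall z, is_derive z 1 f 0) -> forall x y, f x = f y.
Proof.
move=> h x y; wlog xy : x y / x <= y.
  by move=> H; case/orP: (le_total x y) => [/H //|/H ->].
exact: (@der_eq0_cst f x y (fun=> 0)).
Qed.

Lemma near_pos f x : {for x, continuous f} -> 0 < f x ->
  exists2 e, 0 < e & forall y, `|x - y| < e -> 0 < f y.
Proof.
move=> cf f0; have : \forall y \near x, 0 < f y by apply: (cvgr_gt (f x) cf).
by move=> /nbhs_ballP[e /= e0 H]; exists e.
Qed.

(** The point is the infimum of the set where [f <= 0]. This is the continuity argument behind every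
    propagation of positivity below. *)
Lemma first_nonpos f a b : a <= b -> (forall z, a <= z <= b -> {for z, continuous f}) ->
  0 < f a -> f b <= 0 ->
  exists2 c, a < c <= b & f c <= 0 /\ forall z, a <= z < c -> 0 < f z.
Proof.
move=> ab cf fa fb; pose E := [set z | a <= z <= b /\ f z <= 0].
have Eb : E b by rewrite /E /= ab lexx.
have lbE : lbound E a by move=> z [/andP[]].
have hE : has_inf E by split; [exists b | exists a].
have aE : a <= inf E by apply: lb_le_inf => //; exists b.
have Eb' : inf E <= b by apply: ge_inf => //; exists a.
have low z : a <= z < inf E -> 0 < f z.
  move=> /andP[az zE]; rewrite ltNge; apply/negP => fz.
  suff : inf E <= z by rewrite leNgt zE.
  apply: ge_inf; first by exists a.
  by split => //; rewrite az /= (le_trans (ltW zE)).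
have fc : f (inf E) <= 0.
  rewrite leNgt; apply/negP => f0.
  have [e e0 He] := near_pos (cf _ (introT andP (conj aE Eb'))) f0.
  have [z [/andP[az zb] fz] zlt] := inf_adherent e0 hE.
  have zE : inf E <= z by apply: ge_inf; [exists a | split => //; rewrite az].
  have : 0 < f z.
    by apply: He; rewrite ltr_norml; apply/andP; split; lra.
  by rewrite ltNge fz.
exists (inf E); last by split.
rewrite Eb' andbT lt_neqAle aE andbT; apply/eqP => aI.
by move: fc; rewrite -aI leNgt fa.
Qed.

Lemma last_nonpos f a b : a <= b -> (forall z, a <= z <= b -> {for z, continuous f}) ->
  f a <= 0 -> 0 < f b ->
  exists2 c, a <= c < b & f c <= 0 /\ forall z, c < z <= b -> 0 < f z.
Proof.
move=> ab cf fa fb.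
have ab' : - b <= - a by rewrite lerN2.
have cg z : - b <= z <= - a -> {for z, continuous (fun y => f (- y))}.
  move=> /andP[bz za]; apply: (@continuous_comp _ _ _ -%R f); first exact: oppr_continuous.
  by apply: cf; apply/andP; split; lra.
have [||c /andP[c1 c2] [fc H]] := first_nonpos ab' cg; rewrite ?opprK //.
exists (- c); first by apply/andP; split; lra.
split => // z /andP[cz zb]; rewrite -[z]opprK; apply: H.
by apply/andP; split; lra.
Qed.

End Derivatives.

(** * Maximum principles for functions that are convex where positive *)

Section Arms.
Context {R : realType}.
Implicit Types (u v w p m g : R -> R) (a b c x y z : R).

(** As long as [w] is positive, [w1] increases from a nonnegative value, so [w] cannot fall to a
    first nonpositive point. *)
Lemma convex_forward w w1 w2 a b : a < b ->
  (forall z, a <= z <= b -> is_derive z 1 w (w1 z)) ->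
  (forall z, a <= z <= b -> is_derive z 1 w1 (w2 z)) ->
  (forall z, a <= z <= b -> 0 < w z -> 0 < w2 z) ->
  0 < w a -> 0 <= w1 a -> 0 < w b /\ 0 < w1 b.
Proof.
move=> ab dw dw1 H wa w1a.
have step c : a < c <= b -> (forall z, a <= z < c -> 0 < w z) ->
    forall z, a < z <= c -> 0 < w1 z.
  move=> /andP[ac cb] pos z /andP[az zc]; apply: (le_lt_trans w1a).
  apply: (@der_gt0_lt _ w1 a z w2) => // y /andP[ay yz].
    by apply: dw1; rewrite ay (le_trans yz) // (le_trans zc).
  apply: H; first by rewrite (ltW ay) (le_trans (ltW yz)) // (le_trans zc).
  by apply: pos; rewrite (ltW ay) (lt_le_trans yz).
have mono c : a < c <= b -> (forall z, a <= z < c -> 0 < w z) -> 0 < w c.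
  move=> cab pos; apply: (lt_le_trans wa); case/andP: (cab) => ac cb.
  apply: (@der_ge0_le _ w a c w1 (ltW ac)) => z /andP[az zc].
    by apply: dw; rewrite az (le_trans zc).
  by apply/ltW/(step c) => //; rewrite az ltW.
have allpos z : a <= z <= b -> 0 < w z.
  move=> /andP[az zb]; rewrite ltNge; apply/negP => wz.
  have cw y : a <= y <= z -> {for y, continuous w}.
    move=> /andP[ay yz]; apply: (@der_cont _ _ _ (w1 y)); apply: dw.
    by rewrite ay (le_trans yz).
  have [c /andP[ac cz] [wc pos]] := first_nonpos az cw wa wz.
  have := mono c; rewrite ac (le_trans cz zb) => /(_ isT pos).
  by rewrite ltNge wc.
split; first by apply: allpos; rewrite lexx ltW.
apply: (step b); rewrite ?ab ?lexx //.
by move=> z /andP[az zb]; apply: allpos; rewrite az ltW.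
Qed.

(** If [w a <= 0], the mean value theorem after the last nonpositive point before [z0] yields a
    positive slope at a positive value, and [convex_forward] applies from there. The disjunction
    covers a Neumann condition at a midpoint as well as a Dirichlet condition. *)
Lemma convex_escape w w1 w2 a b z0 : a < b ->
  (forall z, a <= z <= b -> is_derive z 1 w (w1 z)) ->
  (forall z, a <= z <= b -> is_derive z 1 w1 (w2 z)) ->
  (forall z, a <= z <= b -> 0 < w z -> 0 < w2 z) ->
  0 <= w1 a \/ w a <= 0 ->
  a <= z0 <= b -> 0 < w z0 -> 0 < w b /\ 0 < w1 b.
Proof.
move=> ab dw dw1 H wa /andP[az zb] wz.
have [wa0|wa0] := ltP 0 (w a).
  by apply: (@convex_forward w w1 w2 a b) => //; case: wa => //; rewrite leNgt wa0.
have cw y : a <= y <= z0 -> {for y, continuous w}.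
  move=> /andP[ay yz]; apply: (@der_cont _ _ _ (w1 y)); apply: dw.
  by rewrite ay (le_trans yz).
have [c /andP[ac cz] [wc pos]] := last_nonpos az cw wa0 wz.
have [|y /andP[cy yz] wE] := @der_MVT _ w c z0 w1 cz.
  move=> y /andP[cy yz]; apply: dw.
  by rewrite (le_trans ac) // (le_trans yz).
have w1y : 0 < w1 y.
  have : 0 < w z0 - w c by rewrite subr_gt0 (le_lt_trans wc).
  by rewrite wE pmulr_lgt0 // subr_gt0.
have sub x : y <= x <= b -> a <= x <= b.
  by move=> /andP[yx ->]; rewrite (le_trans ac) // (le_trans (ltW cy)).
have yb : y < b by exact: lt_le_trans zb.
apply: (@convex_forward w w1 w2 y b) => //; last by rewrite ltW.
- by move=> x /sub; exact: dw.
- by move=> x /sub; exact: dw1.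
- by move=> x /sub; exact: H.
- by apply: pos; rewrite cy ltW.
Qed.

Lemma convex_dirichlet w w1 w2 a b : a < b ->
  (forall z, a <= z <= b -> is_derive z 1 w (w1 z)) ->
  (forall z, a <= z <= b -> is_derive z 1 w1 (w2 z)) ->
  (forall z, a <= z <= b -> 0 < w z -> 0 < w2 z) ->
  0 <= w1 a \/ w a <= 0 -> w b <= 0 ->
  forall z, a <= z <= b -> w z <= 0.
Proof.
move=> ab dw dw1 H wa wb z zab; rewrite leNgt; apply/negP => wz.
have [+ _] := convex_escape ab dw dw1 H wa zab wz.
by rewrite ltNge wb.
Qed.

(** If the common end value were positive, both pieces would arrive with positive slope, against
    [p1 b + m1 b <= 0]. Once it is nonpositive, each piece is a Dirichlet problem. *)
Lemma glued_max_principle p p1 p2 m m1 m2 a b : a < b ->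
  (forall z, a <= z <= b -> is_derive z 1 p (p1 z)) ->
  (forall z, a <= z <= b -> is_derive z 1 p1 (p2 z)) ->
  (forall z, a <= z <= b -> is_derive z 1 m (m1 z)) ->
  (forall z, a <= z <= b -> is_derive z 1 m1 (m2 z)) ->
  (forall z, a <= z <= b -> 0 < p z -> 0 < p2 z) ->
  (forall z, a <= z <= b -> 0 < m z -> 0 < m2 z) ->
  0 <= p1 a -> 0 <= m1 a -> p b = m b -> p1 b + m1 b <= 0 ->
  (forall z, a <= z <= b -> p z <= 0) /\ (forall z, a <= z <= b -> m z <= 0).
Proof.
move=> ab dp dp1 dm dm1 Hp Hm pa ma pmb pm1.
have bb : a <= b <= b by rewrite lexx ltW.
have pb0 : p b <= 0.
  rewrite leNgt; apply/negP => pb.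
  have [_ p1b] := convex_escape ab dp dp1 Hp (or_introl pa) bb pb.
  rewrite pmb in pb.
  have [_ m1b] := convex_escape ab dm dm1 Hm (or_introl ma) bb pb.
  by move: pm1; rewrite leNgt addr_gt0.
split; first exact: (@convex_dirichlet p p1 p2 a b ab dp dp1 Hp (or_introl pa)).
apply: (@convex_dirichlet m m1 m2 a b ab dm dm1 Hm (or_introl ma)).
by rewrite -pmb.
Qed.

Lemma der_pos_local g x d : is_derive x 1 g d -> 0 < d ->
  exists2 e, 0 < e & forall h, 0 < h < e -> g (x - h) < g x /\ g x < g (x + h).
Proof.
move=> dg d0; have [dgx dgE] := dg.
have : (fun h => h^-1 *: (g (h *: (1 : R) + x) - g x)) @ 0^' --> d.
  by rewrite -dgE; exact: dgx.
move=> /(cvgr_gt d)/(_ 0 d0)/nbhs_ballP[e /= e0 H].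
exists e => // h /andP[h0 he].
have he' : `|h| < e by rewrite gtr0_norm.
have H1 : 0 < h^-1 *: (g (h *: 1 + x) - g x).
  by apply: (H h); rewrite /ball /= ?sub0r ?normrN // gt_eqF.
have H2 : 0 < (- h)^-1 *: (g ((- h) *: 1 + x) - g x).
  by apply: (H (- h)); rewrite /ball /= ?sub0r ?normrN ?oppr_eq0 // gt_eqF.
move: H1 H2; rewrite /GRing.scale /= !mulr1 invrN mulNr oppr_gt0.
rewrite pmulr_rgt0 ?invr_gt0 // pmulr_rlt0 ?invr_gt0 // subr_gt0 subr_lt0.
by rewrite addrC [- h + x]addrC.
Qed.

(** Every zero is crossed upwards. At a first return to zero [g] would be positive just before it,
    contrary to the positive derivative. *)
Lemma pos_after_transverse_zeros g g1 a b : a < b ->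
  (forall z, a <= z <= b -> is_derive z 1 g (g1 z)) ->
  g a = 0 -> (forall z, a <= z <= b -> g z = 0 -> 0 < g1 z) -> 0 < g b.
Proof.
move=> ab dg ga H.
have aab : a <= a <= b by rewrite lexx ltW.
have [e e0 He] := der_pos_local (dg a aab) (H a aab ga).
rewrite ltNge; apply/negP => gb.
pose h := Num.min (e / 2) ((b - a) / 2).
have h0 : 0 < h by rewrite lt_min !divr_gt0 // subr_gt0.
have he : h < e by rewrite gt_min; apply/orP; left; lra.
have hb : h < b - a by rewrite gt_min; apply/orP; right; lra.
have [_] : g (a - h) < g a /\ g a < g (a + h) by apply: He; rewrite h0.
rewrite ga => gh.
have cg z : a + h <= z <= b -> {for z, continuous g}.
  by move=> /andP[? ?]; apply: (@der_cont _ _ _ (g1 z)); apply: dg; lra.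
have ahb : a + h <= b by lra.
have [c /andP[ac cb] [gc pos]] := first_nonpos ahb cg gh gb.
have gc0 : g c = 0.
  apply/eqP; rewrite eq_le gc /= leNgt; apply/negP => gc0.
  have cc : {for c, continuous (fun y => - g y)}.
    by apply: continuousN; apply: cg; lra.
  have [|e' e'0 He'] := near_pos cc; first by rewrite oppr_gt0.
  pose k := Num.min (e' / 2) (c - (a + h)).
  have k0 : 0 < k by rewrite lt_min divr_gt0 ?subr_gt0.
  have ke : k < e' by rewrite gt_min; apply/orP; left; lra.
  have kc : k <= c - (a + h) by rewrite ge_min lexx orbT.
  have : 0 < g (c - k) by apply: pos; lra.
  have : 0 < - g (c - k).
    by apply: He'; rewrite opprB addrC subrK gtr0_norm.
  lra.
have cab : a <= c <= b by lra.
have [e' e'0 He'] := der_pos_local (dg c cab) (H c cab gc0).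
pose k := Num.min (e' / 2) (c - (a + h)).
have k0 : 0 < k by rewrite lt_min divr_gt0 ?subr_gt0.
have ke : k < e' by rewrite gt_min; apply/orP; left; lra.
have kc : k <= c - (a + h) by rewrite ge_min lexx orbT.
have [] : g (c - k) < g c /\ g c < g (c + k) by apply: He'; rewrite k0.
have : 0 < g (c - k) by apply: pos; lra.
lra.
Qed.

End Arms.

(** * Primitives of continuous functions on the whole line *)

Section Antiderivative.
Context {R : realType}.
Notation mu := (@lebesgue_measure R).
Implicit Types (h f F : R -> R) (a b x y z : R).

Lemma continuous_itv_integrable h a b : continuous h ->
  mu.-integrable `[a, b] (EFin \o h).
Proof.
move=> ch; apply: continuous_compact_integrable; first exact: segment_compact.
exact: continuous_subspaceT.
Qed.

Let G h B x := \int[mu]_(t in `[- B, x]) h t.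

Let derG h B x : continuous h -> - B < x -> is_derive x 1 (G h B) (h x).
Proof.
move=> ch Bx.
have xx : x < x + 1 by rewrite ltrDl.
have [] := @continuous_FTC1_closed R h (- B) x (x + 1) xx
  (continuous_itv_integrable _ _ ch) Bx (ch x).
move=> dG GE.
by apply: DeriveDef; [exact: dG | rewrite -derive1E].
Qed.

(** An integral from [- B] is a primitive only to the right of [- B]. The lower limit therefore
    moves with [x], and [HE] shows that the increment from 0 does not depend on it. *)
Lemma antiderivative h : continuous h ->
  exists H : R -> R, H 0 = 0 /\ forall x, is_derive x 1 H (h x).
Proof.
move=> ch; pose H x := G h (`|x| + 1) x - G h (`|x| + 1) 0.
have HE B x : `|x| < B -> H x = G h B x - G h B 0.
  move=> xB.
  have diff B1 B2 y : `|x| < B1 -> `|x| < B2 -> - `|x| <= y ->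
      is_derive y 1 (fun z => G h B1 z - G h B2 z) (h y - h y).
    by move=> h1 h2 xy; apply: derB; apply: derG => //; lra.
  have x0 := normr_ge0 x; have xx := ler_norm x; have xx' := ler_norm (- x).
  rewrite normrN in xx'.
  suff : G h (`|x| + 1) x - G h B x = G h (`|x| + 1) 0 - G h B 0.
    by rewrite /H; lra.
  have [x0'|x0'] := leP 0 x.
    symmetry; apply: (@der_eq0_cst _ (fun z => G h (`|x| + 1) z - G h B z) 0 x
      (fun y => h y - h y)) => // [z zx|z _]; last by rewrite subrr.
    by apply: diff; lra.
  apply: (@der_eq0_cst _ (fun z => G h (`|x| + 1) z - G h B z) x 0
      (fun y => h y - h y)) => // [|z zx|z _]; last by rewrite subrr.
    lra.
  by apply: diff; lra.
exists H; split; first by rewrite /H subrr.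
move=> x; have x0 := normr_ge0 x.
have := ler_norm (- x); rewrite normrN => xx.
have d1 : is_derive x 1 (fun y => G h (`|x| + 2) y - G h (`|x| + 2) 0) (h x - 0).
  by apply: derB; apply: derG => //; lra.
rewrite subr0 in d1.
have nE : {near x, H =1 (fun y => G h (`|x| + 2) y - G h (`|x| + 2) 0)}.
  apply/nbhs_ballP; exists 1 => //= y; rewrite /ball /= => xy; apply: HE.
  have := ler_normB y x; have -> : `|y - x| = `|x - y| by rewrite distrC.
  have := lerB_dist y x; rewrite (distrC y x); lra.
apply: (near_eq_is_derive _ d1); near=> y; symmetry.
by near: y.
Unshelve. all: by end_near. Qed.

Lemma Rintegral_FTC f F a b : a <= b -> continuous f ->
  (forall z, a <= z <= b -> is_derive z 1 F (f z)) ->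
  \int[mu]_(x in `[a, b]) f x = F b - F a.
Proof.
rewrite le_eqVlt => /orP[/eqP <- cf dF|ab cf dF].
  by rewrite set_itv1 Rintegral_set1 subrr.
rewrite /Rintegral (@continuous_FTC2 _ f F a b ab) //.
- exact: continuous_subspaceT.
- split.
  + move=> x; rewrite in_itv /= => /andP[ax xb].
    by have /@ex_derive := dF x (introT andP (conj (ltW ax) (ltW xb))).
  + by apply/cvg_at_right_filter; apply: (@der_cont _ F a (f a)); apply: dF; lra.
  + by apply/cvg_at_left_filter; apply: (@der_cont _ F b (f b)); apply: dF; lra.
- move=> x; rewrite in_itv /= => /andP[ax xb]; rewrite derive1E.
  by have [] := dF x (introT andP (conj (ltW ax) (ltW xb))).
Qed.

End Antiderivative.

(** * Glued boundary value problems *)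

Section Glued.
Context {R : realType}.
Implicit Types (u v F : bool -> R -> R) (a b c k l x y z : R).

(* The circle is cut into two intervals on which the data are constant; each is
   symmetric about its midpoint. A solution on the circle is encoded by two arms
   indexed by [bool], parametrised by the distance [z] to the midpoint and glued
   at the common endpoint [z = l]. *)
Definition glued l F u v :=
  [/\ forall i z, 0 <= z <= l -> is_derive z 1 (u i) (v i z),
      forall i z, 0 <= z <= l -> is_derive z 1 (v i) (F i (u i z)),
      forall i, v i 0 = 0,
      u true l = u false l & v true l + v false l = 0].

Lemma glued_max l u v w : 0 < l ->
  (forall i z, 0 <= z <= l -> is_derive z 1 (u i) (v i z)) ->
  (forall i z, 0 <= z <= l -> is_derive z 1 (v i) (w i z)) ->
  (forall i z, 0 <= z <= l -> 0 < u i z -> 0 < w i z) ->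
  (forall i, 0 <= v i 0) -> u true l = u false l -> v true l + v false l <= 0 ->
  forall i z, 0 <= z <= l -> u i z <= 0.
Proof.
move=> l0 du dv H v0 ul vl.
have [] := @glued_max_principle R _ _ (w true) _ _ (w false) 0 l l0 (du true)
  (dv true) (du false) (dv false) (H true) (H false) (v0 true) (v0 false) ul vl.
by move=> ? ? [].
Qed.

Lemma der_expR_scale k z : is_derive z 1 (fun y => expR (k * y)) (k * expR (k * z)).
Proof.
have d := @der_comp _ expR (fun y => k * y) z _ _ (is_derive_expR _) (derZ k (der_id z)).
by apply: (derE d); ring.
Qed.

(** Variation of constants; the slope at 0 vanishes because both primitives [A] and [B] do. *)
Lemma arm_solver k (h : R -> R) : 0 < k -> continuous h ->
  exists u v : R -> R, [/\ forall z, is_derive z 1 u (v z),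
    forall z, is_derive z 1 v (k ^+ 2 * u z - h z) & v 0 = 0].
Proof.
move=> k0 ch.
pose E z := expR (k * z); pose E' z := expR (- k * z).
have dE z : is_derive z 1 E (k * E z) by exact: der_expR_scale.
have dE' z : is_derive z 1 E' (- k * E' z) by exact: der_expR_scale.
have EE z : E z * E' z = 1 by rewrite -expRD mulNr subrr expR0.
have cE : continuous E by move=> z; exact: der_cont (dE z).
have cE' : continuous E' by move=> z; exact: der_cont (dE' z).
have [|A [A0 dA]] := @antiderivative R (fun z => E' z * h z).
  by move=> z; apply: continuousM; [exact: cE' | exact: ch].
have [|B [B0 dB]] := @antiderivative R (fun z => E z * h z).
  by move=> z; apply: continuousM; [exact: cE | exact: ch].
exists (fun z => - (2 * k)^-1 * (E z * A z - E' z * B z)).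
exists (fun z => - 2^-1 * (E z * A z + E' z * B z)).
have kn : k != 0 by rewrite gt_eqF.
split=> [z|z|].
- apply: (derE (derZ (- (2 * k)^-1) (derB (derM (dE z) (dA z)) (derM (dE' z) (dB z))))).
  have -> : E z * (E' z * h z) = E' z * (E z * h z) by ring.
  by field.
- apply: (derE (derZ (- 2^-1) (derD (derM (dE z) (dA z)) (derM (dE' z) (dB z))))).
  have -> : E' z * (E z * h z) = h z by rewrite mulrA (mulrC (E' z)) EE mul1r.
  have -> : E z * (E' z * h z) = h z by rewrite mulrA EE mul1r.
  by field.
- by rewrite A0 B0 !mulr0 addr0 mulr0.
Qed.

(** Multiples of the even solution [e] of the homogeneous equation keep the zero slope at the
    midpoints; one multiplier per arm suffices for the two junction conditions. *)
Lemma linear_solver l k (h : bool -> R -> R) : 0 < l -> 0 < k ->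
  (forall i, continuous (h i)) ->
  exists u v, [/\ forall i z, is_derive z 1 (u i) (v i z),
      forall i z, is_derive z 1 (v i) (k ^+ 2 * u i z - h i z),
      forall i, v i 0 = 0,
      u true l = u false l & v true l + v false l = 0].
Proof.
move=> l0 k0 ch.
have kn : k != 0 by rewrite gt_eqF.
have [p [p1 [dp dp1 p10]]] := arm_solver k0 (ch true).
have [m [m1 [dm dm1 m10]]] := arm_solver k0 (ch false).
pose e z := expR (k * z) + expR (- k * z).
pose e1 z := k * expR (k * z) + - k * expR (- k * z).
have de z : is_derive z 1 e (e1 z) by exact: (derD (der_expR_scale k z) (der_expR_scale (- k) z)).
have de1 z : is_derive z 1 e1 (k ^+ 2 * e z).
  apply: (derE (derD (derZ k (der_expR_scale k z)) (derZ (- k) (der_expR_scale (- k) z)))).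
  by rewrite /e; ring.
have e10 : e1 0 = 0 by rewrite /e1 !mulr0 expR0; ring.
have el : e l != 0 by rewrite gt_eqF // addr_gt0 ?expR_gt0.
have e1l : e1 l != 0.
  rewrite gt_eqF // /e1 mulNr -mulrBr mulr_gt0 // subr_gt0 ltr_expR.
  by rewrite ltr_pM2r //; lra.
(* [S] is the sum of the two multipliers, determined by the slopes, and [D] their difference,
   determined by the values. *)
pose S := - (p1 l + m1 l) / e1 l; pose D := (m l - p l) / e l.
pose c i := if i then (S + D) / 2 else (S - D) / 2.
pose u0 i := if i then p else m; pose v0 i := if i then p1 else m1.
exists (fun i z => c i * e z + u0 i z), (fun i z => c i * e1 z + v0 i z); split.
- by move=> [] z; [exact: (derD (derZ (c true) (de z)) (dp z))
                  | exact: (derD (derZ (c false) (de z)) (dm z))].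
- move=> [] z; [apply: (derE (derD (derZ (c true) (de1 z)) (dp1 z)))
               | apply: (derE (derD (derZ (c false) (de1 z)) (dm1 z)))].
    by rewrite /u0; ring.
  by rewrite /u0; ring.
- by case; rewrite /v0 e10 mulr0 add0r.
- by rewrite /c /u0 /D /=; field.
- by rewrite /c /v0 /S /=; field.
Qed.

(** The intervals of centre [a n] and radius [th ^+ n * (D / (1 - th))] are nested, so the supremum
    of their left ends lies in all of them. *)
Lemma geometric_limit (a : nat -> R) (D th : R) : 0 <= D -> 0 <= th < 1 ->
  (forall n, `|a n.+1 - a n| <= th ^+ n * D) ->
  exists s, forall n, `|a n - s| <= th ^+ n * (D / (1 - th)).
Proof.
move=> D0 /andP[th0 th1] H; pose c := D / (1 - th).
have t1 : 0 < 1 - th by rewrite subr_gt0.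
have c0 : 0 <= c by rewrite divr_ge0 // ltW.
have cE : D = c * (1 - th) by rewrite /c divfK // gt_eqF.
have stepL n : a n - th ^+ n * c <= a n.+1 - th ^+ n.+1 * c.
  have := H n; rewrite ler_norml => /andP[+ _]; rewrite cE exprS.
  have := exprn_ge0 n th0; nra.
have stepU n : a n.+1 + th ^+ n.+1 * c <= a n + th ^+ n * c.
  have := H n; rewrite ler_norml => /andP[_ +]; rewrite cE exprS.
  have := exprn_ge0 n th0; nra.
have monoL n m : a n - th ^+ n * c <= a (n + m)%N - th ^+ (n + m) * c.
  elim: m => [|m IH]; first by rewrite addn0.
  by rewrite addnS; exact: le_trans (stepL _).
have monoU n m : a (n + m)%N + th ^+ (n + m) * c <= a n + th ^+ n * c.
  elim: m => [|m IH]; first by rewrite addn0.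
  by rewrite addnS; exact: le_trans (stepU _) IH.
have LU n m : a n - th ^+ n * c <= a m + th ^+ m * c.
  apply: (le_trans (monoL n m)); apply: (le_trans _ (monoU m n)).
  rewrite addnC lerD2l -subr_ge0 opprK.
  by rewrite addr_ge0 // mulr_ge0 // exprn_ge0.
pose E := range (fun n => a n - th ^+ n * c).
have E0 : E !=set0 by exists (a 0%N - th ^+ 0 * c); exists 0%N.
exists (sup E) => n.
have h1 : a n - th ^+ n * c <= sup E.
  apply: ub_le_sup; last by exists n.
  by exists (a 0%N + th ^+ 0 * c) => _ [m _ <-].
have h2 : sup E <= a n + th ^+ n * c.
  by apply: ge_sup => // _ [m _ <-].
by rewrite -/c ler_norml; lra.
Qed.

Lemma geometric_small (th C e : R) : 0 <= th < 1 -> 0 < e ->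
  exists n : nat, th ^+ n * C < e.
Proof.
move=> /andP[th0 th1] e0.
have h : (fun n => th ^+ n * C) @ \oo --> (0 * C : R).
  by apply: cvgM; [apply: cvg_expr; rewrite ger0_norm | exact: cvg_cst].
rewrite mul0r in h.
have [n _ Hn] := cvgr_lt 0 h e e0.
by exists n; apply: (Hn n) => /=.
Qed.

End Glued.

(** * Existence for strongly monotone Lipschitz forcings *)

Section MonotoneExistence.
Context {R : realType}.
Implicit Types (u v w : bool -> R -> R) (a b x y z : R).

Lemma lipschitz_cont (f : R -> R) (K : R) :
  (forall x y, `|f x - f y| <= K * `|x - y|) -> continuous f.
Proof.
move=> H x; apply/cvgrPdist_lt => e e0.
have K1 : 0 < `|K| + 1 by rewrite ltr_wpDl.
have d0 : 0 < e / (`|K| + 1) by rewrite divr_gt0.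
near=> y; apply: (le_lt_trans (H x y)).
have xy : `|x - y| < e / (`|K| + 1) by near: y; exact: cvgr_dist_lt.
rewrite ltr_pdivlMr // in xy; apply: le_lt_trans xy.
have := ler_norm K; have := normr_ge0 (x - y); nra.
Unshelve. all: by end_near. Qed.

Lemma approx_cont (f : R -> R) :
  (forall e, 0 < e -> exists2 g : R -> R, continuous g & forall z, `|f z - g z| <= e) ->
  continuous f.
Proof.
move=> H x; apply/cvgrPdist_lt => e e0.
have [|g cg fg] := H (e / 4); first by rewrite divr_gt0.
have e2 : 0 < e / 4 by rewrite divr_gt0.
near=> y.
have xy : `|g x - g y| < e / 4 by near: y; move/cvgrPdist_lt: (cg x); exact.
have := fg x; have := fg y; move: xy.
by rewrite !ltr_norml !ler_norml; lra.
Unshelve. all: by end_near. Qed.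

Lemma itv_bounded (f : R -> R) l : 0 <= l -> continuous f ->
  exists2 D, 0 <= D & forall z, 0 <= z <= l -> `|f z| <= D.
Proof.
move=> l0 cf; have cn : {within `[0, l], continuous (fun z => `|f z|)}.
  by apply: continuous_subspaceT => z; apply: (@continuous_comp _ _ _ f Num.norm); [exact: cf | exact: norm_continuous].
have [d _ H] := EVT_max l0 cn.
exists `|f d| => [|z zl]; first exact: normr_ge0.
by apply: H; rewrite in_itv.
Qed.

Section Contraction.
Variables (l c K : R) (F : bool -> R -> R).
Hypotheses (l0 : 0 < l) (c0 : 0 < c) (cK : c <= K).
Hypothesis FcK : forall i x y, x <= y -> c * (y - x) <= F i y - F i x <= K * (y - x).

(** The source is read only on [[0, l]], where the iterates obey uniform estimates; the clamped
    limit is then continuous on the whole line, as [linear_solver] requires. *)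
Let cl z := Num.max 0 (Num.min z l).

Let clE z : 0 <= z <= l -> cl z = z.
Proof. by move=> /andP[z0 zl]; rewrite /cl (min_idPl zl) (max_idPr z0). Qed.

Let cl_itv z : 0 <= cl z <= l.
Proof. by rewrite /cl le_max lexx ge_max ge_min lexx orbT (ltW l0). Qed.

Let cl_cont : continuous cl.
Proof.
move=> x; apply: (@continuous_max R R (fun=> 0) (fun z => Num.min z l)).
  exact: cvg_cst.
apply: (@continuous_min R R (fun z => z) (fun=> l)); first exact: cvg_id.
exact: cvg_cst.
Qed.

Let K0 : 0 < K. Proof. exact: lt_le_trans cK. Qed.

Let F_cont i : continuous (F i).
Proof.
apply: (@lipschitz_cont _ K) => x y.
wlog xy : x y / y <= x.
  by move=> H; case/orP: (le_total x y) => [xy|/H //]; rewrite distrC (distrC x); exact: H.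
have /andP[h1 h2] := FcK i xy.
have xy0 : 0 <= x - y by lra.
rewrite (ger0_norm xy0) ger0_norm //; apply: le_trans h1.
by rewrite mulr_ge0 // ltW.
Qed.

(** The equation u'' = F(u) is rewritten as u'' = K u - (K u - F(u)), whose source is nondecreasing
    in u with Lipschitz constant [K - c]. *)
Let h u i z := K * u i (cl z) - F i (u i (cl z)).

Let h_cont u : (forall i, continuous (u i)) -> forall i, continuous (h u i).
Proof.
move=> cu i; have cc : continuous (fun z => u i (cl z)).
  by move=> z; apply: continuous_comp; [exact: cl_cont | exact: cu].
move=> z; apply: (@continuousB _ _ _ (fun z => K * u i (cl z)) (fun z => F i (u i (cl z)))).
  by apply: continuousM; [exact: cvg_cst | exact: cc].
by apply: (@continuous_comp _ _ _ _ (F i)); [exact: cc | exact: F_cont].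
Qed.

Let solves u w := (forall i, continuous (u i)) -> (forall i, continuous (w i)) /\
  exists v, [/\ forall i z, is_derive z 1 (w i) (v i z),
      forall i z, is_derive z 1 (v i) (K * w i z - h u i z),
      forall i, v i 0 = 0,
      w true l = w false l & v true l + v false l = 0].

Let solves_ex u : exists w, solves u w.
Proof.
have [cu|] := pselect (forall i, continuous (u i)); last by exists (fun _ _ => 0).
have k0 : 0 < Num.sqrt K by rewrite sqrtr_gt0.
have [w [v [dw dv v0 wl vl]]] := linear_solver l0 k0 (h_cont cu).
exists w => _; split; first by move=> i z; exact: der_cont (dw i z).
by exists v; rewrite sqr_sqrtr ?ltW // in dv.
Qed.

Let th := (K - c) / K.

Let th01 : 0 <= th < 1.
Proof.
have Kc : 0 <= K - c by rewrite subr_ge0.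
by rewrite /th divr_ge0 ?(ltW K0) //= ltr_pdivrMr // mul1r ltrBlDr ltrDl.
Qed.

(** The sources differ by at most [(K - c) * D], which is [K * (th * D)]; so the constant [th * D]
    dominates the difference of the solutions by the maximum principle, with a factor [th < 1] that
    does not depend on [l]. *)
Let contracts u u' w w' D : 0 <= D ->
  (forall i, continuous (u i)) -> (forall i, continuous (u' i)) ->
  solves u w -> solves u' w' ->
  (forall i z, 0 <= z <= l -> `|u i z - u' i z| <= D) ->
  forall i z, 0 <= z <= l -> `|w i z - w' i z| <= th * D.
Proof.
move=> D0 cu cu' sw sw' uD.
have half (a a' b b' : bool -> R -> R) : (forall i, continuous (a i)) -> (forall i, continuous (a' i)) ->
    solves a b -> solves a' b' ->
    (forall i z, 0 <= z <= l -> `|a i z - a' i z| <= D) ->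
    forall i z, 0 <= z <= l -> b i z - b' i z - th * D <= 0.
  move=> ca ca' sb sb' aD.
  have [_ [v [db dv v0 bl vl]]] := sb ca.
  have [_ [v' [db' dv' v'0 b'l v'l]]] := sb' ca'.
  apply: (@glued_max R l (fun i z => b i z - b' i z - th * D)
    (fun i z => v i z - v' i z)
    (fun i z => (K * b i z - h a i z) - (K * b' i z - h a' i z))) => //.
  - move=> i z _; have d1 := derB (derB (db i z) (db' i z)) (der_cst (th * D) z).
    by apply: (derE d1); rewrite subr0.
  - move=> i z zl pos.
    have hD : h a i z - h a' i z <= (K - c) * D.
      rewrite /h clE //; set x := a i z; set y := a' i z.
      have := aD i z zl; rewrite -/x -/y ler_norml => /andP[xy1 xy2].
      have Kc : 0 <= K - c by rewrite subr_ge0.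
      have [xy|/ltW xy] := leP x y; have /andP[f1 f2] := FcK i xy; nra.
    have KD : K * (th * D) = (K - c) * D by rewrite /th; field; rewrite gt_eqF.
    have : K * (th * D) < K * (b i z - b' i z) by rewrite ltr_pM2l //; lra.
    by rewrite KD; lra.
  - by move=> i; rewrite v0 v'0 subrr.
  - by rewrite bl b'l.
  - lra.
move=> i z zl; have h1 := half _ _ _ _ cu cu' sw sw' uD i z zl.
have uD' j y : 0 <= y <= l -> `|u' j y - u j y| <= D by rewrite distrC; exact: uD.
have h2 := half _ _ _ _ cu' cu sw' sw uD' i z zl.
by rewrite ler_norml; lra.
Qed.

(** The iterates of the solution operator [T] converge geometrically to some [u], which [T] fixes on
    [[0, l]]. The solution returned is [T u], differentiable by construction. *)
Lemma monotone_glued_exists : exists u v, glued l F u v.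
Proof.
have [T TP] := choice solves_ex.
pose s n := iter n T (fun _ _ => 0).
have sc n i : continuous (s n i).
  elim: n i => [|n IH] i; first by move=> z; exact: cvg_cst.
  by have [H _] := TP (s n) IH; exact: H.
have [D D0 HD] : exists2 D, 0 <= D & forall i z, 0 <= z <= l -> `|s 1%N i z - s 0%N i z| <= D.
  have [D1 D10 H1] := itv_bounded (ltW l0) (sc 1%N true).
  have [D2 D20 H2] := itv_bounded (ltW l0) (sc 1%N false).
  exists (D1 + D2); first exact: addr_ge0.
  by move=> [] z zl; rewrite subr0; [have := H1 z zl | have := H2 z zl]; lra.
have sD n i z : 0 <= z <= l -> `|s n.+1 i z - s n i z| <= th ^+ n * D.
  elim: n i z => [|n IH] i z zl; first by rewrite expr0 mul1r; exact: HD.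
  have tD : 0 <= th ^+ n * D by case/andP: th01 => t0 _; rewrite mulr_ge0 // exprn_ge0.
  rewrite exprS -mulrA.
  exact: (@contracts (s n.+1) (s n) (s n.+2) (s n.+1) _ tD (sc _) (sc _) (TP _) (TP _) IH).
pose C := D / (1 - th).
have lim_ex (iz : bool * R) : exists y, forall n, `|s n iz.1 (cl iz.2) - y| <= th ^+ n * C.
  by apply: geometric_limit => // n; exact: sD.
have [U UP] := choice lim_ex.
pose u i z := U (i, z).
have uP n i z : `|u i z - s n i (cl z)| <= th ^+ n * C.
  by rewrite distrC; exact: (UP (i, z) n).
have cu i : continuous (u i).
  apply: approx_cont => e e0; have [n Hn] := geometric_small C th01 e0.
  exists (fun z => s n i (cl z)).
    by move=> z; apply: continuous_comp; [exact: cl_cont | exact: sc].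
  by move=> z; apply: le_trans (ltW Hn).
have [cw [v [dw dv v0 wl vl]]] := TP u cu.
have C0 : 0 <= C.
  by case/andP: th01 => ? ?; rewrite /C divr_ge0 // subr_ge0 ltW.
have wu i z : 0 <= z <= l -> T u i z = u i z.
  move=> zl; apply/eqP; rewrite -subr_eq0 -normr_eq0 eq_le normr_ge0 andbT.
  rewrite leNgt; apply/negP => pos.
  have e0 : 0 < `|T u i z - u i z| / 2 by rewrite divr_gt0.
  have [n Hn] := geometric_small C th01 e0.
  have h1 : `|T u i z - s n.+1 i z| <= th * (th ^+ n * C).
    have tC : 0 <= th ^+ n * C by case/andP: th01 => t0 _; rewrite mulr_ge0 // exprn_ge0.
    apply: (@contracts u (s n) (T u) (s n.+1) _ tC cu (sc _) (TP _) (TP _)) => //.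
    by move=> j y yl; have := uP n j y; rewrite clE.
  have h2 := uP n.+1 i z; rewrite clE // in h2.
  have h3 : th * (th ^+ n * C) <= th ^+ n * C.
    case/andP: th01 => t0 t1; have tl := ltW t1.
    by rewrite ler_piMl // mulr_ge0 // exprn_ge0.
  have h4 : th ^+ n.+1 * C <= th ^+ n * C by rewrite exprS -mulrA.
  have := ler_distD (s n.+1 i z) (T u i z) (u i z).
  by rewrite (distrC (s n.+1 i z)); lra.
exists (T u), v; split => //.
move=> i z zl; apply: (derE (dv i z)).
by rewrite /h clE // wu //; ring.
Qed.

End Contraction.
End MonotoneExistence.

(** * The equation for a prescribed junction value *)

Section Comparison.
Context {R : realType}.
Implicit Types (u v w F : bool -> R -> R) (a b c x y z l q : R).

Definition subsol l F u := exists v w,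
  [/\ forall i z, 0 <= z <= l -> is_derive z 1 (u i) (v i z),
      forall i z, 0 <= z <= l -> is_derive z 1 (v i) (w i z),
      forall i z, 0 <= z <= l -> F i (u i z) <= w i z &
      [/\ forall i, 0 <= v i 0, u true l = u false l & v true l + v false l <= 0]].

Definition supersol l F u := exists v w,
  [/\ forall i z, 0 <= z <= l -> is_derive z 1 (u i) (v i z),
      forall i z, 0 <= z <= l -> is_derive z 1 (v i) (w i z),
      forall i z, 0 <= z <= l -> w i z <= F i (u i z) &
      [/\ forall i, v i 0 <= 0, u true l = u false l & 0 <= v true l + v false l]].

Lemma glued_subsol l F u v : glued l F u v -> subsol l F u.
Proof.
move=> [du dv v0 ul vl]; exists v, (fun i z => F i (u i z)).
by split => //; split=> [i||]; rewrite ?v0 ?vl.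
Qed.

Lemma glued_supersol l F u v : glued l F u v -> supersol l F u.
Proof.
move=> [du dv v0 ul vl]; exists v, (fun i z => F i (u i z)).
by split => //; split=> [i||]; rewrite ?v0 ?vl.
Qed.

(** Monotonicity of [F] is used only where [u] exceeds [u'], with [u'] as the smaller argument;
    hence only the supersolution has to stay in the domain [P]. *)
Lemma glued_compare l F (P : R -> Prop) u u' : 0 < l ->
  (forall i x y, P x -> x < y -> F i x < F i y) ->
  subsol l F u -> supersol l F u' ->
  (forall i z, 0 <= z <= l -> P (u' i z)) ->
  forall i z, 0 <= z <= l -> u i z <= u' i z.
Proof.
move=> l0 Fi [v [w [du dv H [v0 ul vl]]]] [v' [w' [du' dv' H' [v'0 u'l v'l]]]] Pu' i z zl.
rewrite -subr_le0; move: i z zl.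
apply: (@glued_max R l (fun i z => u i z - u' i z) (fun i z => v i z - v' i z)
   (fun i z => w i z - w' i z)) => //.
- by move=> i z zl; exact: (derB (du i z zl) (du' i z zl)).
- by move=> i z zl; exact: (derB (dv i z zl) (dv' i z zl)).
- move=> i z zl; rewrite subr_gt0 => uu.
  by have := Fi i _ _ (Pu' i z zl) uu; have := H i z zl; have := H' i z zl; lra.
- by move=> i; have := v0 i; have := v'0 i; lra.
- by rewrite ul u'l.
- lra.
Qed.

Lemma powR_small (p d : R) : 0 < p -> 0 < d ->
  exists2 e, 0 < e <= 1 & e `^ p <= d.
Proof.
move=> p0 d0; exists (Num.min 1 (d `^ p^-1)).
  by rewrite lt_min ltr01 powR_gt0 //= ge_min lexx.
have h : Num.min 1 (d `^ p^-1) <= d `^ p^-1 by rewrite ge_min lexx orbT.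
have m0 : 0 <= Num.min 1 (d `^ p^-1) by rewrite le_min ler01 powR_ge0.
apply: (le_trans (ge0_ler_powR (ltW p0) _ _ h)); rewrite ?nnegrE ?powR_ge0 //.
by rewrite -powRrM mulVf ?gt_eqF // powRr1 // ltW.
Qed.

(** The Lichnerowicz equation solved for the second derivative. For [c > 0] it is singular at 0,
    which is why the existence proof truncates it. *)
Definition lichF q a c (x : R) := (a * x `^ (q - 1) - c * x `^ (- q - 1)) / (2 * q).

Definition dlichF q a c (x : R) :=
  (a * ((q - 1) * x `^ (q - 2)) + c * ((q + 1) * x `^ (- q - 2))) / (2 * q).

Lemma lichF_der q a c x : 0 < x -> is_derive x 1 (lichF q a c) (dlichF q a c x).
Proof.
move=> x0.
have d1 := is_derive1_powR (q - 1) x0; have d2 := is_derive1_powR (- q - 1) x0.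
have d := derB (derZ a d1) (derZ c d2).
have d' := derZ ((2 * q)^-1) d.
have E : (fun y => (2 * q)^-1 * (a * y `^ (q - 1) - c * y `^ (- q - 1))) = lichF q a c.
  by apply/funext => y; rewrite /lichF mulrC.
rewrite E in d'; apply: (derE d').
have -> : q - 1 - 1 = q - 2 by ring.
have -> : - q - 1 - 1 = - q - 2 by ring.
by rewrite /dlichF mulrC; congr (_ * _); ring.
Qed.

Lemma dlichF_gt0 q a c x : 2 < q -> 0 < a -> 0 <= c -> 0 < x -> 0 < dlichF q a c x.
Proof.
move=> q2 a0 c0 x0; rewrite /dlichF divr_gt0 //; last by lra.
have h1 : 0 < x `^ (q - 2) by exact: powR_gt0.
have h2 : 0 < x `^ (- q - 2) by exact: powR_gt0.
apply: ltr_wpDr.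
  by rewrite mulr_ge0 // mulr_ge0 ?ltW //; lra.
by rewrite mulr_gt0 // mulr_gt0 //; lra.
Qed.

Lemma lichF_incr q a c x y : 2 < q -> 0 < a -> 0 <= c -> 0 < x -> x < y ->
  lichF q a c x < lichF q a c y.
Proof.
move=> q2 a0 c0 x0 xy; apply: (@der_gt0_lt _ _ x y (dlichF q a c) xy).
  by move=> z /andP[xz _]; apply: lichF_der; exact: lt_le_trans xz.
by move=> z /andP[xz _]; apply: dlichF_gt0 => //; exact: lt_trans xz.
Qed.

Lemma lichF_bounds q a c (m M : R) : 2 < q -> 0 < a -> 0 <= c -> 0 < m -> m <= M ->
  exists k K : R, [/\ 0 < k, k <= K & forall x y, m <= x -> x <= y -> y <= M ->
    k * (y - x) <= lichF q a c y - lichF q a c x <= K * (y - x)].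
Proof.
move=> q2 a0 c0 m0 mM.
(* [k] drops the nonnegative [c] term; [K] takes the increasing power at [M] and the decreasing one
   at [m]. *)
pose k := a * ((q - 1) * m `^ (q - 2)) / (2 * q).
pose K := (a * ((q - 1) * M `^ (q - 2)) + c * ((q + 1) * m `^ (- q - 2))) / (2 * q).
have M0 : 0 < M by exact: lt_le_trans mM.
have i0 : 0 <= (2 * q)^-1 by rewrite invr_ge0; lra.
have kK x : m <= x <= M -> k <= dlichF q a c x <= K.
  move=> /andP[mx xM]; have x0 : 0 < x by exact: lt_le_trans mx.
  have h1 : m `^ (q - 2) <= x `^ (q - 2).
    by apply: ge0_ler_powR; rewrite ?nnegrE; lra.
  have h2 : x `^ (q - 2) <= M `^ (q - 2).
    by apply: ge0_ler_powR; rewrite ?nnegrE; lra.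
  have h3 : x `^ (- q - 2) <= m `^ (- q - 2).
    have -> : - q - 2 = - (q + 2) by ring.
    rewrite !powRN lef_pV2 ?posrE ?powR_gt0 //.
    by apply: ge0_ler_powR; rewrite ?nnegrE; lra.
  have h4 : 0 <= x `^ (- q - 2) by exact: powR_ge0.
  have q1 : 0 <= q - 1 by lra.
  have q3 : 0 <= q + 1 by lra.
  rewrite /dlichF; apply/andP; split; apply: ler_wpM2r => //.
    rewrite -[leLHS]addr0; apply: lerD; last by rewrite !mulr_ge0.
    by rewrite ler_pM2l //; apply: ler_wpM2l.
  by apply: lerD; [rewrite ler_pM2l //|]; do ?apply: ler_wpM2l.
exists k, K; split.
- by rewrite /k divr_gt0 ?mulr_gt0 ?powR_gt0 //; lra.
- by have /andP[h1 h2] := kK m (introT andP (conj (lexx m) mM)); exact: le_trans h2.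
move=> x y mx; rewrite le_eqVlt => /orP[/eqP -> _|xy yM].
  by rewrite !subrr !mulr0 lexx.
have [|d /andP[xd dy] ->] := @der_MVT _ (lichF q a c) x y (dlichF q a c) xy.
  by move=> z /andP[xz _]; apply: lichF_der; rewrite (lt_le_trans m0) // (le_trans mx).
have yx : 0 < y - x by rewrite subr_gt0.
have /kK/andP[h1 h2] : m <= d <= M by lra.
by apply/andP; split; rewrite (ler_pM2r yx).
Qed.

(** The argument is clamped to [[m, M]] and the function continued with slope [k] outside, so that
    the monotonicity and Lipschitz bounds become global. *)
Lemma truncation q a c (m M : R) : 2 < q -> 0 < a -> 0 <= c -> 0 < m -> m <= M ->
  exists (k K : R) (G : R -> R), [/\ 0 < k, k <= K,
    forall x, m <= x <= M -> G x = lichF q a c x &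
    forall x y, x <= y -> k * (y - x) <= G y - G x <= K * (y - x)].
Proof.
move=> q2 a0 c0 m0 mM; have [k [K [k0 kK H]]] := lichF_bounds q2 a0 c0 m0 mM.
pose cl x := Num.max m (Num.min x M).
exists k, K, (fun x => lichF q a c (cl x) + k * (x - cl x)); split => //.
  move=> x /andP[mx xM]; rewrite /cl (min_idPl xM) (max_idPr mx) subrr mulr0.
  by rewrite addr0.
move=> x y xy.
have clP z : [\/ z < m /\ cl z = m, m <= z <= M /\ cl z = z | M < z /\ cl z = M].
  rewrite /cl; case: (leP z M) => zM; last by constructor 3; rewrite (max_idPr mM).
  by case: (leP m z) => mz; [constructor 2 | constructor 1].
have h1 : cl x <= cl y.
  by case: (clP x) => -[? ->]; case: (clP y) => -[? ->]; lra.
have h2 : cl y - cl x <= y - x.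
  by case: (clP x) => -[? ->]; case: (clP y) => -[? ->]; lra.
have h3 z : m <= cl z <= M by rewrite /cl le_max lexx ge_max mM ge_min lexx orbT.
have /andP[mx xM] := h3 x; have /andP[my yM] := h3 y.
have /andP[e1 e2] := H _ _ mx h1 yM.
by apply/andP; split; nra.
Qed.

End Comparison.

(** * Solvability with given coefficients *)

Section LichnerowiczExistence.
Context {R : realType}.
Implicit Types (u v w F : bool -> R -> R) (x y z l q : R) (a c : bool -> R).

Lemma cst_subsol l F (m : R) : (forall i, F i m <= 0) -> subsol l F (fun _ _ => m).
Proof.
move=> H; exists (fun _ _ => 0), (fun _ _ => 0); split=> [i z _|i z _|i z _|]; [exact: der_cst|exact: der_cst|exact: H|].
by split=> //; rewrite addr0.
Qed.

Lemma cst_supersol l F (m : R) : (forall i, 0 <= F i m) -> supersol l F (fun _ _ => m).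
Proof.
move=> H; exists (fun _ _ => 0), (fun _ _ => 0); split=> [i z _|i z _|i z _|]; [exact: der_cst|exact: der_cst|exact: H|].
by split=> //; rewrite addr0.
Qed.

Lemma powRDp x r s : 0 < x -> x `^ (r + s) = x `^ r * x `^ s.
Proof. by move=> x0; rewrite powRD // (gt_eqF x0) implybT. Qed.

Lemma bool_max (f : bool -> R) : exists M : R, forall i, f i <= M.
Proof.
exists (Num.max (f true) (f false)) => i.
by rewrite le_max; case: i; rewrite lexx ?orbT.
Qed.

Lemma small_lich_up q (A a e W x : R) : 2 < q -> 0 < a -> a <= A -> 0 < e -> 1 < W ->
  e <= x <= e * W -> a * x `^ (q - 1) <= A * W `^ (q - 1) * e `^ (q - 2) * e.
Proof.
move=> q2 a0 aA e0 W1 /andP[ex xW].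
have W0 : 0 < W by exact: lt_trans W1.
have B1 : x `^ (q - 1) <= e `^ (q - 1) * W `^ (q - 1).
  rewrite -(powRM _ (ltW e0) (ltW W0)).
  apply: ge0_ler_powR; rewrite ?nnegrE //; first by clear -q2; lra.
    exact: le_trans (ltW e0) ex.
  by rewrite mulr_ge0 // ltW.
have eq1 : e `^ (q - 1) = e `^ (q - 2) * e.
  by rewrite -{3}(powRr1 (ltW e0)) -powRDp //; congr (_ `^ _); ring.
apply: (@le_trans _ _ (A * (e `^ (q - 1) * W `^ (q - 1)))).
  by apply: ler_pM => //; [exact: ltW | exact: powR_ge0].
by rewrite eq1 le_eqVlt; apply/orP; left; apply/eqP; ring.
Qed.

Lemma small_lich_down q (c e W x : R) : 2 < q -> 0 < c -> 0 < e -> 1 < W ->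
  e <= x <= e * W -> c * W `^ (- q - 1) <= c * x `^ (- q - 1) * e `^ (q + 1).
Proof.
move=> q2 c0 e0 W1 /andP[ex xW].
have W0 : 0 < W by exact: lt_trans W1.
have x0 : 0 < x by exact: lt_le_trans ex.
have eW : 0 < e * W by rewrite mulr_gt0.
have B2 : (e * W) `^ (- q - 1) <= x `^ (- q - 1).
  have -> : - q - 1 = - (q + 1) by ring.
  rewrite !powRN lef_pV2 ?posrE ?powR_gt0 //.
  by apply: ge0_ler_powR; rewrite ?nnegrE //; [clear -q2; lra | exact: ltW | exact: ltW].
have B3 : (e * W) `^ (- q - 1) * e `^ (q + 1) = W `^ (- q - 1).
  rewrite (powRM _ (ltW e0) (ltW W0)) mulrAC -powRDp //.
  have -> : - q - 1 + (q + 1) = 0 by ring.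
  by rewrite powRr0 mul1r.
have e1 : 0 < e `^ (q + 1) by exact: powR_gt0.
by rewrite -B3 -mulrA ler_pM2l // ler_pM2r.
Qed.

Lemma lich_large q (a c M : R) : 2 < q -> 0 < a -> 0 <= c -> 1 <= M -> c / a <= M ->
  0 <= lichF q a c M.
Proof.
move=> q2 a0 c0 M1 cM; have M0 : 0 < M by exact: lt_le_trans M1.
rewrite /lichF divr_ge0 //; last by clear -q2; lra.
have h1 : M <= M `^ (q - 1).
  by rewrite -{1}(powRr1 (ltW M0)); apply: ler_powR => //; clear -q2; lra.
have h2 : M `^ (- q - 1) <= 1.
  by rewrite -[leRHS](powRr0 M); apply: ler_powR => //; clear -q2; lra.
rewrite ler_pdivrMr // in cM; rewrite mulrC in cM.
have h7 : c * M `^ (- q - 1) <= c by rewrite ler_piMr.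
have h8 : a * M <= a * M `^ (q - 1) by rewrite ler_pM2l.
by rewrite subr_ge0 (le_trans h7) // (le_trans cM).
Qed.

(** Only one arm is sure to have [0 < c j], and where [c] vanishes no positive constant is a
    subsolution. A small profile, concave on the arm [j] and convex on the other, works: the
    curvature is of order [e], the power q - 1 > 1 is negligible against it, and the singular term
    on the arm [j] is large. Any [F] agreeing with [lichF] on the range is allowed, in view of the
    truncation. *)
Lemma lich_subsol q l a c : 2 < q -> 0 < l -> (forall i, 0 < a i) ->
  (forall i, 0 <= c i) -> (exists j, 0 < c j) ->
  exists (e W : R) s, [/\ 0 < e, forall i z, 0 <= z <= l -> e <= s i z <= e * W &
    forall F, (forall i x, e <= x <= e * W -> F i x = lichF q (a i) (c i) x) ->
      subsol l F s].
Proof.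
move=> q2 l0 a0 c0 [j cj].
have [A HA] := bool_max a.
have A0 : 0 < A by exact: lt_le_trans (HA true).
(* With this [W] the two parabolas stay in [[e, e * W]] and meet at [z = l]. *)
pose W := 1 + l ^+ 2.
have W1 : 1 < W by rewrite /W ltrDl exprn_gt0.
have W0 : 0 < W by exact: lt_trans W1.
have Wq : 0 < W `^ (q - 1) by exact: powR_gt0.
have Wq' : 0 < W `^ (- q - 1) by exact: powR_gt0.
have qp : 0 < 2 * q by clear -q2; lra.
pose D := A * W `^ (q - 1) + 2 * q.
have AW : 0 < A * W `^ (q - 1) by rewrite mulr_gt0.
have D0 : 0 < D by rewrite addr_gt0.
have [|e1 /andP[e10 e11] E1] := @powR_small R (q - 2) (2 * q / D) _ (divr_gt0 qp D0).
  by clear -q2; lra.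
have cW : 0 < c j * W `^ (- q - 1) by rewrite mulr_gt0.
have [|e2 /andP[e20 e21] E2] := @powR_small R (q + 1) (c j * W `^ (- q - 1) / D) _ (divr_gt0 cW D0).
  by clear -q2; lra.
(* [e1] keeps the positive power below the curvature [e]; [e2] makes the singular term on the arm
   [j] at least [D], enough to pay for that power and for the curvature. *)
pose e := Num.min e1 e2.
have e0 : 0 < e by rewrite lt_min e10.
have ee1 : e <= e1 by rewrite ge_min lexx.
have ee2 : e <= e2 by rewrite ge_min lexx orbT.
have el1 : e <= 1 by exact: le_trans e11.
have F1 : e `^ (q - 2) * D <= 2 * q.
  rewrite -ler_pdivlMr //; apply: le_trans E1.
  by apply: ge0_ler_powR; rewrite ?nnegrE //; [clear -q2; lra | exact: ltW | exact: ltW].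
have F2 : e `^ (q + 1) * D <= c j * W `^ (- q - 1).
  rewrite -ler_pdivlMr //; apply: le_trans E2.
  by apply: ge0_ler_powR; rewrite ?nnegrE //; [clear -q2; lra | exact: ltW | exact: ltW].
pose sg i : R := if i == j then -1 else 1.
pose s i z := e * ((if i == j then W else 1) + sg i * (z ^+ 2 / 2)).
have sB i z : 0 <= z <= l -> e <= s i z <= e * W.
  move=> /andP[z0 zl].
  have z2 : 0 <= z ^+ 2 by exact: sqr_ge0.
  have zl2 : z ^+ 2 <= l ^+ 2 by rewrite lerXn2r ?nnegrE // (le_trans z0).
  rewrite /s -{1}(mulr1 e) !ler_pM2l // /sg /W.
  by clear -z2 zl2; case: (i == j); apply/andP; split; lra.
exists e, W, s; split=> // F FE.
have ep2 : 0 < e `^ (q - 2) by exact: powR_gt0.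
have ep1 : 0 < e `^ (q + 1) by exact: powR_gt0.
exists (fun i z => e * (sg i * z)), (fun i _ => e * sg i); split.
- move=> i z _; have d := derM (der_id z) (der_id z).
  have d1 := derD (der_cst (if i == j then W else 1) z) (derZ (sg i / 2) d).
  have d2 := derZ e d1.
  have E : (fun y => e * ((if i == j then W else 1) + sg i / 2 * (y * y))) = s i.
    by apply/funext => y; rewrite /s; clear; ring.
  by rewrite E in d2; apply: (derE d2); clear; field.
- by move=> i z _; apply: (derE (derZ e (derZ (sg i) (der_id z)))); clear; ring.
- move=> i z zl; have sB' := sB i z zl; rewrite FE //.
  rewrite /lichF ler_pdivrMr //.
  have P1 := small_lich_up q2 (a0 i) (HA i) e0 W1 sB'.
  have e2q : A * W `^ (q - 1) * e `^ (q - 2) * e <= 2 * q * e.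
    rewrite ler_pM2r //; apply: le_trans F1.
    rewrite mulrC ler_pM2l // /D.
    by clear -qp; lra.
  have [ij|ij] := eqVneq i j; last first.
    rewrite /sg (negbTE ij) mulr1.
    have : 0 <= c i * (s i z) `^ (- q - 1) by rewrite mulr_ge0 // powR_ge0.
    by clear -P1 e2q; lra.
  have e2q' : A * W `^ (q - 1) * e `^ (q - 2) * e <= A * W `^ (q - 1).
    rewrite -mulrA ler_piMr ?(ltW AW) // mulr_ile1 ?(ltW ep2) ?(ltW e0) //.
    rewrite -[leRHS](powRr0 e); apply: ger_powR; rewrite ?e0 //.
    by clear -q2; lra.
  subst j.
  have P2 := small_lich_down q2 cj e0 W1 sB'.
  have P3 : D <= c i * (s i z) `^ (- q - 1).
    by rewrite -(ler_pM2l ep1) (le_trans F2) // (le_trans P2) // mulrC.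
  rewrite /sg eqxx.
  have qe : 2 * q * e <= 2 * q by rewrite ler_piMr // ltW.
  by move: P3; rewrite /D; clear -P1 e2q' qe; lra.
- split.
  + by move=> ?; rewrite !mulr0.
  + by rewrite /s /sg /W; clear; case: (j); rewrite /=; field.
  + by rewrite /sg; clear; case: (j) => /=; lra.
Qed.

(** The truncated problem is solved first; the subsolution and a large constant then confine its
    solution to [[e, M]], where the truncation is inactive. *)
Lemma lich_exists q l a c : 2 < q -> 0 < l -> (forall i, 0 < a i) ->
  (forall i, 0 <= c i) -> (exists j, 0 < c j) ->
  exists u v, glued l (fun i => lichF q (a i) (c i)) u v /\
    forall i z, 0 <= z <= l -> 0 < u i z.
Proof.
move=> q2 l0 a0 c0 hj.
have [e [W [s [e0 sB subs]]]] := lich_subsol q2 l0 a0 c0 hj.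
have [M0 HM0] := bool_max (fun i => c i / a i).
pose M := Num.max (Num.max 1 M0) (Num.max e (e * W)).
have M1 : 1 <= M by rewrite !le_max lexx.
have MM0 : M0 <= M by rewrite !le_max lexx orbT.
have MW : e * W <= M by rewrite !le_max lexx !orbT.
have eM : e <= M by rewrite !le_max lexx !orbT.
have [kt [Kt [Gt [kt0 ktK Gt1 Gt2]]]] := truncation q2 (a0 true) (c0 true) e0 eM.
have [kf [Kf [Gf [kf0 kfK Gf1 Gf2]]]] := truncation q2 (a0 false) (c0 false) e0 eM.
pose k := Num.min kt kf; pose K := Num.max Kt Kf; pose G i := if i then Gt else Gf.
have k0 : 0 < k by rewrite lt_min kt0.
have [kkt kkf] : k <= kt /\ k <= kf by rewrite !ge_min !lexx orbT.
have [KKt KKf] : Kt <= K /\ Kf <= K by rewrite !le_max !lexx orbT.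
have kK : k <= K by rewrite (le_trans kkt) // (le_trans ktK).
have G1 i x : e <= x <= M -> G i x = lichF q (a i) (c i) x.
  by case: i; [exact: Gt1 | exact: Gf1].
have G2 i x y : x <= y -> k * (y - x) <= G i y - G i x <= K * (y - x).
  move=> xy; have yx : 0 <= y - x by rewrite subr_ge0.
  have m1 := ler_wpM2r yx kkt; have m2 := ler_wpM2r yx kkf.
  have m3 := ler_wpM2r yx KKt; have m4 := ler_wpM2r yx KKf.
  case: i; [have /andP[h1 h2] := Gt2 _ _ xy | have /andP[h1 h2] := Gf2 _ _ xy].
    by rewrite (le_trans m1 h1) (le_trans h2 m3).
  by rewrite (le_trans m2 h1) (le_trans h2 m4).
have Gi i x y : True -> x < y -> G i x < G i y.
  move=> _ xy; have /andP[h _] := G2 i _ _ (ltW xy).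
  by rewrite -subr_gt0 (lt_le_trans _ h) // mulr_gt0 // subr_gt0.
have [u [v guv]] := monotone_glued_exists l0 k0 kK G2.
have lo i z : 0 <= z <= l -> s i z <= u i z.
  apply: (glued_compare (P := fun=> True) l0 Gi _ (glued_supersol guv)) => //.
  apply: subs => {}i x /andP[ex xW]; apply: G1.
  by rewrite ex (le_trans xW).
have hi i z : 0 <= z <= l -> u i z <= M.
  apply: (glued_compare (P := fun=> True) (u' := fun _ _ => M) l0 Gi (glued_subsol guv)) => //.
  apply: cst_supersol => {}i; rewrite G1 ?lexx ?andbT //.
  by apply: lich_large => //; exact: le_trans (HM0 i) MM0.
have eu i z : 0 <= z <= l -> e <= u i z.
  by move=> zl; apply: le_trans (lo i z zl); have /andP[] := sB i z zl.
exists u, v; split; last by move=> i z zl; exact: lt_le_trans (eu i z zl).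
case: guv => du dv v0 ul vl; split => // i z zl.
by rewrite -G1 ?hi ?eu //; exact: dv.
Qed.

End LichnerowiczExistence.

(** * Sign of the forcing, monotonicity and energy along an arm *)

Section ArmSigns.
Context {R : realType}.
Implicit Types (u v F : R -> R) (a c x y z l q : R).

Definition arm l F u v :=
  [/\ forall z, 0 <= z <= l -> is_derive z 1 u (v z),
      forall z, 0 <= z <= l -> is_derive z 1 v (F (u z)), v 0 = 0 &
      forall z, 0 <= z <= l -> 0 < u z].

Lemma glued_arm l (F u v : bool -> R -> R) i : glued l F u v ->
  (forall i z, 0 <= z <= l -> 0 < u i z) -> arm l (F i) (u i) (v i).
Proof. by move=> [du dv v0 _ _] u0; split; [exact: du|exact: dv|exact: v0|exact: u0]. Qed.

Lemma lichF_cont q a c x : 0 < x -> {for x, continuous (lichF q a c)}.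
Proof. by move=> x0; apply: der_cont (lichF_der q a c x0). Qed.

Lemma lichF_root q a c x y : 0 < x -> x <= y ->
  lichF q a c x < 0 -> 0 <= lichF q a c y ->
  exists2 s, x < s <= y & lichF q a c s = 0.
Proof.
move=> x0 xy fx fy.
have cf : {within `[x, y], continuous (lichF q a c)}.
  apply: continuous_in_subspaceT => z; rewrite inE /= in_itv /= => /andP[xz _].
  by apply: lichF_cont; by exact: lt_le_trans xz.
have [|s] := @IVT _ (lichF q a c) x y 0 xy cf.
  by apply/andP; split; [rewrite ge_min (ltW fx) | rewrite le_max fy orbT].
rewrite in_itv /= => /andP[xs sy] fs; exists s => //.
rewrite sy andbT lt_neqAle xs andbT; apply/eqP => xE.
by move: fx; rewrite xE fs ltxx.
Qed.

Section OneArm.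
Variables (q a c l : R) (u v : R -> R).

(** If the forcing were negative somewhere, [u] would lie there below a zero [s] of the forcing. The
    function [s - u] is convex where positive and has zero slope at the midpoint, so [u] would still
    be below [s] at the junction. *)
Lemma arm_sign_ge0 : 2 < q -> 0 < a -> 0 <= c -> 0 < l ->
  arm l (lichF q a c) u v -> 0 <= lichF q a c (u l) ->
  forall z, 0 <= z <= l -> 0 <= lichF q a c (u z).
Proof.
move=> q2 a0 c0 l0 [du dv v0 up] ul z0 z0l; rewrite leNgt; apply/negP => fz.
have ll : 0 <= l <= l by rewrite lexx ltW.
have uz0 := up _ z0l; have ul0 := up _ ll.
have zl : u z0 <= u l.
  rewrite leNgt; apply/negP => lz.
  by have := lichF_incr q2 a0 c0 ul0 lz; rewrite ltNge (le_trans (ltW fz) ul).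
have [s /andP[us sl] fs] := lichF_root uz0 zl fz ul.
have d1 y : 0 <= y <= l -> is_derive y 1 (fun y => s - u y) (0 - v y).
  by move=> yl; exact: (derB (der_cst s y) (du y yl)).
have d2 y : 0 <= y <= l -> is_derive y 1 (fun y => 0 - v y) (0 - lichF q a c (u y)).
  by move=> yl; exact: (derB (der_cst 0 y) (dv y yl)).
have [|||wl _] := convex_escape l0 d1 d2 _ _ z0l.
- move=> y yl; rewrite subr_gt0 sub0r oppr_gt0 -fs => us'.
  by apply: lichF_incr => //; exact: up.
- by left; rewrite v0 subrr.
- by rewrite subr_gt0.
by move: wl; rewrite subr_gt0 ltNge sl.
Qed.

Lemma arm_sign_le0 : 2 < q -> 0 < a -> 0 <= c -> 0 < l ->
  arm l (lichF q a c) u v -> lichF q a c (u l) <= 0 ->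
  forall z, 0 <= z <= l -> lichF q a c (u z) <= 0.
Proof.
move=> q2 a0 c0 l0 [du dv v0 up] ul z0 z0l; rewrite leNgt; apply/negP => fz.
have ll : 0 <= l <= l by rewrite lexx ltW.
have uz0 := up _ z0l; have ul0 := up _ ll.
have [s su us] : exists2 s, u l <= s < u z0 & 0 < s /\ lichF q a c s = 0.
  have [fl|fl] := eqVneq (lichF q a c (u l)) 0.
    exists (u l); last by [].
    rewrite lexx /= ltNge; apply/negP; rewrite le_eqVlt => /orP[/eqP zl|zl].
      by move: fz; rewrite zl fl ltxx.
    by have := lichF_incr q2 a0 c0 uz0 zl; rewrite fl ltNge ltW.
  have fl' : lichF q a c (u l) < 0 by rewrite lt_neqAle fl ul.
  have lz : u l <= u z0.
    rewrite leNgt; apply/negP => lz.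
    by have := lichF_incr q2 a0 c0 uz0 lz; rewrite ltNge (le_trans ul (ltW fz)).
  have [s /andP[us sz] fs] := lichF_root ul0 lz fl' (ltW fz).
  exists s; last by split => //; exact: lt_trans us.
  rewrite (ltW us) /= lt_neqAle sz andbT; apply/eqP => sE.
  by move: fz; rewrite -sE fs ltxx.
case: us => s0 fs; case/andP: su => us sz.
have d1 y : 0 <= y <= l -> is_derive y 1 (fun y => u y - s) (v y - 0).
  by move=> yl; exact: (derB (du y yl) (der_cst s y)).
have d2 y : 0 <= y <= l -> is_derive y 1 (fun y => v y - 0) (lichF q a c (u y) - 0).
  by move=> yl; exact: (derB (dv y yl) (der_cst 0 y)).
have [|||wl _] := convex_escape l0 d1 d2 _ _ z0l.
- move=> y yl; rewrite subr_gt0 subr0 -{1}fs => us'.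
  by apply: lichF_incr.
- by left; rewrite v0 subrr.
- by rewrite subr_gt0.
by move: wl; rewrite subr_gt0 ltNge us.
Qed.

(** Twice a primitive of [lichF q a c]; hence [v ^+ 2 - energy u] is constant along an arm. *)
Definition energy x := (a * x `^ q + c * x `^ (- q)) / q ^+ 2.

Lemma energy_der x : q != 0 -> 0 < x -> is_derive x 1 energy (2 * lichF q a c x).
Proof.
move=> q0 x0.
have d1 := is_derive1_powR q x0; have d2 := is_derive1_powR (- q) x0.
have d := derZ ((q ^+ 2)^-1) (derD (derZ a d1) (derZ c d2)).
have E : (fun y => (q ^+ 2)^-1 * (a * y `^ q + c * y `^ (- q))) = energy.
  by apply/funext => y; rewrite /energy mulrC.
by rewrite E in d; apply: (derE d); rewrite /lichF; field.
Qed.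

Lemma arm_energy z : 2 < q -> arm l (lichF q a c) u v -> 0 <= z <= l ->
  v z ^+ 2 = energy (u z) - energy (u 0).
Proof.
move=> q2 [du dv v0 up] /andP[z0 zl].
have q0 : q != 0 by rewrite gt_eqF //; lra.
have dE y : 0 <= y <= z -> is_derive y 1 (fun y => v y * v y - energy (u y)) 0.
  move=> /andP[y0 yz]; have yl : 0 <= y <= l by rewrite y0 (le_trans yz).
  have de := @der_comp R energy u y _ _ (energy_der q0 (up y yl)) (du y yl).
  by apply: (derE (derB (derM (dv y yl) (dv y yl)) de)); ring.
have := @der_eq0_cst R (fun y => v y * v y - energy (u y)) 0 z (fun=> 0) z0 dE (fun _ _ => erefl).
by rewrite v0 expr2; lra.
Qed.

Lemma arm_incr : 2 < q -> 0 < a -> 0 <= c -> 0 < l ->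
  arm l (lichF q a c) u v -> 0 <= lichF q a c (u l) ->
  (forall y z, 0 <= y -> y <= z -> z <= l -> v y <= v z) /\
  (forall y z, 0 <= y -> y <= z -> z <= l -> u y <= u z).
Proof.
move=> q2 a0 c0 l0 ar ul; have fz := arm_sign_ge0 q2 a0 c0 l0 ar ul.
case: ar => du dv v0 up.
have vi y z : 0 <= y -> y <= z -> z <= l -> v y <= v z.
  move=> y0 yz zl; apply: (@der_ge0_le _ v y z (fun x => lichF q a c (u x)) yz).
    by move=> x /andP[yx xz]; apply: dv; rewrite (le_trans y0 yx) (le_trans xz).
  by move=> x /andP[/ltW yx /ltW xz]; apply: fz; rewrite (le_trans y0 yx) (le_trans xz).
split => // y z y0 yz zl; apply: (@der_ge0_le _ u y z v yz).
  by move=> x /andP[yx xz]; apply: du; rewrite (le_trans y0 yx) (le_trans xz).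
move=> x /andP[/ltW yx /ltW xz]; rewrite -v0; apply: vi => //.
  exact: le_trans y0 yx.
exact: le_trans xz zl.
Qed.

Lemma arm_decr : 2 < q -> 0 < a -> 0 <= c -> 0 < l ->
  arm l (lichF q a c) u v -> lichF q a c (u l) <= 0 ->
  (forall y z, 0 <= y -> y <= z -> z <= l -> v z <= v y) /\
  (forall y z, 0 <= y -> y <= z -> z <= l -> u z <= u y).
Proof.
move=> q2 a0 c0 l0 ar ul; have fz := arm_sign_le0 q2 a0 c0 l0 ar ul.
case: ar => du dv v0 up.
have vi y z : 0 <= y -> y <= z -> z <= l -> v z <= v y.
  move=> y0 yz zl; rewrite -lerN2.
  apply: (@der_ge0_le _ (fun x => - v x) y z (fun x => - lichF q a c (u x)) yz).
    by move=> x /andP[yx xz]; apply/derN/dv; rewrite (le_trans y0 yx) (le_trans xz).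
  move=> x /andP[/ltW yx /ltW xz]; rewrite oppr_ge0.
  by apply: fz; rewrite (le_trans y0 yx) (le_trans xz).
split => // y z y0 yz zl; rewrite -lerN2.
apply: (@der_ge0_le _ (fun x => - u x) y z (fun x => - v x) yz).
  by move=> x /andP[yx xz]; apply/derN/du; rewrite (le_trans y0 yx) (le_trans xz).
move=> x /andP[/ltW yx /ltW xz]; rewrite oppr_ge0 -v0; apply: vi => //.
  exact: le_trans y0 yx.
exact: le_trans xz zl.
Qed.

(** The slope is nondecreasing from 0. If it vanished at [l], its positive derivative there would
    make it negative just before. *)
Lemma arm_slope_gt0 : 2 < q -> 0 < a -> 0 <= c -> 0 < l ->
  arm l (lichF q a c) u v -> 0 < lichF q a c (u l) -> 0 < v l.
Proof.
move=> q2 a0 c0 l0 ar ul.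
have ll : 0 <= l <= l by rewrite lexx ltW.
have [vi _] := arm_incr q2 a0 c0 l0 ar (ltW ul).
case: ar => du dv v0 up.
have vl : 0 <= v l by rewrite -v0; apply: vi => //; exact: ltW.
rewrite lt_neqAle vl andbT; apply/eqP => vl0.
have [e e0 He] := der_pos_local (dv l ll) ul.
pose h := Num.min (e / 2) l.
have h0 : 0 < h by rewrite lt_min l0 andbT divr_gt0.
have he : h < e by rewrite gt_min; apply/orP; left; lra.
have hl : h <= l by rewrite ge_min lexx orbT.
have [] := He h; first by rewrite h0.
rewrite -vl0 ltNge -{1}v0 => /negP + _; apply; apply: vi; lra.
Qed.

Lemma arm_slope_lt0 : 2 < q -> 0 < a -> 0 <= c -> 0 < l ->
  arm l (lichF q a c) u v -> lichF q a c (u l) < 0 -> v l < 0.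
Proof.
move=> q2 a0 c0 l0 ar ul.
have ll : 0 <= l <= l by rewrite lexx ltW.
have [vi _] := arm_decr q2 a0 c0 l0 ar (ltW ul).
case: ar => du dv v0 up.
have vl : v l <= 0 by rewrite -v0; apply: vi => //; exact: ltW.
rewrite lt_neqAle vl andbT; apply/eqP => vl0.
have dN : is_derive l 1 (fun x => - v x) (- lichF q a c (u l)) by exact/derN/dv.
have [|e e0 He] := der_pos_local dN; first by rewrite oppr_gt0.
pose h := Num.min (e / 2) l.
have h0 : 0 < h by rewrite lt_min l0 andbT divr_gt0.
have he : h < e by rewrite gt_min; apply/orP; left; lra.
have hl : h <= l by rewrite ge_min lexx orbT.
have [] := He h; first by rewrite h0.
rewrite ltrN2 vl0 ltNge -{1}v0 => /negP + _; apply; apply: vi; lra.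
Qed.

End OneArm.
End ArmSigns.

(** * Continuous dependence on the coefficients *)

Section Stability.
Context {R : realType}.
Implicit Types (u v w F : bool -> R -> R) (x y z l q : R) (a c : bool -> R).

Lemma arms_bounded l u : 0 < l ->
  (forall i z, 0 <= z <= l -> {for z, continuous (u i)}) ->
  (forall i z, 0 <= z <= l -> 0 < u i z) ->
  exists m M : R, 0 < m /\ forall i z, 0 <= z <= l -> m <= u i z <= M.
Proof.
move=> l0 cu up.
have cw i : {within `[0, l], continuous (u i)}.
  by apply: continuous_in_subspaceT => z; rewrite inE /= in_itv /=; exact: cu.
have H i : exists mM : R * R, 0 < mM.1 /\ forall z, 0 <= z <= l -> mM.1 <= u i z <= mM.2.
  have [y] := EVT_min (ltW l0) (cw i); rewrite in_itv /= => yl Hy.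
  have [x] := EVT_max (ltW l0) (cw i); rewrite in_itv /= => xl Hx.
  exists (u i y, u i x); split; first exact: up.
  by move=> z zl; rewrite /= Hy ?Hx // in_itv.
have [[m1 M1] /= [m10 H1]] := H true; have [[m2 M2] /= [m20 H2]] := H false.
exists (Num.min m1 m2), (Num.max M1 M2); split; first by rewrite lt_min m10.
move=> i z zl; case: i; rewrite ge_min le_max.
  by have /andP[-> ->] := H1 z zl.
by have /andP[-> ->] := H2 z zl; rewrite !orbT.
Qed.

(** On a compact range [lichF] grows at rate at least [k], so shifting [u] by [e] gains [k * e],
    which dominates the effect of a small change of [c]. Thus [u + e] and [u - e] are a super- and a
    subsolution for [c']. *)
Lemma lich_stable q l a c u v : 2 < q -> 0 < l -> (forall i, 0 < a i) ->
  (forall i, 0 <= c i) -> glued l (fun i => lichF q (a i) (c i)) u v ->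
  (forall i z, 0 <= z <= l -> 0 < u i z) -> forall e, 0 < e ->
  exists2 d, 0 < d & forall c' u' v', (forall i, 0 <= c' i) ->
    (forall i, `|c' i - c i| <= d) -> glued l (fun i => lichF q (a i) (c' i)) u' v' ->
    (forall i z, 0 <= z <= l -> 0 < u' i z) ->
    forall i z, 0 <= z <= l -> `|u' i z - u i z| <= e.
Proof.
move=> q2 l0 a0 c0 gu up e0' e0'0.
have [du dv v0 ul vl] := gu.
have [|m [M [m0 mM]]] := @arms_bounded l u l0 _ up.
  by move=> i z zl; exact: der_cont (du i z zl).
(* The reduction keeps [u - e] and [u + e] inside [[m / 2, M + 1]]. *)
pose e := Num.min e0' (Num.min 1 (m / 2)).
have e0 : 0 < e by rewrite !lt_min e0'0 ltr01 divr_gt0.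
have ee : e <= e0' by rewrite ge_min lexx.
have e1 : e <= 1 by rewrite !ge_min lexx orbT.
have em : e <= m / 2 by rewrite !ge_min lexx !orbT.
have m20 : 0 < m / 2 by rewrite divr_gt0.
have mM2 : m / 2 <= M + 1.
  by have /andP[h1 h2] := mM true 0 (introT andP (conj (lexx 0) (ltW l0))); lra.
have kex i : exists2 k : R, 0 < k & forall x y, m / 2 <= x -> x <= y -> y <= M + 1 ->
    k * (y - x) <= lichF q (a i) (c i) y - lichF q (a i) (c i) x.
  have [k [K [k0 kK H]]] := lichF_bounds q2 (a0 i) (c0 i) m20 mM2.
  by exists k => // x y h1 h2 h3; have /andP[] := H x y h1 h2 h3.
have [k1 k10 Hk1] := kex true; have [k2 k20 Hk2] := kex false.
pose k := Num.min k1 k2.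
have k0 : 0 < k by rewrite lt_min k10.
have [kk1 kk2] : k <= k1 /\ k <= k2 by rewrite !ge_min !lexx orbT.
have Hk i x y : m / 2 <= x -> x <= y -> y <= M + 1 ->
    k * (y - x) <= lichF q (a i) (c i) y - lichF q (a i) (c i) x.
  move=> h1 h2 h3; have yx : 0 <= y - x by rewrite subr_ge0.
  by case: i; [apply: le_trans (Hk1 x y h1 h2 h3) | apply: le_trans (Hk2 x y h1 h2 h3)];
    apply: ler_wpM2r.
pose s := (m / 2) `^ (- q - 1) / (2 * q).
have q0 : 0 < 2 * q by clear -q2; lra.
have s0 : 0 < s by rewrite divr_gt0 // powR_gt0.
exists (k * e / s); first by rewrite divr_gt0 // mulr_gt0.
move=> c' u' v' c'0 cc gu' up'.
have pert i x : m / 2 <= x ->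
    `|lichF q (a i) (c' i) x - lichF q (a i) (c i) x| <= k * e.
  move=> mx; have x0 : 0 < x by exact: lt_le_trans mx.
  have -> : lichF q (a i) (c' i) x - lichF q (a i) (c i) x =
    - ((c' i - c i) * (x `^ (- q - 1) / (2 * q))).
    by rewrite /lichF; ring.
  rewrite normrN normrM; have := cc i; rewrite ler_pdivlMr // => h.
  apply: le_trans h; apply: ler_wpM2l => //.
  rewrite ger0_norm ?divr_ge0 ?powR_ge0 ?(ltW q0) //.
  rewrite ler_pM2r ?invr_gt0 //.
  have -> : - q - 1 = - (q + 1) by ring.
  rewrite !powRN lef_pV2 ?posrE ?powR_gt0 //.
  by apply: ge0_ler_powR; rewrite ?nnegrE //; [clear -q2; lra | exact: ltW | exact: ltW].
have Fi i x y : 0 < x -> x < y -> lichF q (a i) (c' i) x < lichF q (a i) (c' i) y.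
  exact: lichF_incr.
have up1 i z : 0 <= z <= l -> u' i z <= u i z + e.
  apply: (glued_compare (P := fun x => 0 < x) l0 Fi (glued_subsol gu')
    (u' := fun i z => u i z + e)); last first.
    by move=> {}i {}z zl; rewrite addr_gt0 // up.
  exists (fun i z => v i z + 0), (fun i z => lichF q (a i) (c i) (u i z)); split.
  - by move=> {}i {}z zl; exact: (derD (du i z zl) (der_cst e z)).
  - move=> {}i {}z zl; apply: (derE (derD (dv i z zl) (der_cst 0 z))).
    by rewrite addr0.
  - move=> {}i {}z zl; have /andP[h1 h2] := mM i z zl.
    have h3 : m / 2 <= u i z by clear -h1 m0; lra.
    have h4 : u i z <= u i z + e by rewrite lerDl ltW.
    have h5 : u i z + e <= M + 1 by exact: lerD.
    have h6 := Hk i _ _ h3 h4 h5.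
    have := pert i (u i z + e) (le_trans h3 h4); rewrite ler_norml.
    by move: h6; clear; lra.
  - by split=> [{}i||]; rewrite ?v0 ?ul ?addr0 // vl.
have lo1 i z : 0 <= z <= l -> u i z - e <= u' i z.
  apply: (glued_compare (P := fun x => 0 < x) l0 Fi _ (glued_supersol gu')
    (u := fun i z => u i z - e)); last exact: up'.
  exists (fun i z => v i z - 0), (fun i z => lichF q (a i) (c i) (u i z)); split.
  - by move=> {}i {}z zl; exact: (derB (du i z zl) (der_cst e z)).
  - move=> {}i {}z zl; apply: (derE (derB (dv i z zl) (der_cst 0 z))).
    by rewrite subr0.
  - move=> {}i {}z zl; have /andP[h1 h2] := mM i z zl.
    have h3 : m / 2 <= u i z - e by clear -h1 em; lra.
    have h4 : u i z - e <= u i z by rewrite gerBl ltW.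
    have h5 : u i z <= M + 1 by apply: (le_trans h2); rewrite lerDl.
    have h6 := Hk i _ _ h3 h4 h5.
    have := pert i (u i z - e) h3; rewrite ler_norml.
    by move: h6; clear; lra.
  - by split=> [{}i||]; rewrite ?v0 ?ul ?subr0 // vl.
move=> i z zl; have := up1 i z zl; have := lo1 i z zl.
by rewrite ler_norml; clear -ee; lra.
Qed.

End Stability.

(** * Fixed points of the junction value *)

Section FixedPoint.
Context {R : realType}.
Implicit Types (u v : bool -> R -> R) (x y z l q t gam mu Z b : R).

Definition sgb (i : bool) : R := if i then 1 else -1.

(* For a solution, [w' / (2 N) = b (lambda + gamma_N)] with [b = phi(0)^q = phi(pi)^q].
   Hence the first equation reads [phi'' = lichF q a c phi] with [a = tau_t^2] and
   [c = 2 eta^2 / kappa + (mu + b (lambda + gamma_N))^2], constant on each half circle. *)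
Definition acoef t i := (t + sgb i) ^+ 2.

Definition ccoef Z mu gam b i := Z + (mu + b * (sgb i + gam)) ^+ 2.

Definition arms q l t gam mu Z b u v :=
  glued l (fun i => lichF q (acoef t i) (ccoef Z mu gam b i)) u v /\
  forall i z, 0 <= z <= l -> 0 < u i z.

Lemma acoef_gt0 t i : 1 < `|t| -> 0 < acoef t i.
Proof.
move=> t1; rewrite exprn_even_gt0 //=; apply/eqP => h.
have : `|t| = 1 by rewrite (_ : t = - sgb i) ?normrN; [rewrite /sgb; case: i {h}; rewrite ?normrN normr1 | lra].
by move=> E; rewrite E ltxx in t1.
Qed.

Lemma ccoef_ge0 Z mu gam b i : 0 <= Z -> 0 <= ccoef Z mu gam b i.
Proof. by move=> Z0; rewrite addr_ge0 // sqr_ge0. Qed.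

(** The bases of the two squares differ by [2 * b], so they cannot both vanish. *)
Lemma ccoef_some_gt0 Z mu gam b : 0 <= Z -> 0 < b -> (0 < Z \/ mu != 0) ->
  exists j, 0 < ccoef Z mu gam b j.
Proof.
move=> Z0 b0 [Zp|mu0]; first by exists true; rewrite ltr_wpDr // sqr_ge0.
have [h|h] := eqVneq (mu + b * (1 + gam)) 0; last first.
  by exists true; rewrite ltr_wpDl // exprn_even_gt0.
exists false; rewrite ltr_wpDl // exprn_even_gt0 //=; apply/eqP => h'.
by rewrite /sgb in h'; nra.
Qed.

Lemma arms_exist q l t gam mu Z b : 2 < q -> 0 < l -> 1 < `|t| -> 0 <= Z ->
  (0 < Z \/ mu != 0) -> 0 < b -> exists u v, arms q l t gam mu Z b u v.
Proof.
move=> q2 l0 t1 Z0 Zmu b0; apply: lich_exists => //.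
- by move=> i; exact: acoef_gt0.
- by move=> i; exact: ccoef_ge0.
- exact: ccoef_some_gt0.
Qed.

Lemma arms_unique q l t gam mu Z b u v u' v' : 2 < q -> 0 < l -> 1 < `|t| -> 0 <= Z ->
  arms q l t gam mu Z b u v -> arms q l t gam mu Z b u' v' ->
  forall i z, 0 <= z <= l -> u i z = u' i z.
Proof.
move=> q2 l0 t1 Z0 [gu up] [gu' up'] i z zl.
have Fi j x y : 0 < x -> x < y -> lichF q (acoef t j) (ccoef Z mu gam b j) x <
    lichF q (acoef t j) (ccoef Z mu gam b j) y.
  by apply: lichF_incr => //; [exact: acoef_gt0 | exact: ccoef_ge0].
apply/eqP; rewrite eq_le; apply/andP; split.
  exact: (glued_compare (P := fun x => 0 < x) l0 Fi (glued_subsol gu) (glued_supersol gu') up').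
exact: (glued_compare (P := fun x => 0 < x) l0 Fi (glued_subsol gu') (glued_supersol gu) up).
Qed.

(** Exchange of the two half circles; it is what allows [1 < t] instead of [1 < |t|]. *)
Lemma arms_flip q l t gam mu Z b u v : arms q l t gam mu Z b u v ->
  arms q l (- t) (- gam) (- mu) Z b (fun i => u (~~ i)) (fun i => v (~~ i)).
Proof.
move=> [[du dv v0 ul vl] up].
have aE i : acoef (- t) i = acoef t (~~ i) by rewrite /acoef /sgb; case: i => /=; ring.
have cE i : ccoef Z (- mu) (- gam) b i = ccoef Z mu gam b (~~ i).
  by rewrite /ccoef /sgb; case: i => /=; ring.
split; last by move=> i; exact: up.
split=> [i z zl|i z zl|i||].
- exact: du.
- by rewrite aE cE; exact: dv.
- exact: v0.
- by rewrite /= ul.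
- by rewrite /= addrC.
Qed.

(** As [b] tends to 0 both [ccoef] tend to [Z + mu ^+ 2 > 0]. So one constant [e] is a subsolution
    for all small [b], and [b] can be taken below e^q. *)
Lemma arms_small q l t gam mu Z : 2 < q -> 0 < l -> 1 < `|t| -> `|gam| < 1 -> 0 <= Z ->
  (0 < Z \/ mu != 0) ->
  exists2 b, 0 < b & forall u v, arms q l t gam mu Z b u v -> b < u true l `^ q.
Proof.
move=> q2 l0 t1 g1 Z0 Zmu.
have C0 : 0 < Z + mu ^+ 2.
  by case: Zmu => [Zp|mu0]; [rewrite ltr_wpDr // sqr_ge0 | rewrite ltr_wpDl // exprn_even_gt0].
pose C := Z + mu ^+ 2.
have [A HA] := bool_max (acoef t).
have A0 : 0 < A by apply: lt_le_trans (HA true); exact: acoef_gt0.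
have q0 : 0 < q by clear -q2; lra.
have [||e /andP[e0 e1] He] := @powR_small R (2 * q) (C / 2 / A).
- by rewrite mulr_gt0.
- by rewrite !divr_gt0.
have eq0 : 0 < e `^ q by exact: powR_gt0.
(* The factor 8 keeps the cross term [2 * (mu * (b * (sgb i + gam)))] within [C / 2], since
   [|sgb i + gam| <= 2]. *)
pose d := 8 * (`|mu| + 1).
have d0 : 0 < d by rewrite mulr_gt0 // ltr_wpDl.
pose b := Num.min (e `^ q / 2) (C / d).
have b0 : 0 < b by rewrite lt_min !divr_gt0.
have be : b < e `^ q by rewrite gt_min; apply/orP; left; clear -eq0; lra.
have bC : b * d <= C by rewrite -ler_pdivlMr // ge_min lexx orbT.
exists b => // u v [gu up].
have cC i : C / 2 <= ccoef Z mu gam b i.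
  have s2 : `|sgb i + gam| <= 2.
    by move: g1; rewrite ltr_norml ler_norml /sgb; clear; case: i; lra.
  have h1 : `|mu * (b * (sgb i + gam))| <= C / 4.
    rewrite !normrM (gtr0_norm b0).
    apply: (@le_trans _ _ (`|mu| * (b * 2))).
      by apply: ler_wpM2l => //; rewrite ler_pM2l.
    by move: bC (normr_ge0 mu) b0; rewrite /d; clear; nra.
  have h2 : 0 <= (b * (sgb i + gam)) ^+ 2 by exact: sqr_ge0.
  move: h1; rewrite ler_norml => /andP[h1 _].
  have -> : ccoef Z mu gam b i = C + 2 * (mu * (b * (sgb i + gam))) + (b * (sgb i + gam)) ^+ 2.
    by rewrite /ccoef /C; ring.
  by move: h1 h2; clear; lra.
have Fi j x y : 0 < x -> x < y -> lichF q (acoef t j) (ccoef Z mu gam b j) x <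
    lichF q (acoef t j) (ccoef Z mu gam b j) y.
  by apply: lichF_incr => //; [exact: acoef_gt0 | exact: ccoef_ge0].
have eu : e <= u true l.
  apply: (glued_compare (P := fun x => 0 < x) (u := fun _ _ => e) l0 Fi _ (glued_supersol gu) up).
    apply: cst_subsol => i; rewrite /lichF ler_pdivrMr ?mulr_gt0 // mul0r subr_le0.
    have ee : e `^ (q - 1) = e `^ (2 * q) * e `^ (- q - 1).
      by rewrite -powRDp //; congr (_ `^ _); ring.
    rewrite ee mulrA ler_pM2r ?powR_gt0 //; apply: le_trans (cC i).
    have := acoef_gt0 i t1 => ai.
    apply: (@le_trans _ _ (A * e `^ (2 * q))); first by rewrite ler_pM2r ?powR_gt0.
    by move: He; rewrite ler_pdivlMr // mulrC.
  by rewrite lexx ltW.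
apply: (lt_le_trans be); apply: ge0_ler_powR; rewrite ?nnegrE ?(ltW q0) ?(ltW e0) //.
by rewrite (le_trans (ltW e0)).
Qed.

(** Triangle inequality, with [|sgb i + gam| = 1 + sgb i * gam]. In this form [gam] cancels when the
    two arms are added. *)
Lemma sqrt_ccoef_le Z mu gam b i : 0 <= Z -> 0 <= b -> `|gam| < 1 ->
  Num.sqrt (ccoef Z mu gam b i) <= Num.sqrt Z + `|mu| + b * (1 + sgb i * gam).
Proof.
move=> Z0 b0 g1.
have sg0 : 0 <= 1 + sgb i * gam.
  by move: g1; rewrite ltr_norml /sgb; clear; case: i; lra.
have E : `|sgb i + gam| = 1 + sgb i * gam.
  rewrite -[RHS]ger0_norm //; case: (i); rewrite /sgb ?mul1r // mulN1r.
  by rewrite -normrN; congr (`|_|); ring.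
have rhs0 : 0 <= Num.sqrt Z + (`|mu| + b * (1 + sgb i * gam)).
  by rewrite !addr_ge0 ?sqrtr_ge0 // mulr_ge0.
rewrite -addrA -[leRHS]ger0_norm // -sqrtr_sqr; apply: ler_wsqrtr.
rewrite /ccoef -{1}(sqr_sqrtr Z0).
have h : (mu + b * (sgb i + gam)) ^+ 2 <= (`|mu| + b * (1 + sgb i * gam)) ^+ 2.
  rewrite -[leLHS]real_normK ?num_real // lerXn2r ?nnegrE ?addr_ge0 ?mulr_ge0 //.
  by apply: (le_trans (ler_normD _ _)); rewrite lerD2l normrM E ger0_norm.
have s0 : 0 <= Num.sqrt Z by exact: sqrtr_ge0.
have h2 : 0 <= `|mu| + b * (1 + sgb i * gam) by rewrite addr_ge0 // mulr_ge0.
have := mulr_ge0 s0 h2; move: h; clear; set s := _ + _; set r := _ + _; nra.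
Qed.

End FixedPoint.

(** * Large values of the junction parameter *)

Section LargeParameter.
Context {R : realType}.
Implicit Types (u v : bool -> R -> R) (x y z l q t gam mu Z b a c : R).

Lemma lichFE q a c x : 0 < x ->
  lichF q a c x = (a * x `^ q - c / x `^ q) / (x * (2 * q)).
Proof.
move=> x0.
have E1 : x `^ (q - 1) = x `^ q / x.
  by rewrite -{3}(powRr1 (ltW x0)) -powRN -powRDp.
have E2 : x `^ (- q - 1) = (x `^ q)^-1 / x.
  by rewrite -powRN -{3}(powRr1 (ltW x0)) -powRN -powRDp.
by rewrite /lichF E1 E2 [in RHS]invfM; ring.
Qed.

Lemma energyE q a c x : energy q a c x = (a * x `^ q + c / x `^ q) / q ^+ 2.
Proof. by rewrite /energy powRN. Qed.

Lemma lichF_gt0P q a c x : 0 < q -> 0 < x ->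
  (0 < lichF q a c x) = (c < a * (x `^ q) ^+ 2).
Proof.
move=> q0 x0; have X0 : 0 < x `^ q by exact: powR_gt0.
rewrite lichFE // pmulr_lgt0 ?invr_gt0 ?mulr_gt0 // subr_gt0 ltr_pdivrMr //.
by rewrite expr2 mulrA.
Qed.

Lemma lichF_ge0P q a c x : 0 < q -> 0 < x ->
  (0 <= lichF q a c x) = (c <= a * (x `^ q) ^+ 2).
Proof.
move=> q0 x0; have X0 : 0 < x `^ q by exact: powR_gt0.
rewrite lichFE // pmulr_lge0 ?invr_gt0 ?mulr_gt0 // subr_ge0 ler_pdivrMr //.
by rewrite expr2 mulrA.
Qed.

Lemma amgm_energy q al s x : 0 < q -> 0 <= al -> 0 <= s -> 0 < x ->
  2 * al * s <= q ^+ 2 * energy q (al ^+ 2) (s ^+ 2) x.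
Proof.
move=> q0 a0 s0 x0; have X0 : 0 < x `^ q by exact: powR_gt0.
rewrite energyE mulrCA divff ?mulr1 ?expf_neq0 ?gt_eqF //.
rewrite -subr_ge0.
have -> : al ^+ 2 * x `^ q + s ^+ 2 / x `^ q - 2 * al * s =
  (al * x `^ q - s) ^+ 2 / x `^ q by field; rewrite gt_eqF.
by rewrite divr_ge0 ?sqr_ge0 // ltW.
Qed.

Lemma arm_slope_ge q a c l (u v : R -> R) : 2 < q -> 0 < a -> 0 <= c -> 0 < l ->
  arm l (lichF q a c) u v -> 0 <= lichF q a c (u l) -> l * lichF q a c (u 0) <= v l.
Proof.
move=> q2 a0 c0 l0 ar ul; have [_ ui] := arm_incr q2 a0 c0 l0 ar ul.
case: ar => du dv v0 up.
have [d /andP[d0 dl] E] := der_MVT l0 dv.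
have -> : v l = l * lichF q a c (u d) by move: E; rewrite v0 !subr0 mulrC.
rewrite ler_pM2l //.
have : u 0 <= u d by apply: ui => //; exact: ltW.
have u00 : 0 < u 0 by apply: up; rewrite lexx ltW.
rewrite le_eqVlt => /orP[/eqP -> //|h]; apply/ltW.
exact: lichF_incr.
Qed.

(** Suppose [b <= X] with X = U^q at the junction. The slopes are opposite there, so the two energy
    identities can be subtracted; this keeps the midpoint of the arm [true] away from equilibrium.
    Its slope at [l] is then at least of order [X / U], while the energy allows at most the order of
    the square root of [X]. Hence X / U^2 = U^(q-2) is at most [K]. *)
Lemma arms_large q l t gam mu Z : 2 < q -> 0 < l -> 1 < t -> `|gam| < 1 -> 0 <= Z ->
  exists2 b0, 0 < b0 & forall b u v, b0 <= b -> arms q l t gam mu Z b u v ->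
    u true l `^ q < b.
Proof.
move=> q2 l0 t1 g1 Z0.
have q0 : 0 < q by clear -q2; lra.
pose r := Num.sqrt Z + `|mu|.
have r0 : 0 <= r by rewrite addr_ge0 ?sqrtr_ge0.
pose sg := (t - 1) / 2.
have sg0 : 0 < sg by rewrite divr_gt0 // subr_gt0.
(* This is the constant left by the two bounds on [v true l], namely 4 l^2 sg^4 X^2 / U^2 <= (t+1)^2
   X. *)
pose K := (t + 1) ^+ 2 / (4 * l ^+ 2 * sg ^+ 4).
have K0 : 0 < K.
  by rewrite divr_gt0 ?mulr_gt0 ?exprn_gt0 //; clear -t1; lra.
have p0 : 0 <= q / (q - 2) by rewrite divr_ge0 //; clear -q2; lra.
(* The first term makes [r <= sg * b]; the second exceeds every X = U^q with U^(q-2) <= K. *)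
exists (r / sg + K `^ (q / (q - 2)) + 1).
  by rewrite addr_gt0 // ltr_wpDl ?powR_gt0 // divr_ge0 // ltW.
move=> b u v b0b ar; rewrite ltNge; apply/negP => Xb.
have [gu up] := ar; have [du dv v0 ul vl] := gu.
have t1' : 1 < `|t| by apply: (lt_le_trans t1); exact: ler_norm.
have Kb : K `^ (q / (q - 2)) < b.
  have : 0 <= r / sg by rewrite divr_ge0 // ltW.
  by move: b0b; clear; lra.
have rb : r <= sg * b.
  rewrite mulrC -ler_pdivrMr //.
  by have := powR_ge0 K (q / (q - 2)); move: b0b; clear; lra.
have b0 : 0 < b by apply: le_lt_trans Kb; exact: powR_ge0.
have ll : 0 <= l <= l by rewrite lexx ltW.
have l00 : 0 <= (0 : R) <= l by apply/andP; split => //; exact: ltW.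
pose U := u true l; have U0 : 0 < U by exact: up.
pose X := U `^ q; have X0 : 0 < X by exact: powR_gt0.
have {}Xb : b <= X by [].
pose s i := Num.sqrt (ccoef Z mu gam b i).
have s0 i : 0 <= s i by exact: sqrtr_ge0.
have sE i : ccoef Z mu gam b i = s i ^+ 2 by rewrite sqr_sqrtr // ccoef_ge0.
have sle i : s i <= r + b * (1 + sgb i * gam) by apply: sqrt_ccoef_le => //; exact: ltW.
have a0 i : 0 < acoef t i by exact: acoef_gt0.
have c0 i : 0 <= ccoef Z mu gam b i by exact: ccoef_ge0.
have arp := glued_arm true gu up; have arm := glued_arm false gu up.
have st := sle true; have sf := sle false; rewrite /sgb in st sf.
have st' : s true < (t + 1) * X.
  have : 1 + gam < 2 by move: g1; rewrite ltr_norml; clear; lra.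
  by move: st rb Xb b0 t1; rewrite /sg; clear; nra.
have Fp : 0 < lichF q (acoef t true) (ccoef Z mu gam b true) (u true l).
  rewrite lichF_gt0P // -/U -/X sE /acoef /sgb -exprMn.
  by rewrite ltrXn2r ?nnegrE // mulr_ge0 ?(ltW X0) //; clear -t1; lra.
have vp := arm_slope_gt0 q2 (a0 _) (c0 _) l0 arp Fp.
have vm : v false l = - v true l by move: vl; clear; lra.
have Fm : lichF q (acoef t false) (ccoef Z mu gam b false) (u false l) < 0.
  rewrite ltNge; apply/negP => F0.
  have [vi _] := arm_incr q2 (a0 _) (c0 _) l0 arm F0.
  have := vi 0 l (lexx 0) (ltW l0) (lexx l).
  by rewrite v0 vm oppr_ge0 leNgt vp.
have Q0 : (t - 1) * X < s false.
  move: Fm; rewrite ltNge lichF_ge0P //; last exact: up.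
  rewrite -ul -/U -/X sE /acoef /sgb -exprMn -ltNge.
  have tX : 0 <= (t - 1) * X by rewrite mulr_ge0 ?(ltW X0) //; clear -t1; lra.
  by rewrite ltr_pXn2r ?nnegrE //.
have e1 := arm_energy q2 arp ll; have e2 := arm_energy q2 arm ll.
have u00 := up true 0 l00; have u00' := up false 0 l00.
have am := @amgm_energy q (t - 1) (s false) (u false 0) q0 _ (s0 _) u00'.
have {}am : 2 * (t - 1) * s false <= q ^+ 2 * energy q (acoef t false) (ccoef Z mu gam b false) (u false 0).
  by rewrite sE; apply: am; clear -t1; lra.
pose Y := u true 0 `^ q; have Y0 : 0 < Y by exact: powR_gt0.
have qn : q != 0 by rewrite gt_eqF.
have Xn : X != 0 by rewrite gt_eqF.
have Yn : Y != 0 by rewrite gt_eqF.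
have h1 : q ^+ 2 * v true l ^+ 2 =
    ((t + 1) * X - s true) ^+ 2 / X - ((t + 1) * Y - s true) ^+ 2 / Y.
  rewrite e1 !energyE -/U -/X -/Y sE /acoef /sgb.
  by field; rewrite ?qn ?Xn ?Yn.
have h2 : q ^+ 2 * v true l ^+ 2 <= (s false - (t - 1) * X) ^+ 2 / X.
  have -> : v true l ^+ 2 = v false l ^+ 2 by rewrite vm sqrrN.
  rewrite e2 mulrBr.
  have -> : q ^+ 2 * energy q (acoef t false) (ccoef Z mu gam b false) (u false l) =
     (t - 1) ^+ 2 * X + s false ^+ 2 / X.
    rewrite energyE -ul -/U -/X sE /acoef /sgb.
    by field; rewrite ?qn ?Xn.
  apply: (@le_trans _ _ ((t - 1) ^+ 2 * X + s false ^+ 2 / X - 2 * (t - 1) * s false)).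
    by rewrite lerD2l lerN2.
  by rewrite le_eqVlt; apply/orP; left; apply/eqP; field.
have P0 : 0 < (t + 1) * X - s true by rewrite subr_gt0.
(* [gam] cancels in [s true + s false], which is at most [2 * r + 2 * b], against a total of
   [2 * t * X] from the other terms. *)
have PQ : 2 * sg * X <= ((t + 1) * X - s true) - (s false - (t - 1) * X).
  by move: st sf rb Xb sg0; rewrite /sg; clear; nra.
(* The difference of [h1] and [h2], using P^2 - Q^2 >= (P - Q)^2 for P >= Q >= 0. *)
have h3 : 4 * sg ^+ 2 * X <= ((t + 1) * Y - s true) ^+ 2 / Y.
  have h4 : 4 * sg ^+ 2 * X <= ((t + 1) * X - s true) ^+ 2 / X - (s false - (t - 1) * X) ^+ 2 / X.
    rewrite -mulrBl ler_pdivlMr //.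
    have Q0' : 0 < s false - (t - 1) * X by rewrite subr_gt0.
    have sX : 0 < sg * X by rewrite mulr_gt0.
    move: PQ P0 Q0' sX.
    set P := _ - s true; set Q := _ - (t - 1) * X; set w := sg * X.
    move=> PQ P0 Q0' sX.
    have -> : 4 * sg ^+ 2 * X * X = (2 * w) ^+ 2 by rewrite /w; ring.
    have PQ' : 2 * w <= P - Q by rewrite /w mulrA.
    by clear -PQ' P0 Q0' sX; nra.
  by move: h1 h2 h4; clear; lra.
have FY := arm_sign_ge0 q2 (a0 _) (c0 _) l0 arp (ltW Fp) l00.
have sY : s true <= (t + 1) * Y.
  move: FY; rewrite lichF_ge0P // -/Y sE /acoef /sgb -exprMn.
  by rewrite ler_pXn2r ?nnegrE // mulr_ge0 ?(ltW Y0) //; clear -t1; lra.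
have [_ ui] := arm_incr q2 (a0 _) (c0 _) l0 arp (ltW Fp).
have uU : u true 0 <= U by apply: ui => //; exact: ltW.
have h5 : 2 * sg ^+ 2 * X / (q * U) <= lichF q (acoef t true) (ccoef Z mu gam b true) (u true 0).
  rewrite lichFE // -/Y sE /acoef /sgb.
  have -> : 2 * sg ^+ 2 * X / (q * U) = (4 * sg ^+ 2 * X) / (U * (2 * q)).
    by field; rewrite !gt_eqF.
  apply: (@le_trans _ _ ((4 * sg ^+ 2 * X) / (u true 0 * (2 * q)))).
    apply: ler_wpM2l.
      by apply: mulr_ge0; [rewrite mulr_ge0 ?sqr_ge0 | exact: ltW].
    have d0 : 0 < u true 0 * (2 * q) by rewrite !mulr_gt0.
    have d1 : 0 < U * (2 * q) by rewrite !mulr_gt0.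
    rewrite lef_pV2 ?posrE //; apply: ler_wpM2r => //.
    by rewrite mulr_ge0 // ltW.
  rewrite ler_pM2r ?invr_gt0 ?mulr_gt0 //; apply: (le_trans h3).
  rewrite ler_pdivrMr // mulrBl divfK //.
  by have := s0 true; move: sY; clear; set w := (t + 1) * Y; rewrite (_ : (t + 1) ^+ 2 * Y * Y = w ^+ 2); [nra | rewrite /w; ring].
have h6 : l * (2 * sg ^+ 2 * X / (q * U)) <= v true l.
  apply: le_trans (arm_slope_ge q2 (a0 _) (c0 _) l0 arp (ltW Fp)).
  by rewrite ler_pM2l.
have h7 : q ^+ 2 * v true l ^+ 2 <= (t + 1) ^+ 2 * X.
  rewrite h1; apply: (@le_trans _ _ (((t + 1) * X - s true) ^+ 2 / X)).
    by rewrite gerBl divr_ge0 ?sqr_ge0 // ltW.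
  rewrite ler_pdivrMr // (_ : (t + 1) ^+ 2 * X * X = ((t + 1) * X) ^+ 2); last by ring.
  rewrite lerXn2r ?nnegrE ?(ltW P0) ?gerBl //.
  by rewrite mulr_ge0 ?(ltW X0) //; clear -t1; lra.
have h8 : (2 * l * sg ^+ 2 * X / U) ^+ 2 <= (t + 1) ^+ 2 * X.
  apply: le_trans h7; rewrite -exprMn lerXn2r ?nnegrE //.
  - have [l0' X0' U0'] : [/\ 0 <= l, 0 <= X & 0 <= U] by split; exact: ltW.
    by rewrite divr_ge0 // mulr_ge0 // mulr_ge0 ?sqr_ge0 // mulr_ge0.
  - by apply: mulr_ge0; exact: ltW.
  - apply: le_trans (ler_wpM2l (ltW q0) h6).
    by rewrite le_eqVlt; apply/orP; left; apply/eqP; field; rewrite !gt_eqF.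
have h9 : U `^ (q - 2) <= K.
  have XU : X = U `^ (q - 2) * U ^+ 2.
    by rewrite -(powR_mulrn 2 (ltW U0)) -powRDp //; congr (_ `^ _); ring.
  have d0 : 0 < 4 * l ^+ 2 * sg ^+ 4.
    by apply: mulr_gt0; [apply: mulr_gt0 => //; exact: exprn_gt0 | exact: exprn_gt0].
  rewrite /K (ler_pdivlMr _ _ d0).
  rewrite -(ler_pM2r X0); apply: le_trans h8.
  rewrite {2}XU le_eqVlt; apply/orP; left; apply/eqP.
  by rewrite XU; field; rewrite gt_eqF.
have : X <= K `^ (q / (q - 2)).
  have -> : X = (U `^ (q - 2)) `^ (q / (q - 2)).
    rewrite -powRrM; congr (_ `^ _); field.
    by clear -q2; rewrite gt_eqF //; lra.
  by apply: ge0_ler_powR; rewrite ?nnegrE ?powR_ge0 // ?(ltW K0).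
by rewrite leNgt (lt_le_trans Kb).
Qed.

End LargeParameter.

(** * Existence of a fixed point by the intermediate value theorem *)

Section FixedPointExistence.
Context {R : realType}.
Implicit Types (u v : bool -> R -> R) (x y z l q t gam mu Z b a c : R).

Lemma ccoef_cont Z mu gam i : continuous (fun b => ccoef Z mu gam b i).
Proof.
move=> b.
have d := derD (der_cst Z b) (derM (derD (der_cst mu b) (derM (der_id b) (der_cst (sgb i + gam) b)))
  (derD (der_cst mu b) (derM (der_id b) (der_cst (sgb i + gam) b)))).
exact: der_cont d.
Qed.

Lemma arms_stable q l t gam mu Z b u v : 2 < q -> 0 < l -> 1 < `|t| -> 0 <= Z ->
  arms q l t gam mu Z b u v -> forall e, 0 < e ->
  \forall b' \near b, forall u' v', arms q l t gam mu Z b' u' v' ->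
    forall i z, 0 <= z <= l -> `|u' i z - u i z| <= e.
Proof.
move=> q2 l0 t1 Z0 [gu up] e e0.
have [|i|d d0 H] := lich_stable q2 l0 _ _ gu up e0.
- by move=> i; exact: acoef_gt0.
- exact: ccoef_ge0.
near=> b' => u' v' [gu' up'].
apply: (H _ u' v' _ _ gu' up') => i; first exact: ccoef_ge0.
rewrite distrC; have : `|ccoef Z mu gam b true - ccoef Z mu gam b' true| < d.
  by near: b'; move/cvgrPdist_lt: (@ccoef_cont Z mu gam true b); exact.
have : `|ccoef Z mu gam b false - ccoef Z mu gam b' false| < d.
  by near: b'; move/cvgrPdist_lt: (@ccoef_cont Z mu gam false b); exact.
by case: i => /ltW ? /ltW.
Unshelve. all: by end_near. Qed.

Lemma arms_value_cont q l t gam mu Z (val : R -> R) b : 2 < q -> 0 < l -> 1 < `|t| ->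
  0 <= Z -> (0 < Z \/ mu != 0) ->
  (forall b, 0 < b -> exists u v, arms q l t gam mu Z b u v /\ u true l = val b) ->
  0 < b -> {for b, continuous val}.
Proof.
move=> q2 l0 t1 Z0 Zmu valP b0; apply/cvgrPdist_le => e e0.
have [u [v [ar <-]]] := valP b b0.
have H := arms_stable q2 l0 t1 Z0 ar e0.
near=> b'.
have b'0 : 0 < b' by near: b'; exact: lt_nbhsr.
have [u' [v' [ar' <-]]] := valP b' b'0.
rewrite distrC; move: u' v' ar'; near: b'.
apply: filterS H => b' H u' v' ar'; apply: (H u' v' ar').
by rewrite lexx ltW.
Unshelve. all: by end_near. Qed.

Lemma arms_value q l t gam mu Z : 2 < q -> 0 < l -> 1 < `|t| -> 0 <= Z ->
  (0 < Z \/ mu != 0) -> exists val : R -> R,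
  forall b, 0 < b -> exists u v, arms q l t gam mu Z b u v /\ u true l = val b.
Proof.
move=> q2 l0 t1 Z0 Zmu.
have [f Hf] : {f : R -> R & forall b, 0 < b ->
    exists u v, arms q l t gam mu Z b u v /\ u true l = f b}.
  apply: (@choice _ _ (fun b y => 0 < b ->
    exists u v, arms q l t gam mu Z b u v /\ u true l = y)) => b; have [b0|b0] := ltP 0 b; last by exists 0.
  have [u [v ar]] := arms_exist gam q2 l0 t1 Z0 Zmu b0.
  by exists (u true l) => _; exists u, v.
by exists f.
Qed.

Lemma arms_fixed_point_gt1 q l t gam mu Z : 2 < q -> 0 < l -> 1 < t -> `|gam| < 1 ->
  0 <= Z -> (0 < Z \/ mu != 0) ->
  exists b u v, [/\ 0 < b, arms q l t gam mu Z b u v & u true l `^ q = b].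
Proof.
move=> q2 l0 t1 g1 Z0 Zmu.
have t1' : 1 < `|t| by apply: (lt_le_trans t1); exact: ler_norm.
have [val valP] := arms_value gam q2 l0 t1' Z0 Zmu.
have [b1 b10 H1] := arms_small q2 l0 t1' g1 Z0 Zmu.
have [b2' b20' H2] := arms_large mu q2 l0 t1 g1 Z0.
pose b2 := Num.max b1 b2'.
have b12 : b1 <= b2 by rewrite le_max lexx.
have b22 : b2' <= b2 by rewrite le_max lexx orbT.
have valp b : 0 < b -> 0 < val b.
  move=> b0; have [u [v [[_ up] <-]]] := valP b b0; apply: up.
  by rewrite lexx ltW.
have h1 : b1 < val b1 `^ q.
  by have [u [v [ar <-]]] := valP b1 b10; exact: H1 ar.
have h2 : val b2 `^ q < b2.
  have [u [v [ar <-]]] := valP b2 (lt_le_trans b10 b12); exact: H2 ar.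
have cf : {within `[b1, b2], continuous (fun b => val b `^ q - b)}.
  apply: continuous_in_subspaceT => b; rewrite inE /= in_itv /= => /andP[bb _].
  have b0 : 0 < b by exact: lt_le_trans bb.
  apply: (@continuousB _ _ _ (fun b => val b `^ q) (fun b => b)); last exact: cvg_id.
  apply: (@continuous_comp _ _ _ val (fun x => x `^ q)).
    exact: arms_value_cont valP b0.
  apply: (@der_cont _ _ _ (q * val b `^ (q - 1))).
  by apply: is_derive1_powR; exact: valp.
have [|b] := @IVT _ (fun b => val b `^ q - b) b1 b2 0 b12 cf.
  apply/andP; split; [rewrite ge_min | rewrite le_max].
    by apply/orP; right; rewrite subr_le0 ltW.
  by apply/orP; left; rewrite subr_ge0 ltW.
rewrite in_itv /= => /andP[bb _] /eqP; rewrite subr_eq0 => /eqP E.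
have b0 : 0 < b by exact: lt_le_trans bb.
have [u [v [ar uE]]] := valP b b0.
by exists b, u, v; split => //; rewrite uE.
Qed.

Lemma arms_fixed_point q l t gam mu Z : 2 < q -> 0 < l -> 1 < `|t| -> `|gam| < 1 ->
  0 <= Z -> (0 < Z \/ mu != 0) ->
  exists b u v, [/\ 0 < b, arms q l t gam mu Z b u v & u true l `^ q = b].
Proof.
move=> q2 l0 t1 g1 Z0 Zmu.
have [t0|t0] := lerP 0 t.
  by apply: arms_fixed_point_gt1 => //; rewrite ger0_norm in t1.
have t1' : 1 < - t by rewrite -ltr0_norm.
have g1' : `|- gam| < 1 by rewrite normrN.
have Zmu' : 0 < Z \/ - mu != 0 by rewrite oppr_eq0.
have [b [u [v [b0 ar uE]]]] := arms_fixed_point_gt1 q2 l0 t1' g1' Z0 Zmu'.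
exists b, (fun i => u (~~ i)), (fun i => v (~~ i)); split => //.
  by have := arms_flip ar; rewrite !opprK.
by case: ar => -[_ _ _ <- _] _.
Qed.

End FixedPointExistence.

(** * Uniqueness of the junction value *)

Section Matching.
Context {R : realType}.
Implicit Types (u v : bool -> R -> R) (x y z l q t gam Z b a c h : R).

(** Taken at [Z / b ^+ 2], this is [ccoef / b ^+ 2] for [mu = 0]: at a fixed point [b] scales out of
    the energies. *)
Definition ncoef Z gam i := Z + (sgb i + gam) ^+ 2.

Lemma ccoef_ncoef Z gam b i : b != 0 -> ccoef Z 0 gam b i = b ^+ 2 * ncoef (Z / b ^+ 2) gam i.
Proof. by move=> b0; rewrite /ccoef /ncoef; field. Qed.

Lemma ncoef_ge0 Z gam i : 0 <= Z -> 0 <= ncoef Z gam i.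
Proof. by move=> Z0; rewrite addr_ge0 // sqr_ge0. Qed.

(** For [s] the slope at the junction, this is the energy gained from midpoint to junction, in units
    of [b / q ^+ 2]. *)
Definition hgap q b s := q ^+ 2 * s ^+ 2 / b.

(* Subtracting the conserved energies of the two arms at heights of equal slope,
   the squared forcings differ by an affine function of the energy. *)
Lemma forcing_gap t gam Z b w :
  (b * (acoef t true + ncoef Z gam true) - w) ^+ 2
    - 4 * acoef t true * ncoef Z gam true * b ^+ 2
  - ((b * (acoef t false + ncoef Z gam false) - w) ^+ 2
    - 4 * acoef t false * ncoef Z gam false * b ^+ 2) =
  8 * b * ((t + gam) * ((t - gam) ^+ 2 * b - w) - Z * (t - gam) * b).
Proof. by rewrite /acoef /ncoef /sgb; ring. Qed.

(** With [1 < t], the condition [t + gam < 2] means (t-1)^2 < (1-gam)^2, so the forcing on the arm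
    [false] is negative at the junction whatever [Z >= 0] is. The junction condition dictates the
    remaining signs. *)
Lemma arms_bad_signs q l t gam Z b u v : 2 < q -> 0 < l -> 1 < t -> 0 <= Z ->
  0 < b -> t + gam < 2 -> arms q l t gam 0 Z b u v -> u true l `^ q = b ->
  [/\ 0 < v true l, v false l = - v true l,
      0 < lichF q (acoef t true) (ccoef Z 0 gam b true) (u true l) &
      lichF q (acoef t false) (ccoef Z 0 gam b false) (u false l) < 0].
Proof.
move=> q2 l0 t1 Z0 b0 bad [gu up] uE; have [du dv v0 ul vl] := gu.
have q0 : 0 < q by clear -q2; lra.
have t1' : 1 < `|t| by apply: (lt_le_trans t1); exact: ler_norm.
have ll : 0 <= l <= l by rewrite lexx ltW.
have a0 i : 0 < acoef t i by exact: acoef_gt0.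
have c0 i : 0 <= ccoef Z 0 gam b i by exact: ccoef_ge0.
have arp := glued_arm true gu up; have arm := glued_arm false gu up.
have Fm : lichF q (acoef t false) (ccoef Z 0 gam b false) (u false l) < 0.
  rewrite ltNge lichF_ge0P //; last exact: up.
  rewrite -ul uE -ltNge /ccoef /acoef /sgb add0r exprMn mulrC.
  apply: ltr_wpDl => //; rewrite ltr_pM2l ?exprn_gt0 //.
  by clear -bad t1; nra.
have vm := arm_slope_lt0 q2 (a0 _) (c0 _) l0 arm Fm.
have vE : v false l = - v true l by move: vl; clear; lra.
have vp : 0 < v true l by rewrite vE oppr_lt0 in vm.
split => //; rewrite ltNge; apply/negP => F0.
have [vi _] := arm_decr q2 (a0 _) (c0 _) l0 arp F0.
by have := vi 0 l (lexx 0) (ltW l0) (lexx l); rewrite v0 leNgt vp.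
Qed.

Lemma energy_scaled q t gam Z b U i : 0 < q -> 0 < b -> U `^ q = b ->
  q ^+ 2 * energy q (acoef t i) (ccoef Z 0 gam b i) U =
  b * (acoef t i + ncoef (Z / b ^+ 2) gam i).
Proof.
move=> q0 b0 UE; have bn : b != 0 by rewrite gt_eqF.
have qn : q != 0 by rewrite gt_eqF.
by rewrite energyE UE ccoef_ncoef //; field; rewrite ?qn ?bn.
Qed.

(** If the inequality failed, [forcing_gap] would make the forcing of the arm [true] outweigh the
    other wherever the two slopes cancel. The sum of the slopes, 0 at the midpoints, would then
    cross 0 only upwards and be positive at [l]. *)
Lemma arms_bad_match q l t gam Z b u v : 2 < q -> 0 < l -> 1 < t -> 0 <= Z ->
  0 < b -> -1 < gam -> t + gam < 2 -> arms q l t gam 0 Z b u v -> u true l `^ q = b ->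
  (t + gam) * ((t - gam) ^+ 2 - hgap q b (v true l)) <= Z / b ^+ 2 * (t - gam).
Proof.
move=> q2 l0 t1 Z0 b0 g1 bad ar uE; rewrite leNgt; apply/negP => hyp.
have [vp vE Fp Fm] := arms_bad_signs q2 l0 t1 Z0 b0 bad ar uE.
have [gu up] := ar; have [du dv v0 ul vl] := gu.
have q0 : 0 < q by clear -q2; lra.
have t1' : 1 < `|t| by apply: (lt_le_trans t1); exact: ler_norm.
have a0 i : 0 < acoef t i by exact: acoef_gt0.
have c0 i : 0 <= ccoef Z 0 gam b i by exact: ccoef_ge0.
have arp := glued_arm true gu up; have arm := glued_arm false gu up.
have ll : 0 <= l <= l by rewrite lexx ltW.
have [vip uip] := arm_incr q2 (a0 _) (c0 _) l0 arp (ltW Fp).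
have [vim uim] := arm_decr q2 (a0 _) (c0 _) l0 arm (ltW Fm).
have uE' : u false l `^ q = b by rewrite -ul.
have bn : b != 0 by rewrite gt_eqF.
have : 0 < v true l + v false l.
  apply: (@pos_after_transverse_zeros _ (fun z => v true z + v false z)
    (fun z => lichF q (acoef t true) (ccoef Z 0 gam b true) (u true z) +
       lichF q (acoef t false) (ccoef Z 0 gam b false) (u false z)) 0 l) => //.
  - by move=> z zl; exact: (derD (dv true z zl) (dv false z zl)).
  - by rewrite !v0 addr0.
  move=> z zl vz; have /andP[z0 zl'] := zl.
  have u1 : 0 < u true z by exact: up.
  have u2 : 0 < u false z by exact: up.
  (* The forcing at [z] is (a X - c / X) / (2 q u); this ordering of the values makes the factors
     [1 / u] favour the arm [true]. *)
  have u12 : u true z <= u false z.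
    by apply: (le_trans (uip z l z0 zl' (lexx l))); rewrite ul; exact: uim.
  have Fz1 := arm_sign_ge0 q2 (a0 _) (c0 _) l0 arp (ltW Fp) zl.
  have Fz2 := arm_sign_le0 q2 (a0 _) (c0 _) l0 arm (ltW Fm) zl.
  have e1 := arm_energy q2 arp zl; have e2 := arm_energy q2 arm zl.
  have e3 := arm_energy q2 arp ll; have e4 := arm_energy q2 arm ll.
  pose Xp := u true z `^ q; pose Xm := u false z `^ q.
  have Xp0 : 0 < Xp by exact: powR_gt0.
  have Xm0 : 0 < Xm by exact: powR_gt0.
  pose w := q ^+ 2 * (v true l ^+ 2 - v true z ^+ 2).
  have vz' : v false z ^+ 2 = v true z ^+ 2.
    by rewrite -[RHS]sqrrN; congr (_ ^+ 2); move: vz; clear; lra.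
  have vl' : v false l ^+ 2 = v true l ^+ 2 by rewrite vE sqrrN.
  have qn : q != 0 by rewrite gt_eqF.
  pose cp := ccoef Z 0 gam b true; pose cm := ccoef Z 0 gam b false.
  have W i : v i l ^+ 2 = v true l ^+ 2 -> v i z ^+ 2 = v true z ^+ 2 ->
      u i l `^ q = b ->
      v i z ^+ 2 = energy q (acoef t i) (ccoef Z 0 gam b i) (u i z) -
         energy q (acoef t i) (ccoef Z 0 gam b i) (u i 0) ->
      v i l ^+ 2 = energy q (acoef t i) (ccoef Z 0 gam b i) (u i l) -
         energy q (acoef t i) (ccoef Z 0 gam b i) (u i 0) ->
      acoef t i * u i z `^ q + ccoef Z 0 gam b i / u i z `^ q =
        b * (acoef t i + ncoef (Z / b ^+ 2) gam i) - w.
    move=> h1 h2 h3 h4 h5; rewrite -(energy_scaled t gam Z i q0 b0 h3).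
    have -> : acoef t i * u i z `^ q + ccoef Z 0 gam b i / u i z `^ q =
       q ^+ 2 * energy q (acoef t i) (ccoef Z 0 gam b i) (u i z).
      by rewrite energyE mulrCA divff ?expf_neq0 // mulr1.
    rewrite /w -h1 -h2 -mulrBr; congr (_ * _).
    by rewrite h4 h5; ring.
  have W1 := W true erefl erefl uE e1 e3.
  have W2 := W false vl' vz' uE' e2 e4.
  pose pp := acoef t true * Xp - cp / Xp.
  pose pm := cm / Xm - acoef t false * Xm.
  have E1 : lichF q (acoef t true) cp (u true z) = pp / (u true z * (2 * q)).
    by rewrite lichFE.
  have E2 : lichF q (acoef t false) cm (u false z) = - (pm / (u false z * (2 * q))).
    by rewrite lichFE // /pm -/Xm; ring.
  have d1 : 0 < u true z * (2 * q) by rewrite !mulr_gt0.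
  have d2 : 0 < u false z * (2 * q) by rewrite !mulr_gt0.
  have pp0 : 0 <= pp by move: Fz1; rewrite -/cp E1 pmulr_lge0 // invr_gt0.
  have pm0 : 0 <= pm by move: Fz2; rewrite -/cm E2 oppr_le0 pmulr_lge0 // invr_gt0.
  have pp2 : pp ^+ 2 = (b * (acoef t true + ncoef (Z / b ^+ 2) gam true) - w) ^+ 2
    - 4 * acoef t true * ncoef (Z / b ^+ 2) gam true * b ^+ 2.
    rewrite -W1 (_ : 4 * acoef t true * ncoef (Z / b ^+ 2) gam true * b ^+ 2 = 4 * acoef t true * cp).
      by rewrite /pp -/cp -/Xp; field; rewrite gt_eqF.
    by rewrite /cp ccoef_ncoef //; ring.
  have pm2 : pm ^+ 2 = (b * (acoef t false + ncoef (Z / b ^+ 2) gam false) - w) ^+ 2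
    - 4 * acoef t false * ncoef (Z / b ^+ 2) gam false * b ^+ 2.
    rewrite -W2 (_ : 4 * acoef t false * ncoef (Z / b ^+ 2) gam false * b ^+ 2 = 4 * acoef t false * cm).
      by rewrite /pm -/cm -/Xm; field; rewrite gt_eqF.
    by rewrite /cm ccoef_ncoef //; ring.
  have gap : 0 < pp ^+ 2 - pm ^+ 2.
    rewrite pp2 pm2 forcing_gap mulr_gt0 ?mulr_gt0 // subr_gt0.
    have wb : w <= hgap q b (v true l) * b.
      rewrite /hgap divfK // /w ler_pM2l ?exprn_gt0 // gerBl.
      exact: sqr_ge0.
    have tg : 0 < t + gam by move: t1 g1; clear; lra.
    apply: (@lt_le_trans _ _ (b * ((t + gam) * ((t - gam) ^+ 2 - hgap q b (v true l))))).
      by rewrite mulrC ltr_pM2l.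
    by rewrite mulrCA ler_pM2l // mulrBr; move: wb; clear; lra.
  have pmp : pm < pp.
    rewrite ltNge; apply/negP => pl; move: gap; rewrite subr_gt0 ltNge => /negP; apply.
    by rewrite lerXn2r ?nnegrE.
  rewrite -/cp -/cm E1 E2 subr_gt0.
  apply: (@le_lt_trans _ _ (pm / (u true z * (2 * q)))).
    apply: ler_wpM2l => //; rewrite lef_pV2 ?posrE //; apply: ler_wpM2r => //.
    by apply: mulr_ge0 => //; exact: ltW.
  by rewrite ltr_pM2r // invr_gt0.
by rewrite vl ltxx.
Qed.

(** The energy at the midpoint is at least the minimum of [energy], computed by the inequality of
    arithmetic and geometric means; at the junction it is known exactly from u^q = b. *)
Lemma arms_gap_le q l t gam Z b u v i : 2 < q -> 0 < l -> 1 < t -> 0 <= Z ->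
  0 < b -> arms q l t gam 0 Z b u v -> u i l `^ q = b ->
  hgap q b (v i l) <= (Num.sqrt (ncoef (Z / b ^+ 2) gam i) - Num.sqrt (acoef t i)) ^+ 2.
Proof.
move=> q2 l0 t1 Z0 b0 [gu up] uE.
have q0 : 0 < q by clear -q2; lra.
have bn : b != 0 by rewrite gt_eqF.
have ll : 0 <= l <= l by rewrite lexx ltW.
have l00 : 0 <= (0 : R) <= l by apply/andP; split => //; exact: ltW.
have t1' : 1 < `|t| by apply: (lt_le_trans t1); exact: ler_norm.
have a0 : 0 <= acoef t i by exact: ltW (acoef_gt0 _ t1').
have Zb : 0 <= Z / b ^+ 2 by rewrite divr_ge0 // sqr_ge0.
have n0 := ncoef_ge0 gam i Zb.
have e := arm_energy q2 (glued_arm i gu up) ll.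
rewrite /hgap e ler_pdivrMr // mulrBr (energy_scaled t gam Z i q0 b0 uE).
have := @amgm_energy _ q (Num.sqrt (acoef t i)) (b * Num.sqrt (ncoef (Z / b ^+ 2) gam i)) (u i 0) q0
  (sqrtr_ge0 _) (mulr_ge0 (ltW b0) (sqrtr_ge0 _)) (up i 0 l00).
rewrite exprMn !sqr_sqrtr // -ccoef_ncoef // => h.
rewrite sqrrB !sqr_sqrtr //.
move: h; set S := energy _ _ _ _; set A := Num.sqrt _; set B := Num.sqrt _.
by clear; lra.
Qed.

(** If [t + gam < 2], the energy gives h <= (2 - t - gam)^2 < (t - gam)^2, against [arms_bad_match]
    with [Z = 0]. Otherwise neither forcing is negative at the junction and one is positive, so the
    slopes cannot cancel. *)
Lemma arms_no_fixed_point_gt1 q l t gam b u v : 2 < q -> 0 < l -> 1 < t -> `|gam| < 1 ->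
  0 < b -> arms q l t gam 0 0 b u v -> u true l `^ q = b -> False.
Proof.
move=> q2 l0 t1; rewrite ltr_norml => /andP[g1 g2] b0 ar uE.
have [bad|good] := ltP (t + gam) 2.
  have := arms_bad_match q2 l0 t1 (lexx 0) b0 g1 bad ar uE.
  have [vp vE _ _] := arms_bad_signs q2 l0 t1 (lexx 0) b0 bad ar uE.
  have [[_ _ _ ul _] _] := ar; have uE' : u false l `^ q = b by rewrite -ul.
  have := arms_gap_le q2 l0 t1 (lexx 0) b0 ar uE'.
  rewrite /hgap vE sqrrN -/(hgap q b (v true l)) !mul0r /ncoef /acoef /sgb add0r.
  rewrite !sqrtr_sqr ltr0_norm; last by move: g2; clear; lra.
  rewrite gtr0_norm; last by move: t1; clear; lra.
  set h := hgap _ _ _; move=> h1 h2.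
  have : 0 < t + gam by move: t1 g1; clear; lra.
  have h3 : h < (t - gam) ^+ 2.
    by apply: (le_lt_trans h1); move: t1 g1 g2 bad; clear; nra.
  by move: h2 h3; clear; nra.
have [[du dv v0 ul vl] up] := ar.
have q0 : 0 < q by clear -q2; lra.
have t1' : 1 < `|t| by apply: (lt_le_trans t1); exact: ler_norm.
have ll : 0 <= l <= l by rewrite lexx ltW.
have a0 i : 0 < acoef t i by exact: acoef_gt0.
have c0 i : 0 <= ccoef 0 0 gam b i by exact: ccoef_ge0.
have arp := glued_arm true (proj1 ar) up; have arm := glued_arm false (proj1 ar) up.
have Fp : 0 < lichF q (acoef t true) (ccoef 0 0 gam b true) (u true l).
  rewrite lichF_gt0P ?up // uE /ccoef /acoef /sgb !add0r exprMn mulrC.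
  rewrite ltr_pM2r ?exprn_gt0 //.
  by move: t1 g1 g2; clear; nra.
have Fm : 0 <= lichF q (acoef t false) (ccoef 0 0 gam b false) (u false l).
  rewrite lichF_ge0P ?up // -ul uE /ccoef /acoef /sgb !add0r exprMn mulrC.
  rewrite ler_pM2r ?exprn_gt0 //.
  by move: t1 g1 g2 good; clear; nra.
have vp := arm_slope_gt0 q2 (a0 _) (c0 _) l0 arp Fp.
have [vi _] := arm_incr q2 (a0 _) (c0 _) l0 arm Fm.
have := vi 0 l (lexx 0) (ltW l0) (lexx l); rewrite v0.
by move: vl vp; clear; lra.
Qed.

Lemma arms_no_fixed_point q l t gam b u v : 2 < q -> 0 < l -> 1 < `|t| -> `|gam| < 1 ->
  0 < b -> arms q l t gam 0 0 b u v -> u true l `^ q = b -> False.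
Proof.
move=> q2 l0 t1 g1 b0 ar uE.
have [t0|t0] := lerP 0 t.
  by rewrite ger0_norm // in t1; exact: arms_no_fixed_point_gt1 ar uE.
have t1' : 1 < - t by rewrite -ltr0_norm.
have g1' : `|- gam| < 1 by rewrite normrN.
have ar' := arms_flip ar; rewrite oppr0 in ar'.
apply: (arms_no_fixed_point_gt1 q2 l0 t1' g1' b0 ar').
by case: ar => -[_ _ _ <- _] _.
Qed.

End Matching.

(** * Algebraic inequalities behind the supersolution *)

Section TransversalAlgebra.
Context {R : realType}.
Implicit Types (q t gam Z h x nu : R).

(** By [2 < t - gam], [Z < (1 + gam) ^+ 2] would imply Z < (t-1)^2. Then [nm] is at most (1 - gam) +
    (t - 1)/2, which keeps [h] so far below (t-gam)^2 that the matching inequality yields Z >= (3/2)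
    (t-1)^2, a contradiction. *)
Lemma bad_Z_large t gam Z h nm : 1 < t -> -1 < gam -> t + gam < 2 -> 2 < t - gam ->
  0 < Z -> 0 <= nm -> nm ^+ 2 = Z + (1 - gam) ^+ 2 -> h <= (nm - (t - 1)) ^+ 2 ->
  (t + gam) * ((t - gam) ^+ 2 - h) <= Z * (t - gam) -> (1 + gam) ^+ 2 <= Z.
Proof.
move=> t1 g1 bad far Z0 nm0 nmE hle match_; rewrite leNgt; apply/negP => ZB.
have ZA : Z < (t - 1) ^+ 2.
  by apply: (lt_trans ZB); rewrite ltrXn2r ?nnegrE //; move: t1 g1 far; clear; lra.
have nm1 : 1 - gam <= nm.
  rewrite -(@ler_pXn2r _ 2) ?nnegrE //; first by rewrite nmE lerDr ltW.
  by move: bad t1; clear; lra.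
have nm2 : nm <= (1 - gam) + (t - 1) / 2.
  rewrite -(@ler_pXn2r _ 2) ?nnegrE //; last by move: bad t1; clear; lra.
  rewrite nmE; move: ZA bad t1 g1; clear; nra.
have k1 : 3 / 2 * (t - 1) <= t - gam - nm + (t - 1) by move: nm2; clear; lra.
have k2 : t - gam <= t - gam + nm - (t - 1) by move: nm1 bad; clear; lra.
have t10 : 0 < t - 1 by rewrite subr_gt0.
have far0 : 0 < t - gam by move: far; clear; lra.
have k3 : 3 / 2 * (t - 1) * (t - gam) <= (t - gam) ^+ 2 - h.
  have : 3 / 2 * (t - 1) * (t - gam) <= (t - gam - nm + (t - 1)) * (t - gam + nm - (t - 1)).
    by apply: ler_pM => //; [rewrite mulr_ge0 // ltW | exact: ltW].
  by move: hle; clear; lra.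
have k4 : (t - 1) * (3 / 2 * (t - 1) * (t - gam)) <= (t + gam) * ((t - gam) ^+ 2 - h).
  apply: ler_pM => //; [exact: ltW | | by move: g1; clear; lra].
  by rewrite !mulr_ge0 // ltW.
have k5 : 3 / 2 * (t - 1) ^+ 2 * (t - gam) <= Z * (t - gam).
  by apply: le_trans match_; apply: le_trans k4; rewrite le_eqVlt; apply/orP; left; apply/eqP; ring.
rewrite ler_pM2r // in k5.
have := exprn_gt0 2 t10; move: k5 ZA; clear; lra.
Qed.

Section Scaled.
Variables (q t gam Z h x Np Nm Pp Pm : R).
Hypotheses (q2 : 2 < q) (q6 : q <= 6) (t1 : 1 < t) (g1 : -1 < gam) (bad : t + gam < 2)
  (far : 2 < t - gam) (Z0 : 0 < Z) (h0 : 0 < h) (x0 : 0 < x)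
  (NpE : Np = Z + (1 + gam) ^+ 2) (NmE : Nm = Z + (1 - gam) ^+ 2)
  (PpE : Pp = (t + 1) ^+ 2 - Np) (PmE : Pm = Nm - (t - 1) ^+ 2)
  (hPp : h <= Pp) (hPm : h <= Pm) (ZB : (1 + gam) ^+ 2 <= Z).

Let Np0 : 0 < Np. Proof. by rewrite NpE ltr_wpDr ?sqr_ge0. Qed.
Let Nm0 : 0 < Nm. Proof. by rewrite NmE ltr_wpDr ?sqr_ge0. Qed.

Lemma PpPm : Pp - Pm = 2 * ((t - gam) * (t + gam) - Z).
Proof. by rewrite PpE PmE NpE NmE; ring. Qed.

(** From [ZB] and [q <= 6], [Z / Np >= 1 / 2 >= (q - 2) / (q + 2)], which settles the case
    [Pm <= Pp]. Otherwise [Z] exceeds (t-gam)(t+gam), hence Nm >= 3 (t-1)^2, and the last term makes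
    up for the deficit, again because [q <= 6]. *)
Lemma dagger :
  0 < Z / Np * (Pp - h) - (q - 2) / (q + 2) * (Pm - h)
      + Z / Nm * (2 * h + 2 * q / (q + 2) * (Pm - h)).
Proof.
have q20 : 0 < q + 2 by move: q2; lra.
have qm : 0 < q - 2 by rewrite subr_gt0.
have c1 : (q - 2) / (q + 2) <= 1 / 2 by rewrite ler_pdivrMr //; move: q6; lra.
have c0 : 0 <= (q - 2) / (q + 2) by rewrite divr_ge0 // ltW.
have c2 : 1 / 2 <= Z / Np.
  by rewrite ler_pdivlMr // NpE; move: ZB; lra.
have Pph : 0 <= Pp - h by rewrite subr_ge0.
have Pmh : 0 <= Pm - h by rewrite subr_ge0.
have ZN : 0 < Z / Nm by rewrite divr_gt0.
have c3 : 0 <= 2 * q / (q + 2) by rewrite divr_ge0 //; move: q2; lra.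
have := PpPm; set e := _ - Z => PP.
have [e0|e0] := lerP 0 e.
  have k1 : (q - 2) / (q + 2) * (Pm - h) <= Z / Np * (Pp - h).
    apply: ler_pM => //; first exact: le_trans c2.
    by move: PP e0; lra.
  have k2 : 0 < Z / Nm * (2 * h + 2 * q / (q + 2) * (Pm - h)).
    by rewrite mulr_gt0 // ltr_wpDr ?mulr_gt0 // mulr_ge0.
  by move: k1 k2; lra.
have k1 : (q - 2) / (q + 2) * (Pp - h) <= Z / Np * (Pp - h).
  by apply: ler_wpM2r => //; exact: le_trans c2.
have ud0 : 0 < (t - gam) * (t + gam).
  by rewrite mulr_gt0 //; move: t1 g1 far; lra.
have N3 : 3 * (t - 1) ^+ 2 <= Nm.
  rewrite NmE; have : (t - gam) * (t + gam) <= Z by move: e0; rewrite /e; lra.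
  by move: bad t1 g1; nra.
have k2 : 0 < - ((q - 2) / (q + 2) * (- 2 * e))
    + Z / Nm * (2 * h + 2 * q / (q + 2) * (Pm - h)).
  have -> : - ((q - 2) / (q + 2) * (- 2 * e))
    + Z / Nm * (2 * h + 2 * q / (q + 2) * (Pm - h)) =
    (Z * (4 * Nm - 2 * q * (t - 1) ^+ 2 + 4 * h) + 2 * (t - gam) * (t + gam) * (q - 2) * Nm)
      / ((q + 2) * Nm).
    rewrite /e PmE; field.
    by rewrite !gt_eqF.
  rewrite divr_gt0 ?mulr_gt0 // ltr_pwDl //.
    rewrite mulr_gt0 //; have := sqr_ge0 (t - 1); move: N3 h0 q6.
    by set A := (t - 1) ^+ 2; nra.
  rewrite mulr_ge0 ?(ltW Nm0) // mulr_ge0 ?(ltW qm) // -mulrA mulr_ge0 //; exact: ltW.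
have : (q - 2) / (q + 2) * (Pm - h) = (q - 2) / (q + 2) * (Pp - h) + (q - 2) / (q + 2) * (- 2 * e).
  by rewrite -mulrDr; congr (_ * _); move: PP; lra.
by move: k1 k2; lra.
Qed.

(** Quantities of [transversal_params]: [pip * x ^+ 2] and [pim * x ^+ 2] are the sizes of the
    forcings at the junction in units of u / l^2; [1 - zeta] bounds the dilation weight on the arm
    [false] from below, [nu] and [nus] the weight on the arm [true]. *)
Let n := 2 * q / (q - 2).
Let th := (q - 2) / 2.
Let zeta := n * Z / Nm.
Let pip := q / 2 * (Pp / h).
Let pim := q / 2 * (Pm / h).
Let nu := (1 + gam) ^+ 2 / Np.
Let nus := (1 + th * x)^-1.

Let qm : 0 < q - 2. Proof. by rewrite subr_gt0. Qed.
Let q0 : 0 < q. Proof. by move: q2; lra. Qed.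
Let th0 : 0 < th. Proof. by rewrite divr_gt0. Qed.

Let pi_ge P : h <= P -> q / 2 <= q / 2 * (P / h).
Proof. by move=> hP; rewrite ler_peMr ?divr_ge0 ?(ltW q0) // ler_pdivlMr // mul1r. Qed.

(** The difference of [slope_bound] and [slope_target] is, up to a positive factor, the margin left
    in the slope condition at the junction: the first comes from the arm [true] with weight [m], the
    second from the arm [false]. *)
Definition slope_bound m := m + (1 - m) * ((pip - 1) / th).

Definition slope_target := (1 - zeta) * ((1 + x + x * pim) / (1 + (th + 2) * x)).

(** Clearing denominators leaves a sum of nonnegative terms and a positive one. The delicate factor
    is (t-gam)(t+gam) - (t-1)^2 Z/Nm, nonnegative because [t - 1] is below both [t - gam] and
    [t + gam]. *)
Lemma slope_small_nu : slope_target < slope_bound nus.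
Proof.
have d1 : 0 < 1 + th * x by rewrite addr_gt0 // mulr_gt0.
have d2 : 0 < 1 + (th + 2) * x by rewrite addr_gt0 // mulr_gt0 // addr_gt0.
have E : slope_bound nus = (1 + x * (pip - 1)) / (1 + th * x).
  by rewrite /slope_bound /nus; field; rewrite !gt_eqF.
rewrite E /slope_target mulrA ltr_pdivrMr // mulrAC ltr_pdivlMr //.
rewrite -subr_gt0.
have -> : (1 + x * (pip - 1)) * (1 + (th + 2) * x) - (1 - zeta) * (1 + x + x * pim) * (1 + th * x) =
  x * (q / (2 * h)) * ((Pp - Pm) * (1 + q * x / 2) + x * (Pp + Pm - 2 * h) +
     zeta * (1 + th * x) * Pm) + zeta * (1 + th * x) * (1 + x).
  by rewrite /pip /pim /th; field; rewrite gt_eqF.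
have zeta0 : 0 < zeta by rewrite /zeta /n !(divr_gt0, mulr_gt0).
apply: ltr_pwDr; first exact: (mulr_gt0 (mulr_gt0 zeta0 d1) (addr_gt0 ltr01 x0)).
apply: mulr_ge0.
  by rewrite mulr_ge0 ?(ltW x0) // divr_ge0 ?mulr_ge0 ?(ltW q0) ?(ltW h0).
have -> : (Pp - Pm) * (1 + q * x / 2) + x * (Pp + Pm - 2 * h) + zeta * (1 + th * x) * Pm =
  (2 + q * x) * ((t - gam) * (t + gam) - (t - 1) ^+ 2 * (Z / Nm)) +
  (n - 2) * Z * (Pm / Nm) + x * ((Pp - h) + (Pm - h)).
  rewrite PpPm /zeta /n /th PmE; field.
  by rewrite !gt_eqF.
have ZN1 : Z / Nm <= 1 by rewrite ler_pdivrMr // mul1r NmE lerDl sqr_ge0.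
have ZN0 : 0 <= Z / Nm by rewrite divr_ge0 // ltW.
have n2 : 0 <= n - 2.
  by rewrite subr_ge0 /n ler_pdivlMr // ; lra.
apply: addr_ge0; first apply: addr_ge0.
- apply: mulr_ge0; first by rewrite addr_ge0 // mulr_ge0 //; exact: ltW.
  have : (t - 1) ^+ 2 * (Z / Nm) <= (t - 1) ^+ 2 by rewrite ler_piMr // sqr_ge0.
  have : (t - 1) ^+ 2 <= (t - gam) * (t + gam).
    by rewrite expr2; apply: ler_pM; move: t1 g1 bad; lra.
  by lra.
- apply: mulr_ge0; first by apply: mulr_ge0 => //; exact: ltW.
  by apply: divr_ge0; [exact: le_trans (ltW h0) hPm | exact: ltW].
- by apply: mulr_ge0; [exact: ltW | apply: addr_ge0; rewrite subr_ge0].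
Qed.

(** As [pim >= th + 1], the quotient in [slope_target] is at most its limit for large [x]; with that
    limit the margin is a positive multiple of [dagger]. *)
Lemma slope_large_nu : zeta < 1 -> slope_target < slope_bound nu.
Proof.
move=> z1.
have d2 : 0 < 1 + (th + 2) * x by rewrite addr_gt0 // mulr_gt0 // addr_gt0.
have d3 : 0 < th + 2 by rewrite addr_gt0.
have le1 : slope_target <= (1 - zeta) * ((1 + pim) / (th + 2)).
  apply: ler_wpM2l; first by rewrite subr_ge0 ltW.
  rewrite ler_pdivrMr // mulrAC ler_pdivlMr //.
  have := pi_ge hPm; rewrite -/pim /th; set p := pim; move: x0 q2; nra.
apply: (le_lt_trans le1); rewrite -subr_gt0.
have -> : slope_bound nu - (1 - zeta) * ((1 + pim) / (th + 2)) =
   q / (h * (q - 2)) * (Z / Np * (Pp - h) - (q - 2) / (q + 2) * (Pm - h)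
      + Z / Nm * (2 * h + 2 * q / (q + 2) * (Pm - h))).
  have -> : Z / Np = 1 - nu.
    by rewrite /nu NpE; field; rewrite -NpE gt_eqF.
  rewrite /slope_bound /pip /pim /zeta /n /th; field.
  have qp : 0 < q + 2 by rewrite addr_gt0.
  have qp' : 0 < q - 2 + 2 * 2 by move: q2; lra.
  by rewrite ?(gt_eqF h0) ?(gt_eqF Nm0) ?(gt_eqF qm) ?(gt_eqF qp) ?(gt_eqF qp').
by rewrite mulr_gt0 ?dagger // divr_gt0 // mulr_gt0.
Qed.

End Scaled.
End TransversalAlgebra.

(** * Choice of the weights of the generators *)

Section TransversalParams.
Context {R : realType}.
Implicit Types (q t gam Z h x : R).

(** A linear problem for six weights. On the arm [true], [2 * de = al * (q - 2)] holds up to the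
    slack [e]. The translation weights [ka] give both arms the junction value 1/q - e, and [e] is
    left to satisfy the slope condition. *)
Lemma transversal_params q t gam Z h x (N P : bool -> R) :
  2 < q -> q <= 6 -> 1 < t -> -1 < gam -> t + gam < 2 -> 2 < t - gam ->
  0 < Z -> 0 < h -> 0 < x -> (forall i, N i = ncoef Z gam i) ->
  P true = acoef t true - N true -> P false = N false - acoef t false ->
  h <= P true -> h <= P false -> (1 + gam) ^+ 2 <= Z ->
  exists al de ka : bool -> R,
  [/\ forall i, 0 <= ka i, forall i, 2 * de i < al i * (q - 2),
      forall i, 2 * (sgb i + gam) ^+ 2 <= N i * (al i * (q + 2) + 2 * de i) &
  [/\ al true + de true * x - ka true = al false - de false * x - ka false,
      al true + de true * x - ka true < q^-1 &
      0 <= al true * x + de true * (x + q / 2 * (P true / h) * x ^+ 2)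
             - ka true * (q / 2 * (P true / h) * x)
         - (al false * x + de false * (x + q / 2 * (P false / h) * x ^+ 2)
             + ka false * (q / 2 * (P false / h) * x))]].
Proof.
move=> q2 q6 t1 g1 bad far Z0 h0 x0 NE PpE' PmE' hPp hPm ZB.
set Np := N true; set Nm := N false; set Pp := P true; set Pm := P false.
have NpE : Np = Z + (1 + gam) ^+ 2 by rewrite /Np NE.
have NmE : Nm = Z + (1 - gam) ^+ 2 by rewrite /Nm NE /ncoef /sgb; ring.
have PpE : Pp = (t + 1) ^+ 2 - Np by rewrite /Pp PpE'.
have PmE : Pm = Nm - (t - 1) ^+ 2 by rewrite /Pm PmE'.
have small := slope_small_nu q2 t1 g1 bad Z0 h0 x0 NpE NmE PpE PmE hPp hPm.
have large := slope_large_nu q2 q6 t1 g1 bad far Z0 h0 x0 NpE NmE PpE PmE hPp hPm ZB.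
pose th := (q - 2) / 2; pose n := 2 * q / (q - 2); pose zeta := n * Z / Nm.
pose pip := q / 2 * (Pp / h); pose pim := q / 2 * (Pm / h).
(* The least [m] compatible with the linearised inequality on the arm [true] and with a nonnegative
   [ka] there. *)
pose m := Num.max ((1 + gam) ^+ 2 / Np) (1 + th * x)^-1.
have q0 : 0 < q by clear -q2; lra.
have qm : 0 < q - 2 by rewrite subr_gt0.
have th0 : 0 < th by rewrite divr_gt0.
have Np0 : 0 < Np by rewrite NpE ltr_wpDr ?sqr_ge0.
have Nm0 : 0 < Nm by rewrite NmE ltr_wpDr ?sqr_ge0.
have d1 : 0 < 1 + th * x by rewrite addr_gt0 // mulr_gt0.
have d2 : 0 < 1 + (th + 2) * x by rewrite addr_gt0 // mulr_gt0 // addr_gt0.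
have m0 : 0 < m by rewrite lt_max invr_gt0 d1 orbT.
have m1 : m < 1.
  rewrite gt_max invf_lt1 // ltrDl mulr_gt0 // andbT.
  by rewrite ltr_pdivrMr // mul1r NpE ltrDr.
have mB : (1 + gam) ^+ 2 <= Np * m.
  by rewrite mulrC -ler_pdivrMr // le_max lexx.
have mx : 1 <= m * (1 + th * x).
  by rewrite -ler_pdivrMr // div1r le_max lexx orbT.
have pi_ge p : h <= p -> q / 2 <= q / 2 * (p / h).
  by move=> hP; rewrite ler_peMr ?divr_ge0 ?(ltW q0) // ler_pdivlMr // mul1r.
have pip1 := pi_ge _ hPp; have pim1 := pi_ge _ hPm.
(* The linearised inequality on the arm [false] requires [1 - zeta <= z1]; the cut-off at 0 keeps
   the dilation weight [dm] nonnegative. *)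
pose z1 := Num.max 0 (1 - zeta).
have zeta0 : 0 < zeta by rewrite /zeta /n !(divr_gt0, mulr_gt0).
have z10 : 0 <= z1 by rewrite le_max lexx.
have z11 : z1 <= 1 by rewrite ge_max ler01 gerBl ltW.
have z1z : 1 - zeta <= z1 by rewrite le_max lexx orbT.
pose S := m + (1 - m) * ((pip - 1) / th) - z1 * ((1 + x + x * pim) / (1 + (th + 2) * x)).
have S0 : 0 < S.
  rewrite /S subr_gt0 /z1; case: (lerP 0 (1 - zeta)) => hz; last first.
    rewrite mul0r; apply: addr_gt0 => //; apply: mulr_gt0; first by rewrite subr_gt0.
    by apply: divr_gt0 => //; move: pip1; rewrite -/pip; clear -q2; lra.
  rewrite /m; case: (leP ((1 + gam) ^+ 2 / Np)) => hm; first exact: small.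
  move: hz; rewrite le_eqVlt => /orP[/eqP hz|hz]; last by apply: large; rewrite -subr_gt0.
  rewrite -hz mul0r.
  have nu1 : (1 + gam) ^+ 2 / Np < 1 by move: m1; rewrite gt_max => /andP[].
  have nu0 : 0 <= (1 + gam) ^+ 2 / Np by rewrite divr_ge0 ?sqr_ge0 // ltW.
  apply: ltr_wpDl => //; apply: mulr_gt0; first by rewrite subr_gt0.
  by apply: divr_gt0 => //; move: pip1; rewrite -/pip; clear -q2; lra.
have pp0 : 0 < pip by apply: lt_le_trans pip1; rewrite divr_gt0.
have pm0 : 0 < pim by apply: lt_le_trans pim1; rewrite divr_gt0.
pose dp := m * (q - 2) / (2 * q).
pose dm := (q - 2) / (2 * q) * z1 / (1 + (th + 2) * x).
have dm0 : 0 <= dm by rewrite divr_ge0 ?(ltW d2) // mulr_ge0 // divr_ge0 // ?mulr_ge0 // ltW.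
(* Solves the slope condition with equality. Its positivity, from [0 < S], makes the value 1/q - e
   strictly less than 1/q. *)
pose e := (q - 2) / (2 * q) * S / (2 * (pip + pim)).
have c0 : 0 < (q - 2) / (2 * q) by rewrite divr_gt0 // mulr_gt0.
have e0 : 0 < e by apply: divr_gt0; apply: mulr_gt0 => //; exact: addr_gt0.
have qn : q != 0 by rewrite gt_eqF.
have qi : 0 < q^-1 by rewrite invr_gt0.
exists (fun i => if i then m / q + e else q^-1 + dm * x + e),
  (fun i => if i then dp else dm),
  (fun i => if i then m / q + dp * x - q^-1 + 2 * e else 2 * e).
split.
- case; last by rewrite mulr_ge0 // ltW.
  have -> : m / q + dp * x - q^-1 + 2 * e = q^-1 * (m * (1 + th * x) - 1) + 2 * e.
    by rewrite /dp /th; field.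
  apply: addr_ge0; apply: mulr_ge0 => //; [exact: ltW | by rewrite subr_ge0 | exact: ltW].
- have eq0 : 0 < e * (q - 2) by rewrite mulr_gt0.
  case.
    have -> : 2 * dp = m / q * (q - 2) by rewrite /dp; field.
    by rewrite mulrDl ltrDl.
  have dmle : 2 * dm <= (q - 2) / q.
    have -> : 2 * dm = (q - 2) / q * (z1 / (1 + (th + 2) * x)).
      by rewrite /dm; field; rewrite qn gt_eqF.
    rewrite ler_piMr ?divr_ge0 ?(ltW qm) ?(ltW q0) // ler_pdivrMr // mul1r.
    by apply: (le_trans z11); rewrite lerDl; apply: mulr_ge0; [rewrite addr_ge0 // ltW | exact: ltW].
  have dx : 0 <= dm * x * (q - 2).
    by apply: mulr_ge0; [apply: mulr_ge0 => //; exact: ltW | exact: ltW].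
  have -> : (q^-1 + dm * x + e) * (q - 2) = (q - 2) / q + dm * x * (q - 2) + e * (q - 2) by ring.
  by move: dmle dx eq0; clear; lra.
- have eq2 : 0 <= e * (q + 2) by apply: mulr_ge0; [exact: ltW | clear -q2; lra].
  case.
    have -> : (m / q + e) * (q + 2) + 2 * dp = 2 * m + e * (q + 2) by rewrite /dp; field.
    rewrite -/Np mulrDr /sgb.
    have : 0 <= Np * (e * (q + 2)) by apply: mulr_ge0 => //; exact: ltW.
    by move: mB; clear; lra.
  have -> : (q^-1 + dm * x + e) * (q + 2) + 2 * dm = (q + 2) / q + (q - 2) / q * z1 + e * (q + 2).
    rewrite /dm /th; field; rewrite qn /=.
    have -> : 2 + (q - 2 + 4) * x = 2 * (1 + (th + 2) * x) by rewrite /th; field.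
    by rewrite mulf_neq0 // gt_eqF.
  rewrite -/Nm.
  have k1 : Nm * ((q + 2) / q + (q - 2) / q * (1 - zeta)) = 2 * (sgb false + gam) ^+ 2.
    rewrite /zeta /n /sgb NmE; field.
    by rewrite qn -NmE !gt_eqF.
  rewrite -k1 ler_pM2l // -addrA lerD2l.
  apply: ler_wpDr => //; apply: ler_wpM2l => //.
  by rewrite divr_ge0 // ltW.
split=> /=.
- ring.
- by move: e0; clear; lra.
have -> : (m / q + e) * x + dp * (x + q / 2 * (Pp / h) * x ^+ 2)
     - (m / q + dp * x - q^-1 + 2 * e) * (q / 2 * (Pp / h) * x)
     - ((q^-1 + dm * x + e) * x + dm * (x + q / 2 * (Pm / h) * x ^+ 2)
      + 2 * e * (q / 2 * (Pm / h) * x)) = 0; last by [].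
rewrite -/pip -/pim.
have eE : 2 * e * (pip + pim) = (q - 2) / (2 * q) * S.
  by rewrite /e; field; rewrite qn gt_eqF // addr_gt0.
have -> : (m / q + e) * x + dp * (x + pip * x ^+ 2) - (m / q + dp * x - q^-1 + 2 * e) * (pip * x)
   - ((q^-1 + dm * x + e) * x + dm * (x + pim * x ^+ 2) + 2 * e * (pim * x)) =
  x * (m / q + dp - m / q * pip + q^-1 * pip - q^-1 - dm * (1 + x + x * pim)
   - 2 * e * (pip + pim)) by ring.
rewrite eE /S /dp /dm /th.
apply/eqP; rewrite mulf_eq0; apply/orP; right; apply/eqP; field.
rewrite qn ?(gt_eqF qm) /=.
have -> : 2 + (q - 2 + 4) * x = 2 * (1 + (th + 2) * x) by rewrite /th; field.
by rewrite ?mulf_neq0 // gt_eqF.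
Qed.

End TransversalParams.

(** * From a linearised supersolution to nonlinear barriers *)

Section Transversality.
Context {R : realType}.
Implicit Types (u v : bool -> R -> R) (x y z l q t gam Z b a c h e : R).

Lemma lich_path_der q a Z k x f e : 2 < q -> 0 < x + e * f ->
  is_derive e 1 (fun e => lichF q a (Z + (k * (1 + e)) ^+ 2) (x + e * f))
    (dlichF q a (Z + (k * (1 + e)) ^+ 2) (x + e * f) * f
     - k ^+ 2 * (1 + e) / q * (x + e * f) `^ (- q - 1)).
Proof.
move=> q2 X0.
have dX := derD (der_cst x e) (derM (der_id e) (der_cst f e)).
have dk := derM (der_cst k e) (derD (der_cst 1 e) (der_id e)).
have dc := derD (der_cst Z e) (derM dk dk).
have d1 := @der_comp _ (fun y => y `^ (q - 1)) (fun e => x + e * f) e _ _ (is_derive1_powR (q - 1) X0) dX.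
have d2 := @der_comp _ (fun y => y `^ (- q - 1)) (fun e => x + e * f) e _ _ (is_derive1_powR (- q - 1) X0) dX.
have d := derZ ((2 * q)^-1) (derB (derZ a d1) (derM dc d2)).
have E : (fun y => (2 * q)^-1 * (a * (x + y * f) `^ (q - 1)
     - (Z + k * (1 + y) * (k * (1 + y))) * (x + y * f) `^ (- q - 1))) =
   (fun e => lichF q a (Z + (k * (1 + e)) ^+ 2) (x + e * f)).
  by apply/funext => y; rewrite /lichF [RHS]mulrC expr2.
rewrite E in d; apply: (derE d).
have -> : q - 1 - 1 = q - 2 by ring.
have -> : - q - 1 - 1 = - q - 2 by ring.
rewrite /dlichF; field.
by rewrite gt_eqF //; clear -q2; lra.
Qed.

Lemma cvD (T : Type) (F : set_system T) {FF : Filter F} (f g : T -> R) (x y : R) :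
  f @ F --> x -> g @ F --> y -> (fun s => f s + g s) @ F --> x + y.
Proof. exact: cvgD. Qed.

Lemma cvB (T : Type) (F : set_system T) {FF : Filter F} (f g : T -> R) (x y : R) :
  f @ F --> x -> g @ F --> y -> (fun s => f s - g s) @ F --> x - y.
Proof. exact: cvgB. Qed.

Lemma cvM (T : Type) (F : set_system T) {FF : Filter F} (f g : T -> R) (x y : R) :
  f @ F --> x -> g @ F --> y -> (fun s => f s * g s) @ F --> x * y.
Proof. exact: cvgM. Qed.

Lemma cvC (T : Type) (F : set_system T) {FF : Filter F} (x : R) : (fun _ : T => x) @ F --> x.
Proof. exact: cvg_cst. Qed.

Lemma powR_cvg (T : Type) (F : set_system T) {FF : Filter F} (f : T -> R) x (p : R) :
  0 < x -> f @ F --> x -> (fun s => f s `^ p) @ F --> x `^ p.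
Proof.
move=> x0 fx; apply: (@cvg_comp _ _ _ f (fun y => y `^ p) F _ _ fx).
exact: der_cont (is_derive1_powR p x0).
Qed.

Lemma fst_cvg (f : R -> R) (z w : R) : {for z, continuous f} ->
  (fun p : R * R => f p.1) @ filter_prod (nbhs z) (nbhs w) --> f z.
Proof.
by move=> cf; apply: (@cvg_comp _ _ _ fst f _ (nbhs (z : R))); [exact: cvg_fst | exact: cf].
Qed.

(** Positivity at [e = 0] extends to a neighbourhood of each [(z, 0)]; compactness of [[0, l]] makes
    the size of [e] uniform. *)
Lemma uniform_pos l (G : R -> R -> R) : 0 <= l ->
  (forall z, 0 <= z <= l ->
     (fun p : R * R => G p.1 p.2) @ filter_prod (nbhs z) (nbhs (0 : R)) --> G z 0) ->
  (forall z, 0 <= z <= l -> 0 < G z 0) ->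
  exists2 e0, 0 < e0 & forall e z, `|e| < e0 -> 0 <= z <= l -> 0 < G z e.
Proof.
move=> l0 cG G0.
have := (compact_near_coveringP _).1 (@segment_compact R 0 l) R (nbhs (0 : R))
  (fun e z => 0 < G z e) _.
case.
  move=> z; rewrite /= in_itv /= => zl.
  have H := cvgr_gt (G z 0) (cG z zl) 0 (G0 z zl).
  exact: H.
move=> e0 /= e00 H; exists e0 => // e z ee zl.
apply: (H e); first by rewrite /= sub0r normrN.
by rewrite /= in_itv.
Qed.

(** Derivative in [e] of the forcing for the parameter [b * (1 + e)] along [u + e * f], minus [f2].
    Positivity at [e = 0] says that [f] is a strict supersolution of the problem linearised in log
    b. *)
Definition forcing_rate q t gam Z b (u f f2 : bool -> R -> R) i z e :=
  dlichF q (acoef t i) (Z + (b * (sgb i + gam) * (1 + e)) ^+ 2) (u i z + e * f i z) * f i z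
     - (b * (sgb i + gam)) ^+ 2 * (1 + e) / q * (u i z + e * f i z) `^ (- q - 1) - f2 i z.

(** For small [e], [u + e * f] is a supersolution for [b * (1 + e)] and [u - e * f] a subsolution
    for [b * (1 - e)]. Since f < u / q at the junction, these barriers move there more slowly than
    the q-th root of the parameter. *)
Lemma transversal_step q l t gam Z b u v (f f1 f2 : bool -> R -> R) :
  2 < q -> 0 < l -> 1 < `|t| -> 0 <= Z -> 0 < b ->
  arms q l t gam 0 Z b u v -> u true l `^ q = b ->
  (forall i z, 0 <= z <= l -> is_derive z 1 (f i) (f1 i z)) ->
  (forall i z, 0 <= z <= l -> is_derive z 1 (f1 i) (f2 i z)) ->
  (forall i z, 0 <= z <= l -> {for z, continuous (f2 i)}) ->
  (forall i z, 0 <= z <= l -> 0 < forcing_rate q t gam Z b u f f2 i z 0) ->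
  (forall i, f1 i 0 <= 0) -> f true l = f false l -> f true l < u true l / q ->
  0 <= f1 true l + f1 false l ->
  exists2 e0, 0 < e0 & forall e, 0 < e < e0 ->
    (forall u' v', arms q l t gam 0 Z (b * (1 + e)) u' v' -> u' true l `^ q < b * (1 + e)) /\
    (forall u' v', arms q l t gam 0 Z (b * (1 - e)) u' v' -> b * (1 - e) < u' true l `^ q).
Proof.
move=> q2 l0 t1 Z0 b0 [gu up] uE df df1 cf2 rate0 f10 fl fu f1l.
have [du dv v0 ul vl] := gu.
have q0 : 0 < q by clear -q2; lra.
have ll : 0 <= l <= l by rewrite lexx ltW.
pose U := u true l; have U0 : 0 < U by exact: up.
have cu i z : 0 <= z <= l -> {for z, continuous (u i)}.
  by move=> zl; exact: der_cont (du i z zl).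
have cf i z : 0 <= z <= l -> {for z, continuous (f i)}.
  by move=> zl; exact: der_cont (df i z zl).
have pairs i z : 0 <= z <= l ->
    (fun p : R * R => u i p.1 + p.2 * f i p.1) @ filter_prod (nbhs z) (nbhs (0 : R)) -->
      u i z + 0 * f i z.
  move=> zl; apply: cvgD; first exact: (fst_cvg _ (cu i z zl)).
  by apply: cvgM; [exact: cvg_snd | exact: (fst_cvg _ (cf i z zl))].
have posex i : exists2 e0, 0 < e0 & forall e z, `|e| < e0 -> 0 <= z <= l ->
    0 < u i z + e * f i z.
  apply: (uniform_pos (ltW l0)); first exact: pairs.
  by move=> z zl; rewrite mul0r addr0; exact: up.
have rateex i : exists2 e0, 0 < e0 & forall e z, `|e| < e0 -> 0 <= z <= l ->
    0 < forcing_rate q t gam Z b u f f2 i z e.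
  apply: (uniform_pos (ltW l0)); last exact: rate0.
  move=> z zl; have X0 : 0 < u i z + 0 * f i z by rewrite mul0r addr0; exact: up.
  have hX := pairs i z zl.
  have hf : (fun p : R * R => f i p.1) @ filter_prod (nbhs z) (nbhs (0 : R)) --> f i z.
    exact: (fst_cvg _ (cf i z zl)).
  have hf2 : (fun p : R * R => f2 i p.1) @ filter_prod (nbhs z) (nbhs (0 : R)) --> f2 i z.
    exact: (fst_cvg _ (cf2 i z zl)).
  have he : (fun p : R * R => 1 + p.2) @ filter_prod (nbhs z) (nbhs (0 : R)) --> (1 + 0 : R).
    by apply: cvgD; [exact: cvg_cst | exact: cvg_snd].
  have FF : Filter (filter_prod (nbhs z) (nbhs (0 : R))) by exact: filter_prod_filter.
  have hp p := @powR_cvg _ _ FF _ _ p X0 hX.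
  have C := @cvC _ _ FF.
  have D f g x y hf hg := @cvD _ _ FF f g x y hf hg.
  have B f g x y hf hg := @cvB _ _ FF f g x y hf hg.
  have M f g x y hf hg := @cvM _ _ FF f g x y hf hg.
  have hk := M _ _ _ _ (C (b * (sgb i + gam))) he.
  have hk2 := M _ _ _ _ hk hk.
  have h1 := M _ _ _ _ (C (acoef t i)) (M _ _ _ _ (C (q - 1)) (hp (q - 2))).
  have h2 := M _ _ _ _ (D _ _ _ _ (C Z) hk2) (M _ _ _ _ (C (q + 1)) (hp (- q - 2))).
  have h3 := M _ _ _ _ (M _ _ _ _ (D _ _ _ _ h1 h2) (C (2 * q)^-1)) hf.
  have h4 := M _ _ _ _ (M _ _ _ _ (M _ _ _ _ (C ((b * (sgb i + gam)) ^+ 2)) he) (C q^-1)) (hp (- q - 1)).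
  have hF := B _ _ _ _ (B _ _ _ _ h3 h4) hf2.
  by rewrite /forcing_rate /dlichF expr2; under eq_fun do rewrite expr2.
have [ep1 ep10 Hp1] := posex true; have [ep2 ep20 Hp2] := posex false.
have [er1 er10 Hr1] := rateex true; have [er2 er20 Hr2] := rateex false.
(* Difference between (b (1+e))^(1/q) and the barrier at the junction; its derivative at 0 is
   [U / q - f true l]. *)
pose r e := U * (1 + e) `^ q^-1 - (U + e * f true l).
have dr : is_derive (0 : R) 1 r (U / q - f true l).
  have one0 : 0 < (1 : R) + 0 by rewrite addr0.
  have d1 := @der_comp _ (fun y => y `^ q^-1) (fun e => 1 + e) 0 _ _
    (is_derive1_powR q^-1 one0) (derD (der_cst 1 0) (der_id 0)).
  have d := derB (derZ U d1) (derD (der_cst U 0) (derM (der_id 0) (der_cst (f true l) 0))).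
  apply: (derE d); rewrite addr0 powR1; ring.
have r0 : r 0 = 0 by rewrite /r addr0 powR1 mul0r; ring.
have [|er er0 Hr] := der_pos_local dr; first by rewrite subr_gt0.
pose e0 := Num.min (Num.min (Num.min ep1 ep2) (Num.min er1 er2)) (Num.min er (2^-1)).
have e00 : 0 < e0 by rewrite !lt_min ep10 ep20 er10 er20 er0 invr_gt0 ltr0n.
have emin e : e < e0 -> [/\ [/\ e < ep1, e < ep2, e < er1 & e < er2], e < er & e < 2^-1].
  by rewrite !lt_min => /andP[/andP[/andP[-> ->] /andP[-> ->]] /andP[-> ->]].
have Hp i e z : `|e| < e0 -> 0 <= z <= l -> 0 < u i z + e * f i z.
  by move=> /emin[[h1 h2 _ _] _ _]; case: i; [exact: Hp1 | exact: Hp2].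
have Hrt i e z : `|e| < e0 -> 0 <= z <= l -> 0 < forcing_rate q t gam Z b u f f2 i z e.
  by move=> /emin[[_ _ h1 h2] _ _]; case: i; [exact: Hr1 | exact: Hr2].
have ccE e i : ccoef Z 0 gam (b * (1 + e)) i = Z + (b * (sgb i + gam) * (1 + e)) ^+ 2.
  by rewrite /ccoef add0r; congr (_ + _ ^+ 2); ring.
have cc0 i : ccoef Z 0 gam b i = Z + (b * (sgb i + gam) * (1 + 0)) ^+ 2.
  by rewrite /ccoef add0r addr0 mulr1.
(* [g] increases with [e]; comparing it with its value at 0 is exactly the super- or subsolution
   inequality of the barrier. *)
pose g i z e := lichF q (acoef t i) (Z + (b * (sgb i + gam) * (1 + e)) ^+ 2) (u i z + e * f i z)
   - e * f2 i z.
have dg i z e : `|e| < e0 -> 0 <= z <= l ->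
    is_derive e 1 (g i z) (forcing_rate q t gam Z b u f f2 i z e).
  move=> ee zl; have X0 := Hp i e z ee zl.
  have d := derB (@lich_path_der q (acoef t i) Z (b * (sgb i + gam)) (u i z) (f i z) e q2 X0)
    (derM (der_id e) (der_cst (f2 i z) e)).
  by apply: (derE d); rewrite /forcing_rate mulr0 addr0 mul1r.
have g0 i z : g i z 0 = lichF q (acoef t i) (ccoef Z 0 gam b i) (u i z).
  by rewrite /g cc0 !mul0r subr0 [u i z + 0]addr0.
have Fi B j x y : 0 < x -> x < y -> lichF q (acoef t j) (ccoef Z 0 gam B j) x <
    lichF q (acoef t j) (ccoef Z 0 gam B j) y.
  by apply: lichF_incr => //; [exact: acoef_gt0 | exact: ccoef_ge0].
have dw e i z : 0 <= z <= l -> is_derive z 1 (fun z => u i z + e * f i z) (v i z + e * f1 i z).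
  by move=> zl; exact: (derD (du i z zl) (derZ e (df i z zl))).
have dw1 e i z : 0 <= z <= l -> is_derive z 1 (fun z => v i z + e * f1 i z)
    (lichF q (acoef t i) (ccoef Z 0 gam b i) (u i z) + e * f2 i z).
  by move=> zl; exact: (derD (dv i z zl) (derZ e (df1 i z zl))).
have uq e : -1 < e -> (U * (1 + e) `^ q^-1) `^ q = b * (1 + e).
  move=> e1; have e1' : 0 <= 1 + e by move: e1; clear; lra.
  rewrite powRM ?(ltW U0) ?powR_ge0 // uE -powRrM mulVf ?gt_eqF // powRr1 //.
exists e0 => // e /andP[e_gt0 ee].
have [_ eer e2] := emin e ee.
have [rm rp] : r (0 - e) < r 0 /\ r 0 < r (0 + e) by apply: Hr; rewrite e_gt0.
rewrite r0 sub0r in rm; rewrite r0 add0r in rp.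
have ee1 : `|e| < e0 by rewrite gtr0_norm.
have ee2 : `|- e| < e0 by rewrite normrN.
have sub e' y : 0 <= y <= e -> `|e'| = y -> `|e'| < e0.
  by move=> /andP[_ ye] ->; exact: le_lt_trans ee.
split=> u' v' [gu' up'].
  have cmp : u' true l <= u true l + e * f true l.
    apply: (glued_compare (P := fun x => 0 < x) (u' := fun i z => u i z + e * f i z)
      l0 (Fi (b * (1 + e))) (glued_subsol gu')) => //.
      exists (fun i z => v i z + e * f1 i z),
        (fun i z => lichF q (acoef t i) (ccoef Z 0 gam b i) (u i z) + e * f2 i z); split.
      - exact: dw.
      - exact: dw1.
      - move=> i z zl; rewrite -g0 ccE.
        suff : g i z 0 <= g i z e by rewrite {2}/g; clear; lra.
        apply: (@der_ge0_le _ (g i z) 0 e (forcing_rate q t gam Z b u f f2 i z) (ltW e_gt0)).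
          by move=> y yl; apply: dg => //; apply: (sub _ y yl); rewrite ger0_norm //; case/andP: yl.
        move=> y /andP[/ltW y0 /ltW ye]; apply/ltW/Hrt => //.
        by rewrite ger0_norm //; exact: le_lt_trans ee.
      - split=> [i||]; rewrite ?v0 ?ul ?fl //.
          by rewrite add0r pmulr_rle0.
        by rewrite addrACA vl add0r -mulrDr mulr_ge0 // ltW.
    by move=> i z zl; exact: Hp.
  have lt1 : u' true l < U * (1 + e) `^ q^-1.
    by apply: (le_lt_trans cmp); move: rp; rewrite /r subr_gt0.
  rewrite -uq; last by move: e_gt0; clear; lra.
  by apply: gt0_ltr_powR => //; rewrite nnegrE ltW // ?up' // (lt_trans (up' true l ll)).
have cmp : u true l + - e * f true l <= u' true l.
  apply: (glued_compare (P := fun x => 0 < x) (u := fun i z => u i z + - e * f i z)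
    l0 (Fi (b * (1 - e))) _ (glued_supersol gu') up') => //.
  exists (fun i z => v i z + - e * f1 i z),
    (fun i z => lichF q (acoef t i) (ccoef Z 0 gam b i) (u i z) + - e * f2 i z); split.
  - exact: dw.
  - exact: dw1.
  - move=> i z zl; rewrite -g0 ccE.
    suff : g i z (- e) <= g i z 0 by rewrite {1}/g; clear; lra.
    have e0' : - e <= 0 by rewrite oppr_le0 ltW.
    apply: (@der_ge0_le _ (g i z) (- e) 0 (forcing_rate q t gam Z b u f f2 i z) e0').
      move=> y /andP[y1 y2]; apply: dg => //; rewrite ler0_norm //.
      by apply: le_lt_trans ee; rewrite lerNl.
    move=> y /andP[/ltW y1 /ltW y2]; apply/ltW/Hrt => //.
    by rewrite ler0_norm //; apply: le_lt_trans ee; rewrite lerNl.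
  - split=> [i||]; rewrite ?v0 ?ul ?fl //.
      by rewrite add0r mulNr oppr_ge0 pmulr_rle0.
    by rewrite addrACA vl add0r -mulrDr mulNr oppr_le0 mulr_ge0 // ltW.
have lt1 : U * (1 - e) `^ q^-1 < u' true l.
  by apply: lt_le_trans cmp; move: rm; rewrite /r subr_lt0.
rewrite -uq; last by move: e2; clear; lra.
apply: gt0_ltr_powR => //; rewrite nnegrE ?mulr_ge0 ?powR_ge0 // ltW //.
exact: up'.
Qed.

End Transversality.

(** * Uniqueness of the fixed point for [mu = 0] *)

Section FixedPointUniqueness.
Context {R : realType}.
Implicit Types (u v : bool -> R -> R) (x y z l q t gam Z b a c h e : R).

Lemma dlichF_cont q a c x : 0 < x -> {for x, continuous (dlichF q a c)}.
Proof.
move=> x0.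
have d1 := is_derive1_powR (q - 2) x0; have d2 := is_derive1_powR (- q - 2) x0.
have d := derM (derD (derZ a (derZ (q - 1) d1)) (derZ c (derZ (q + 1) d2)))
  (der_cst (2 * q)^-1 x).
exact: der_cont d.
Qed.

Lemma lichF_scaling q a c x al de : q != 0 -> 0 < x ->
  al * (x * dlichF q a c x) - (al + 2 * de) * lichF q a c x =
  x `^ (- q - 1) / (2 * q) *
    (a * (x `^ q) ^+ 2 * (al * (q - 2) - 2 * de) + c * (al * (q + 2) + 2 * de)).
Proof.
move=> q0 x0.
have xi : x^-1 = x `^ (-1) by rewrite powRN powRr1 // ltW.
have E1 : x `^ (q - 2) = (x `^ q) ^+ 2 * x `^ (- q - 1) / x.
  by rewrite expr2 xi -!powRDp //; congr (_ `^ _); ring.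
have E2 : x `^ (- q - 2) = x `^ (- q - 1) / x.
  by rewrite xi -!powRDp //; congr (_ `^ _); ring.
have E3 : x `^ (q - 1) = (x `^ q) ^+ 2 * x `^ (- q - 1).
  by rewrite expr2 -!powRDp //; congr (_ `^ _); ring.
rewrite /dlichF /lichF E1 E2 E3; field.
by rewrite q0 gt_eqF.
Qed.

(* The perturbation [al * u + de * z * u' - k * u'] combines the generators of the
   scalings of the solution, of [z], and of translations; only the first two
   contribute to the linearised equation. *)
Lemma transversal_of_params q l t gam Z b u v (al de k : bool -> R) :
  2 < q -> 0 < l -> 1 < `|t| -> 0 <= Z -> 0 < b ->
  arms q l t gam 0 Z b u v -> u true l `^ q = b ->
  (forall i z, 0 <= z <= l ->
     0 < acoef t i * (u i z `^ q) ^+ 2 * (al i * (q - 2) - 2 * de i)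
       + (ccoef Z 0 gam b i * (al i * (q + 2) + 2 * de i) - 2 * (b * (sgb i + gam)) ^+ 2)) ->
  (forall i, 0 <= k i * lichF q (acoef t i) (ccoef Z 0 gam b i) (u i 0)) ->
  al true * u true l + de true * (l * v true l) - k true * v true l =
    al false * u false l + de false * (l * v false l) - k false * v false l ->
  al true * u true l + de true * (l * v true l) - k true * v true l < u true l / q ->
  0 <= \sum_i (al i * v i l
      + de i * (v i l + l * lichF q (acoef t i) (ccoef Z 0 gam b i) (u i l))
      - k i * lichF q (acoef t i) (ccoef Z 0 gam b i) (u i l)) ->
  exists2 e0, 0 < e0 & forall e, 0 < e < e0 ->
    (forall u' v', arms q l t gam 0 Z (b * (1 + e)) u' v' -> u' true l `^ q < b * (1 + e)) /\
    (forall u' v', arms q l t gam 0 Z (b * (1 - e)) u' v' -> b * (1 - e) < u' true l `^ q).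
Proof.
move=> q2 l0 t1 Z0 b0 ar uE rate k0 fl fu fsum.
have [[du dv v0 ul vl] up] := ar.
have qn : q != 0 by rewrite gt_eqF //; clear -q2; lra.
pose F i := lichF q (acoef t i) (ccoef Z 0 gam b i).
pose F1 i := dlichF q (acoef t i) (ccoef Z 0 gam b i).
have dF i z : 0 <= z <= l -> is_derive z 1 (fun z => F i (u i z)) (F1 i (u i z) * v i z).
  move=> zl; exact: (@der_comp _ (F i) (u i) z _ _ (lichF_der _ _ _ (up i z zl)) (du i z zl)).
pose f i z := al i * u i z + de i * (z * v i z) - k i * v i z.
pose f1 i z := al i * v i z + de i * (1 * v i z + z * F i (u i z)) - k i * F i (u i z).
pose f2 i z := al i * F i (u i z) + de i * (1 * F i (u i z) +
   (1 * F i (u i z) + z * (F1 i (u i z) * v i z))) - k i * (F1 i (u i z) * v i z).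
apply: (@transversal_step R q l t gam Z b u v f f1 f2) => //.
- move=> i z zl; exact: (derB (derD (derZ (al i) (du i z zl))
    (derZ (de i) (derM (der_id z) (dv i z zl)))) (derZ (k i) (dv i z zl))).
- move=> i z zl; apply: (derE (derB (derD (derZ (al i) (dv i z zl))
    (derZ (de i) (derD (derM (der_cst 1 z) (dv i z zl)) (derM (der_id z) (dF i z zl)))))
    (derZ (k i) (dF i z zl)))).
  by rewrite /f2 /F; ring.
- move=> i z zl.
  have cu := der_cont (du i z zl); have cv := der_cont (dv i z zl).
  have cF := der_cont (dF i z zl).
  have cF1 : {for z, continuous (fun z => F1 i (u i z))}.
    by apply: (@continuous_comp _ _ _ (u i) (F1 i)); [exact: cu | exact: dlichF_cont (up i z zl)].
  have FF : Filter (nbhs z) by exact: nbhs_filter.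
  have C := @cvC R _ _ FF.
  have D g1 g2 x y hf hg := @cvD _ _ _ FF g1 g2 x y hf hg.
  have B g1 g2 x y hf hg := @cvB _ _ _ FF g1 g2 x y hf hg.
  have M g1 g2 x y hf hg := @cvM _ _ _ FF g1 g2 x y hf hg.
  have I : (fun y : R => y) @ nbhs z --> z by exact: cvg_id.
  have h1 := M _ _ _ _ (C 1) cF.
  have h2 := M _ _ _ _ cF1 cv.
  exact: (B _ _ _ _ (D _ _ _ _ (M _ _ _ _ (C (al i)) cF) (M _ _ _ _ (C (de i))
    (D _ _ _ _ h1 (D _ _ _ _ h1 (M _ _ _ _ I h2))))) (M _ _ _ _ (C (k i)) h2)).
- move=> i z zl; rewrite /forcing_rate.
  have -> : Z + (b * (sgb i + gam) * (1 + 0)) ^+ 2 = ccoef Z 0 gam b i.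
    by rewrite /ccoef add0r addr0 mulr1.
  have -> : u i z + 0 * f i z = u i z by rewrite mul0r addr0.
  rewrite addr0 mulr1.
  have -> : dlichF q (acoef t i) (ccoef Z 0 gam b i) (u i z) * f i z
      - (b * (sgb i + gam)) ^+ 2 / q * u i z `^ (- q - 1) - f2 i z =
    (al i * (u i z * F1 i (u i z)) - (al i + 2 * de i) * F i (u i z))
      - (b * (sgb i + gam)) ^+ 2 / q * u i z `^ (- q - 1).
    by rewrite /f /f2 /F1; ring.
  rewrite /F1 /F lichF_scaling ?up //.
  have -> : u i z `^ (- q - 1) / (2 * q) *
    (acoef t i * (u i z `^ q) ^+ 2 * (al i * (q - 2) - 2 * de i) +
     ccoef Z 0 gam b i * (al i * (q + 2) + 2 * de i)) -
    (b * (sgb i + gam)) ^+ 2 / q * u i z `^ (- q - 1) =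
    u i z `^ (- q - 1) / (2 * q) * (acoef t i * (u i z `^ q) ^+ 2 * (al i * (q - 2) - 2 * de i)
       + (ccoef Z 0 gam b i * (al i * (q + 2) + 2 * de i) - 2 * (b * (sgb i + gam)) ^+ 2)).
    by field.
  apply: mulr_gt0; last exact: rate.
  by rewrite divr_gt0 ?powR_gt0 ?up //; clear -q2; lra.
- by move=> i; rewrite /f1 v0 mul0r !mulr0 addr0 mulr0 addr0 sub0r oppr_le0; exact: k0.
- by move: fsum; rewrite big_bool /f1 !mul1r.
Qed.

(** At the level [s] where equality would hold the forcing is negative, because [0 < Z]. Below [s]
    the arm is concave, so a value under [s] would persist up to the junction; there b < S
    contradicts the hypothesis on [acoef]. *)
Lemma good_lower_bound q l t gam Z b u v i z : 2 < q -> 0 < l -> 1 < `|t| -> 0 < Z -> 0 < b ->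
  (sgb i + gam) ^+ 2 <= acoef t i ->
  arms q l t gam 0 Z b u v -> u i l `^ q = b -> 0 <= z <= l ->
  (b * (sgb i + gam)) ^+ 2 <= acoef t i * (u i z `^ q) ^+ 2.
Proof.
move=> q2 l0 t1 Z0 b0 good [[du dv v0 ul vl] up] uE zl.
have q0 : 0 < q by clear -q2; lra.
have a0 : 0 < acoef t i by exact: acoef_gt0.
have c0 : 0 <= ccoef Z 0 gam b i by apply: ccoef_ge0; exact: ltW.
have [be0|be0] := eqVneq (sgb i + gam) 0.
  by rewrite be0 mulr0 expr0n mulr_ge0 ?sqr_ge0 // ltW.
pose S := b * `|sgb i + gam| / Num.sqrt (acoef t i).
have sa0 : 0 < Num.sqrt (acoef t i) by rewrite sqrtr_gt0.
have S0 : 0 < S by rewrite divr_gt0 // mulr_gt0 // normr_gt0.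
have SE : acoef t i * S ^+ 2 = (b * (sgb i + gam)) ^+ 2.
  rewrite /S exprMn exprVn sqr_sqrtr ?(ltW a0) // mulrC divfK ?gt_eqF //.
  by rewrite !exprMn real_normK ?num_real.
pose s := S `^ q^-1; have s0 : 0 < s by exact: powR_gt0.
have sq : s `^ q = S by rewrite /s -powRrM mulVf ?gt_eqF // powRr1 // ltW.
have Fs : lichF q (acoef t i) (ccoef Z 0 gam b i) s < 0.
  by rewrite ltNge lichF_ge0P // sq SE -ltNge /ccoef add0r ltrDr.
rewrite leNgt; apply/negP => bad.
have us : u i z < s.
  rewrite ltNge; apply/negP => su; move: bad; rewrite ltNge => /negP; apply.
  rewrite -SE ler_pM2l // lerXn2r ?nnegrE ?powR_ge0 ?(ltW S0) // -sq.
  by apply: ge0_ler_powR; rewrite ?nnegrE ?(ltW q0) ?(ltW s0) // ltW // up.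
have d1 y : 0 <= y <= l -> is_derive y 1 (fun y => s - u i y) (0 - v i y).
  by move=> yl; exact: (derB (der_cst s y) (du i y yl)).
have d2 y : 0 <= y <= l -> is_derive y 1 (fun y => 0 - v i y)
   (0 - lichF q (acoef t i) (ccoef Z 0 gam b i) (u i y)).
  by move=> yl; exact: (derB (der_cst 0 y) (dv i y yl)).
have [|||wl _] := convex_escape l0 d1 d2 _ _ zl.
- move=> y yl; rewrite subr_gt0 sub0r oppr_gt0 => us'.
  by apply: lt_trans Fs; apply: lichF_incr => //; exact: up.
- by left; rewrite v0 subrr.
- by rewrite subr_gt0.
move: wl; rewrite subr_gt0 => ls.
have ll : 0 <= l <= l by rewrite lexx ltW.
have : b < S.
  by rewrite -uE -sq; apply: gt0_ltr_powR; rewrite ?nnegrE //; apply: ltW => //; exact: up.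
rewrite ltNge => /negP; apply.
rewrite ler_pdivrMr // ler_pM2l // -sqrtr_sqr; exact: ler_wsqrtr.
Qed.

(** The weight 1/q alone leaves ((q-2) (A - B) + (q+2) Z) / q, with A and B the two sides compared
    in [good_lower_bound]. Lowering it by [e] makes the inequality at the junction strict. *)
Lemma transversal_good q l t gam Z b u v : 2 < q -> 0 < l -> 1 < t -> `|gam| < 1 ->
  2 <= t + gam -> 0 < Z -> 0 < b -> arms q l t gam 0 Z b u v -> u true l `^ q = b ->
  exists2 e0, 0 < e0 & forall e, 0 < e < e0 ->
    (forall u' v', arms q l t gam 0 Z (b * (1 + e)) u' v' -> u' true l `^ q < b * (1 + e)) /\
    (forall u' v', arms q l t gam 0 Z (b * (1 - e)) u' v' -> b * (1 - e) < u' true l `^ q).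
Proof.
move=> q2 l0 t1; rewrite ltr_norml => /andP[g1 g2] good Z0 b0 ar uE.
have [[du dv v0 ul vl] up] := ar.
have q0 : 0 < q by clear -q2; lra.
have qm : 0 < q - 2 by rewrite subr_gt0.
have t1' : 1 < `|t| by apply: (lt_le_trans t1); exact: ler_norm.
have ll : 0 <= l <= l by rewrite lexx ltW.
(* The second bound gives e q B <= Z / 8, because B <= 4 b^2; the first keeps [al] at least
   1/(2q). *)
pose e := Num.min (2 * q)^-1 (Z / (32 * q * b ^+ 2)).
have d0 : 0 < 32 * q * b ^+ 2 by rewrite !mulr_gt0 ?exprn_gt0.
have e0 : 0 < e by rewrite lt_min invr_gt0 mulr_gt0 //= divr_gt0.
have e1 : e <= (2 * q)^-1 by rewrite ge_min lexx.
have e2 : e * (32 * q * b ^+ 2) <= Z by rewrite -ler_pdivlMr // ge_min lexx orbT.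
pose al := q^-1 - e.
have alq : al * q = 1 - e * q by rewrite /al mulrBl mulVf // gt_eqF.
have al0 : (2 * q)^-1 <= al.
  have : q^-1 = (2 * q)^-1 + (2 * q)^-1 by field; rewrite gt_eqF.
  by rewrite /al; move: e1; clear; lra.
have alp : 0 < al by apply: lt_le_trans al0; rewrite invr_gt0 mulr_gt0.
apply: (@transversal_of_params q l t gam Z b u v (fun=> al) (fun=> 0) (fun=> 0)) => //.
- exact: ltW.
- move=> i z zl; rewrite !mulr0 subr0 addr0.
  have uiE : u i l `^ q = b by case: (i); rewrite // -ul.
  have gd : (sgb i + gam) ^+ 2 <= acoef t i.
    by rewrite /acoef /sgb; case: (i); move: t1 g1 g2 good; clear; nra.
  have X := good_lower_bound q2 l0 t1' Z0 b0 gd ar uiE zl.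
  have B4 : (b * (sgb i + gam)) ^+ 2 <= 4 * b ^+ 2.
    rewrite exprMn mulrC ler_pM2r ?exprn_gt0 //.
    by rewrite /sgb; case: (i); move: g1 g2; clear; nra.
  rewrite /ccoef add0r.
  move: X B4; set B := (b * (sgb i + gam)) ^+ 2; set A := acoef _ _ * _ => X B4.
  have B0 : 0 <= B by exact: sqr_ge0.
  have h1 : B * (al * (q - 2)) <= A * (al * (q - 2)).
    by apply: ler_wpM2r => //; rewrite mulr_ge0 // ltW.
  have h2 : Z * 2^-1 <= Z * (al * (q + 2)).
    rewrite ler_pM2l //; apply: (@le_trans _ _ (al * q)).
      rewrite alq; have : e * q <= 2^-1.
        have := ler_wpM2r (ltW q0) e1; have -> : (2 * q)^-1 * q = 2^-1.
          by field; rewrite gt_eqF.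
        by [].
      by clear; lra.
    by rewrite ler_pM2l //; clear; lra.
  have h3 : e * q * B <= Z / 8.
    have : e * q * B <= e * q * (4 * b ^+ 2).
      by apply: ler_wpM2l => //; rewrite mulr_ge0 // ltW.
    by move: e2; clear; lra.
  have h4 : B * (al * (q - 2)) + B * (al * (q + 2)) = 2 * B - 2 * (e * q * B).
    have -> : B * (al * (q - 2)) + B * (al * (q + 2)) = 2 * B * (al * q) by ring.
    by rewrite alq; ring.
  by move: h1 h2 h3 h4 Z0; clear; lra.
- by move=> i; rewrite mul0r.
- by rewrite !mul0r ul.
- rewrite !mul0r subr0 addr0 mulrC ltr_pM2l ?up // /al.
  by rewrite gtrBl.
- rewrite big_bool !mul0r /= !addr0 !subr0.
  by rewrite -mulrDr vl mulr0.
Qed.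

(** In the scale-free quantities [x], [h] and [Zh], the energy bounds give [h <= P] on both arms and
    [arms_bad_match] gives [ZB], which are the hypotheses of [transversal_params]. *)
Lemma transversal_bad q l t gam Z b u v : 2 < q -> q <= 6 -> 0 < l -> 1 < t -> `|gam| < 1 ->
  t + gam < 2 -> 2 < t - gam -> 0 < Z -> 0 < b -> arms q l t gam 0 Z b u v ->
  u true l `^ q = b ->
  exists2 e0, 0 < e0 & forall e, 0 < e < e0 ->
    (forall u' v', arms q l t gam 0 Z (b * (1 + e)) u' v' -> u' true l `^ q < b * (1 + e)) /\
    (forall u' v', arms q l t gam 0 Z (b * (1 - e)) u' v' -> b * (1 - e) < u' true l `^ q).
Proof.
move=> q2 q6 l0 t1; rewrite ltr_norml => /andP[g1 g2] bad far Z0 b0 ar uE.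
have [[du dv v0 ul vl] up] := ar.
have q0 : 0 < q by clear -q2; lra.
have t1' : 1 < `|t| by apply: (lt_le_trans t1); exact: ler_norm.
have ll : 0 <= l <= l by rewrite lexx ltW.
have l00 : 0 <= (0 : R) <= l by apply/andP; split => //; exact: ltW.
have Z0' := ltW Z0.
have [vp vE Fp Fm] := arms_bad_signs q2 l0 t1 Z0' b0 bad ar uE.
have match_ := arms_bad_match q2 l0 t1 Z0' b0 g1 bad ar uE.
have gapp := arms_gap_le q2 l0 t1 Z0' b0 ar uE.
have uE' : u false l `^ q = b by rewrite -ul.
have := arms_gap_le q2 l0 t1 Z0' b0 ar uE'.
rewrite {1}/hgap vE sqrrN -/(hgap q b (v true l)) => gapm.
pose s := v true l; pose U := u true l; pose h := hgap q b s.
pose Zh := Z / b ^+ 2; pose N i := ncoef Zh gam i.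
pose x := l * s / U.
have U0 : 0 < U by exact: up.
have h0 : 0 < h by rewrite /h /hgap divr_gt0 // mulr_gt0 ?exprn_gt0.
have Zh0 : 0 < Zh by rewrite divr_gt0 // exprn_gt0.
have x0 : 0 < x by rewrite divr_gt0 // mulr_gt0.
have bn : b != 0 by rewrite gt_eqF.
have b20 : 0 < b ^+ 2 by exact: exprn_gt0.
have a0 i : 0 < acoef t i by exact: acoef_gt0.
have c0 i : 0 <= ccoef Z 0 gam b i by exact: ccoef_ge0.
have N0 i : 0 <= N i by apply: ncoef_ge0; exact: ltW.
have cN i : ccoef Z 0 gam b i = b ^+ 2 * N i by exact: ccoef_ncoef.
pose P i := if i then acoef t true - N true else N false - acoef t false.
have NA : N true < acoef t true.
  by move: Fp; rewrite lichF_gt0P ?up // uE cN mulrC ltr_pM2r.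
have AN : acoef t false < N false.
  by move: Fm; rewrite ltNge lichF_ge0P ?up // uE' cN mulrC ler_pM2r // -ltNge.
have hsq (A B : R) : 0 <= B -> B <= A -> h <= (Num.sqrt B - Num.sqrt A) ^+ 2 -> h <= A - B.
  move=> B0 BA hle; have A0 : 0 <= A by exact: le_trans BA.
  have sBA : Num.sqrt B <= Num.sqrt A by exact: ler_wsqrtr.
  apply: (le_trans hle); rewrite -{2}(sqr_sqrtr A0) -{2}(sqr_sqrtr B0).
  by have := sqrtr_ge0 B; move: sBA; clear; nra.
have hPp : h <= P true by apply: hsq => //; exact: ltW.
have hPm : h <= P false.
  apply: hsq; [exact: ltW | exact: ltW | ].
  by rewrite -sqrrN opprB.
have nmE : Num.sqrt (N false) ^+ 2 = Zh + (1 - gam) ^+ 2.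
  by rewrite sqr_sqrtr // /N /ncoef /sgb; ring.
have am : Num.sqrt (acoef t false) = t - 1.
  by rewrite /acoef /sgb sqrtr_sqr ger0_norm // subr_ge0 ltW.
have ZB : (1 + gam) ^+ 2 <= Zh.
  apply: (@bad_Z_large _ t gam Zh h (Num.sqrt (N false))) => //.
  by rewrite -am.
have [al [de [ka [ka0 g1' g2' [jE jlt slope]]]]] :=
  @transversal_params R q t gam Zh h x N P q2 q6 t1 g1 bad far Zh0 h0 x0 (fun=> erefl)
    erefl erefl hPp hPm ZB.
have sn : s != 0 by rewrite gt_eqF.
have Un : U != 0 by rewrite gt_eqF.
have qn : q != 0 by rewrite gt_eqF.
have ln : l != 0 by rewrite gt_eqF.
have arp := glued_arm true (proj1 ar) up; have arm := glued_arm false (proj1 ar) up.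
have FpE : lichF q (acoef t true) (ccoef Z 0 gam b true) (u true l) =
    U / l ^+ 2 * (q / 2 * (P true / h) * x ^+ 2).
  rewrite lichFE // uE cN -/U /P /x /h /hgap; field.
  by rewrite bn sn Un qn ln.
have FmE : lichF q (acoef t false) (ccoef Z 0 gam b false) (u false l) =
    - (U / l ^+ 2 * (q / 2 * (P false / h) * x ^+ 2)).
  rewrite lichFE ?up // uE' -ul cN -/U /P /x /h /hgap; field.
  by rewrite bn sn Un qn ln.
(* [k i] takes the sign of [v i l], which is also the sign of the forcing along that arm; so their
   product at the midpoint is nonnegative on both arms. *)
pose k i := ka i * U / v i l.
have lv : l * s = x * U by rewrite /x divfK.
have jt : al true * u true l + de true * (l * v true l) - k true * v true l =
   U * (al true + de true * x - ka true).
  by rewrite /k divfK // -/s lv -/U; ring.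
have vmn : v false l != 0 by rewrite vE oppr_eq0.
have jf : al false * u false l + de false * (l * v false l) - k false * v false l =
   U * (al false - de false * x - ka false).
  by rewrite /k divfK // vE -ul -/s -/U mulrN lv; ring.
apply: (@transversal_of_params q l t gam Z b u v al de k) => //.
- move=> i z zl; apply: ltr_pwDl.
    rewrite mulr_gt0 ?subr_gt0 // mulr_gt0 //.
    by rewrite exprn_gt0 // powR_gt0 // up.
  rewrite subr_ge0 cN exprMn.
  have := ler_wpM2l (ltW b20) (g2' i).
  by rewrite [X in X <= _]mulrCA [X in _ <= X]mulrA.
- case; rewrite /k.
    apply: mulr_ge0; first by rewrite divr_ge0 ?mulr_ge0 ?(ltW U0) // ltW.
    exact: (arm_sign_ge0 q2 (a0 _) (c0 _) l0 arp (ltW Fp) l00).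
  apply: mulr_le0; last exact: (arm_sign_le0 q2 (a0 _) (c0 _) l0 arm (ltW Fm) l00).
  by rewrite mulr_ge0_le0 ?mulr_ge0 ?(ltW U0) // invr_le0 vE oppr_le0 ltW.
- by rewrite jt jf jE.
- by rewrite jt ltr_pM2l.
rewrite big_bool /= FpE FmE.
have -> : al true * v true l + de true * (v true l + l * (U / l ^+ 2 * (q / 2 * (P true / h) * x ^+ 2)))
     - k true * (U / l ^+ 2 * (q / 2 * (P true / h) * x ^+ 2)) +
  (al false * v false l + de false * (v false l + l * - (U / l ^+ 2 * (q / 2 * (P false / h) * x ^+ 2)))
     - k false * - (U / l ^+ 2 * (q / 2 * (P false / h) * x ^+ 2))) =
  U / l * (al true * x + de true * (x + q / 2 * (P true / h) * x ^+ 2)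
             - ka true * (q / 2 * (P true / h) * x)
         - (al false * x + de false * (x + q / 2 * (P false / h) * x ^+ 2)
             + ka false * (q / 2 * (P false / h) * x))).
  rewrite /k vE -/s.
  have -> : s = x * U / l by rewrite -lv; field.
  field.
  by rewrite (gt_eqF h0) (gt_eqF x0) Un ln.
by apply: mulr_ge0 => //; apply: divr_ge0; exact: ltW.
Qed.

(** [b - val b ^ q] is positive just after [b1]. It vanishes at its first later nonpositive point,
    and transversality there makes it negative just before, which is absurd. *)
Lemma fixed_point_lt_absurd q l t gam Z b1 b2 u1 v1 u2 v2 : 2 < q -> q <= 6 -> 0 < l ->
  1 < t -> `|gam| < 1 -> 2 < t - gam -> 0 < Z -> 0 < b1 -> b1 < b2 ->
  arms q l t gam 0 Z b1 u1 v1 -> u1 true l `^ q = b1 ->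
  arms q l t gam 0 Z b2 u2 v2 -> u2 true l `^ q = b2 -> False.
Proof.
move=> q2 q6 l0 t1 g1 far Z0 b10 b12 ar1 E1 ar2 E2.
have b20 : 0 < b2 by exact: lt_trans b12.
have t1' : 1 < `|t| by apply: (lt_le_trans t1); exact: ler_norm.
have tr b u v : 0 < b -> arms q l t gam 0 Z b u v -> u true l `^ q = b ->
  exists2 e0, 0 < e0 & forall e, 0 < e < e0 ->
    (forall u' v', arms q l t gam 0 Z (b * (1 + e)) u' v' -> u' true l `^ q < b * (1 + e)) /\
    (forall u' v', arms q l t gam 0 Z (b * (1 - e)) u' v' -> b * (1 - e) < u' true l `^ q).
  have [bad|good] := ltP (t + gam) 2; first exact: transversal_bad.
  exact: transversal_good.
have [val valP] := arms_value gam q2 l0 t1' (ltW Z0) (or_introl Z0 : 0 < Z \/ (0 : R) != 0).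
have valp b : 0 < b -> 0 < val b.
  move=> b0; have [u [v [[_ up] <-]]] := valP b b0; apply: up.
  by rewrite lexx ltW.
pose f b := b - val b `^ q.
have cf b : 0 < b -> {for b, continuous f}.
  move=> b0; apply: (@continuousB _ _ _ (fun b => b) (fun b => val b `^ q)); first exact: cvg_id.
  apply: (@continuous_comp _ _ _ val (fun x => x `^ q)).
    exact: (arms_value_cont q2 l0 t1' (ltW Z0) (or_introl Z0 : 0 < Z \/ (0 : R) != 0) valP b0).
  exact: der_cont (is_derive1_powR q (valp b b0)).
have tr' b : 0 < b -> f b = 0 -> exists2 e0, 0 < e0 & forall e, 0 < e < e0 ->
    0 < f (b * (1 + e)) /\ (e < 1 -> f (b * (1 - e)) < 0).
  move=> b0 fb; have [u [v [ar uE]]] := valP b b0.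
  have uE' : u true l `^ q = b by rewrite uE; move: fb; rewrite /f => /eqP; rewrite subr_eq0 => /eqP.
  have [e0 e00 He] := tr b u v b0 ar uE'.
  exists e0 => // e ee; have /andP[ep _] := ee; have [h1 h2] := He e ee.
  have bp : 0 < b * (1 + e) by rewrite mulr_gt0 // addr_gt0.
  split.
    have [u' [v' [ar' u'E]]] := valP _ bp.
    by rewrite /f subr_gt0 -u'E; exact: h1 ar'.
  move=> e1; have bm : 0 < b * (1 - e) by rewrite mulr_gt0 // subr_gt0.
  have [u' [v' [ar' u'E]]] := valP _ bm.
  by rewrite /f subr_lt0 -u'E; exact: h2 ar'.
have fix0 b u v : 0 < b -> arms q l t gam 0 Z b u v -> u true l `^ q = b -> f b = 0.
  move=> b0 ar uE; have [u' [v' [ar' u'E]]] := valP b b0.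
  rewrite /f -u'E -(arms_unique q2 l0 t1' (ltW Z0) ar ar' true (z := l)) ?uE ?subrr //.
  by rewrite lexx ltW.
have [e1 e10 H1] := tr' b1 b10 (fix0 _ _ _ b10 ar1 E1).
pose d := Num.min (e1 / 2) ((b2 - b1) / (2 * b1)).
have d0 : 0 < d by rewrite lt_min !divr_gt0 ?mulr_gt0 // subr_gt0.
have de1 : d < e1 by rewrite gt_min; apply/orP; left; move: e10; clear; lra.
have db : b1 * (1 + d) < b2.
  have : d * (2 * b1) <= b2 - b1 by rewrite -ler_pdivlMr ?mulr_gt0 // ge_min lexx orbT.
  by move: b12; clear; lra.
have [fa _] := H1 d (introT andP (conj d0 de1)).
have a0 : 0 < b1 * (1 + d) by rewrite mulr_gt0 // addr_gt0.
have fb2 : f b2 <= 0 by rewrite (fix0 _ _ _ b20 ar2 E2).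
have cf' b : b1 * (1 + d) <= b <= b2 -> {for b, continuous f}.
  by move=> /andP[h _]; apply: cf; exact: lt_le_trans h.
have [c /andP[ac cb] [fc pos]] := first_nonpos (ltW db) cf' fa fb2.
have c0 : 0 < c by exact: lt_trans ac.
have fc0 : f c = 0.
  apply/eqP; rewrite eq_le fc /= leNgt; apply/negP => fcn.
  have cN : {for c, continuous (fun b => - f b)} by apply: continuousN; exact: cf.
  have [|e ep He] := near_pos cN; first by rewrite oppr_gt0.
  pose k := Num.min (e / 2) (c - b1 * (1 + d)).
  have k0 : 0 < k by rewrite lt_min divr_gt0 ?subr_gt0.
  have ke : k < e by rewrite gt_min; apply/orP; left; move: ep; clear; lra.
  have kc : k <= c - b1 * (1 + d) by rewrite ge_min lexx orbT.
  have : 0 < f (c - k) by apply: pos; move: kc k0; clear; lra.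
  have : 0 < - f (c - k).
    by apply: He; rewrite opprB addrC subrK gtr0_norm.
  by clear; lra.
have [e2 e20 H2] := tr' c c0 fc0.
pose k := Num.min (Num.min (e2 / 2) (2^-1)) ((c - b1 * (1 + d)) / c).
have k0 : 0 < k.
  by rewrite !lt_min (divr_gt0 e20) // invr_gt0 (ltr0n _ 2) /= divr_gt0 // subr_gt0.
have ke : k < e2 by rewrite !gt_min; apply/orP; left; apply/orP; left; move: e20; clear; lra.
have k1 : k < 1 by rewrite !gt_min; apply/orP; left; apply/orP; right; clear; lra.
have kc : k * c <= c - b1 * (1 + d) by rewrite -ler_pdivlMr // ge_min lexx orbT.
have [_ /(_ k1)] := H2 k (introT andP (conj k0 ke)).
apply/negP; rewrite -leNgt; apply/ltW/pos.
have ck : 0 < k * c by rewrite mulr_gt0.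
by move: kc ck; clear; lra.
Qed.

Lemma arms_fixed_point_unique q l t gam Z b1 b2 u1 v1 u2 v2 : 2 < q -> q <= 6 -> 0 < l ->
  1 < `|t| -> `|gam| < 1 -> 2 < `|t - gam| -> 0 < Z -> 0 < b1 -> 0 < b2 ->
  arms q l t gam 0 Z b1 u1 v1 -> u1 true l `^ q = b1 ->
  arms q l t gam 0 Z b2 u2 v2 -> u2 true l `^ q = b2 -> b1 = b2.
Proof.
move=> q2 q6 l0; wlog t0 : t gam u1 v1 u2 v2 / 0 <= t.
  move=> H t1 g1 far Z0 b10 b20 ar1 E1 ar2 E2.
  have [t0|t0] := lerP 0 t; first exact: (H t gam u1 v1 u2 v2).
  have f1 := arms_flip ar1; have f2 := arms_flip ar2; rewrite oppr0 in f1 f2.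
  apply: (H (- t) (- gam) _ _ _ _ _ _ _ _ _ _ _ f1 _ f2) => //.
  - by rewrite oppr_ge0 ltW.
  - by rewrite normrN.
  - by rewrite normrN.
  - by rewrite -opprD normrN.
  - by case: ar1 => -[_ _ _ <- _] _.
  - by case: ar2 => -[_ _ _ <- _] _.
rewrite (ger0_norm t0) => t1 g1 far Z0 b10 b20 ar1 E1 ar2 E2.
have far' : 2 < t - gam.
  move: far; rewrite ger0_norm // subr_ge0.
  by move: g1; rewrite ltr_norml; move: t1; clear; lra.
case: (ltgtP b1 b2) => // b12.
  by case: (fixed_point_lt_absurd q2 q6 l0 t1 g1 far' Z0 b10 b12 ar1 E1 ar2 E2).
by case: (fixed_point_lt_absurd q2 q6 l0 t1 g1 far' Z0 b20 b12 ar2 E2 ar1 E1).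
Qed.

End FixedPointUniqueness.

(** * Integration and weak derivatives on the circle *)

Section CircleIntegral.
Context {R : realType}.
Notation mu := (@lebesgue_measure R).
Implicit Types (f g h psi : R -> R) (a b c x y z p : R).

Lemma circI_itv : @circI R = `[- pi, pi]%classic.
Proof. by apply/seteqP; split => x /=; rewrite in_itv. Qed.

Lemma measurable_circI : measurable (@circI R : set (measurableTypeR R)).
Proof. by rewrite circI_itv. Qed.

Lemma circI_fin : (mu circI < +oo)%E.
Proof. by rewrite circI_itv /= lebesgue_measure_itv /=; case: ifP; rewrite ?ltry. Qed.

Definition circ_int f := mu.-integrable circI (EFin \o f).

Lemma circ_int_measurable f : circ_int f -> measurable_fun circI f.
Proof. by move=> /measurable_int /measurable_EFinP. Qed.

Lemma circ_int_cont f : continuous f -> circ_int f.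
Proof. by move=> cf; rewrite /circ_int circI_itv; exact: continuous_itv_integrable. Qed.

Lemma circ_intD f g : circ_int f -> circ_int g -> circ_int (fun x => f x + g x).
Proof. by move=> fi gi; apply: eq_integrable (integrableD measurable_circI fi gi) => //; exact: measurable_circI. Qed.

Lemma circ_intB f g : circ_int f -> circ_int g -> circ_int (fun x => f x - g x).
Proof. by move=> fi gi; apply: eq_integrable (integrableB measurable_circI fi gi) => //; exact: measurable_circI. Qed.

Lemma circ_intZ c f : circ_int f -> circ_int (fun x => c * f x).
Proof. by move=> fi; apply: eq_integrable (integrableZl measurable_circI c fi) => //; exact: measurable_circI. Qed.

Lemma cont_bounded_circ f : continuous f -> [bounded f x | x in @circI R].
Proof.
move=> cf; have /compact_bounded [M [Mr MP]] : compact (f @` circI).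
  apply: continuous_compact; first exact: continuous_subspaceT.
  by rewrite circI_itv; exact: segment_compact.
by exists M; split => // y My x Ix; apply: (MP y My); exists x.
Qed.

Lemma circ_int_mul f g : circ_int f -> continuous g -> circ_int (fun x => f x * g x).
Proof.
move=> fi cg; apply: (integrableMl measurable_circI fi); last exact: cont_bounded_circ.
by apply: measurable_funTS; exact: continuous_measurable_fun.
Qed.

Lemma ae_imp (P Q : R -> Prop) : (forall x, P x -> Q x) ->
  {ae mu, forall x, P x} -> {ae mu, forall x, Q x}.
Proof. by move=> PQ; apply: negligibleS => x /= nQ /PQ. Qed.

Lemma ae_and (P Q : R -> Prop) : {ae mu, forall x, P x} -> {ae mu, forall x, Q x} ->
  {ae mu, forall x, P x /\ Q x}.
Proof. by have F := ae_filter_ringOfSetsType mu; move=> h1 h2; exact: filterI. Qed.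

Lemma circ_int_ae f g : circ_int f -> circ_int g ->
  {ae mu, forall x, circI x -> f x = g x} ->
  \int[mu]_(x in circI) f x = \int[mu]_(x in circI) g x.
Proof.
move=> fi gi fg; congr fine.
have := @ae_eq_integral _ _ _ mu circI (EFin \o g) (EFin \o f) measurable_circI
  (measurable_int _ fi) (measurable_int _ gi).
apply.
by apply: ae_imp fg => x h Ix; rewrite /= h.
Qed.

Lemma circ_RintB f g : circ_int f -> circ_int g ->
  \int[mu]_(x in circI) (f x - g x) =
  \int[mu]_(x in circI) f x - \int[mu]_(x in circI) g x.
Proof. by move=> fi gi; exact: (RintegralB measurable_circI fi gi). Qed.

Lemma circ_RintD f g : circ_int f -> circ_int g ->
  \int[mu]_(x in circI) (f x + g x) =
  \int[mu]_(x in circI) f x + \int[mu]_(x in circI) g x.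
Proof. by move=> fi gi; exact: (RintegralD measurable_circI fi gi). Qed.

Lemma circ_RintZ c f : circ_int f ->
  \int[mu]_(x in circI) (c * f x) = c * \int[mu]_(x in circI) f x.
Proof. by move=> fi; exact: (RintegralZl c measurable_circI fi). Qed.

Lemma Lp_circ_int p f : 1 < p -> Lp p f -> circ_int f.
Proof.
move=> p1 [mf fp]; have mabs : measurable_fun circI (fun x => `|f x|).
  exact: measurableT_comp mf.
have mp : measurable_fun circI (fun x => `|f x| `^ p).
  exact: (measurableT_comp (measurable_powR p) mabs).
have ip : circ_int (fun x => `|f x| `^ p).
  apply/integrableP; split; first exact/measurable_EFinP.
  apply: le_lt_trans fp; rewrite le_eqVlt; apply/orP; left; apply/eqP.
  by apply: eq_integral => x _ /=; rewrite ger0_norm // powR_ge0.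
have i1 : circ_int (fun=> 1) by apply: circ_int_cont => x; exact: cvg_cst.
apply: (le_integrable measurable_circI _ _ (circ_intD i1 ip)).
  exact/measurable_EFinP.
move=> x _ /=; rewrite lee_fin [leRHS]ger0_norm ?addr_ge0 ?powR_ge0 //.
have [fx|fx] := leP (`|f x|) 1.
  by apply: (le_trans fx); rewrite lerDl powR_ge0.
apply: (@le_trans _ _ (`|f x| `^ p)); last by rewrite lerDr.
rewrite -[leLHS]powRr1 //; apply: ler_powR; exact: ltW.
Qed.

Lemma ae_neq c : {ae mu, forall x, x != c}.
Proof.
exists [set c]; split; [exact: measurable_set1 | exact: lebesgue_measure_set1 | ].
by move=> x /= /negP; rewrite negbK => /eqP.
Qed.

(** Lebesgue differentiation of the extension of [f] by zero. *)
Lemma integral_zero_ae f a b : mu.-integrable `[a, b] (EFin \o f) ->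
  (forall x, a < x < b -> \int[mu]_(z in `[a, x]) f z = 0) ->
  {ae mu, forall x, a < x < b -> f x = 0}.
Proof.
move=> fi f0; pose g := f \_ `[a, b].
have gi : mu.-integrable setT (EFin \o g).
  rewrite /g -restrict_EFin.
  by have [+ _] := integrable_mkcond (mu := mu) (EFin \o f) (measurable_itv `[a, b]); apply.
have giS (A : set R) : measurable A -> mu.-integrable A (EFin \o g).
  by move=> mA; apply: integrableS gi.
have gl : locally_integrable setT g.
  split; [by have /measurable_EFinP := measurable_int _ gi | exact: openT | ].
  move=> K _ cK; have mK := compact_measurable cK.
  by have /integrableP[] := giS K mK.
have := @FTC1 _ g (BLeft a) (fun y => giS _ (measurable_itv _)) gl.
apply: ae_imp => x H xab; have /andP[ax xb] := xab.
have [|dF FE] := H; first by rewrite lte_fin.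
have <- : g x = f x by rewrite /g patchE mem_set //= in_itv /= !ltW.
rewrite -FE derive1E.
have nE : {near x, (fun=> 0 : R) =1 (fun y => \int[mu]_(z in `[a, y]) g z)}.
  have : \forall y \near x, y \in `]a, b[ by apply: near_in_itvoo; rewrite in_itv /= ax.
  apply: filterS => y; rewrite in_itv /= => /andP[ay yb].
  rewrite -(f0 y) ?ay //; apply: eq_Rintegral => z; rewrite inE /= in_itv /= => /andP[az zy].
  by rewrite /g patchE mem_set //= in_itv /= az ltW // (le_lt_trans zy).
by have [_ ->] := near_eq_is_derive nE (der_cst 0 x).
Qed.

End CircleIntegral.

(** * Smooth periodic test functions and the du Bois-Reymond lemma *)

Section TestFunctions.
Context {R : realType}.
Notation mu := (@lebesgue_measure R).
Implicit Types (f g h psi : R -> R) (a b c x y z p : R).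

Lemma smooth_der f : smooth f -> forall x, is_derive x 1 f (derive1n 1 f x).
Proof.
by move=> sf x; apply: DeriveDef; [exact: (sf 0%N x) | rewrite derive1n1 derive1E].
Qed.

Lemma smooth_derive1n f : smooth f -> smooth (derive1n 1 f).
Proof. by move=> sf k x; rewrite derive1n1 -derive1Sn; exact: sf. Qed.

Lemma smooth_cont f : smooth f -> continuous f.
Proof. by move=> sf x; exact: der_cont (smooth_der sf x). Qed.

Lemma derive1n1_funext f g : (forall x, is_derive x 1 f (g x)) -> derive1n 1 f = g.
Proof. by move=> d; apply/funext => x; rewrite derive1n1 derive1E; have [] := d x. Qed.

Lemma smooth_antiderivative f g : (forall x, is_derive x 1 f (g x)) -> smooth g -> smooth f.
Proof.
move=> d sg [x|k x]; first by have [] := d x.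
by rewrite derive1Sn -derive1n1 (derive1n1_funext d).
Qed.

(** A class of functions closed under differentiation consists of smooth functions, without any
    formula for iterated derivatives. *)
Lemma smooth_class (C : (R -> R) -> Prop) :
  (forall f, C f -> exists2 g, C g & forall x, is_derive x 1 f (g x)) ->
  forall f, C f -> smooth f.
Proof.
move=> H f Cf k; have : C (derive1n k f).
  by elim: k => // k IH; have [g Cg d] := H _ IH; rewrite derive1nS -derive1n1 (derive1n1_funext d).
by move=> /H [g _ d] x; have [] := d x.
Qed.

Lemma smooth_cst c : smooth (fun=> c : R).
Proof.
apply: (@smooth_class (fun f => exists c, f = fun=> c)); last by exists c.
by move=> _ [d ->]; exists (fun=> 0); [exists 0 | move=> x; exact: der_cst].
Qed.

Lemma smooth_subc f c : smooth f -> smooth (fun x => f x - c).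
Proof.
move=> sf; apply: (@smooth_antiderivative _ (derive1n 1 f)); last exact: smooth_derive1n.
by move=> x; apply: (derE (derB (smooth_der sf x) (der_cst c x))); rewrite subr0.
Qed.

Lemma pi0 : 0 < (pi : R). Proof. exact: pi_gt0. Qed.

Lemma circ_FTC f g : continuous g -> (forall x, is_derive x 1 f (g x)) ->
  \int[mu]_(x in circI) g x = f pi - f (- pi).
Proof.
move=> cg d; rewrite circI_itv; apply: Rintegral_FTC => //.
by have := pi0; lra.
Qed.

Lemma test_primitive h : smooth h -> periodic2pi h -> \int[mu]_(x in circI) h x = 0 ->
  exists2 psi, test_fun psi & derive1n 1 psi = h.
Proof.
move=> sh ph h0; have [H [_ dH]] := antiderivative (smooth_cont sh).
exists H; last exact: derive1n1_funext.
split; first exact: smooth_antiderivative dH sh.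
have dd x : is_derive x 1 (fun x => H (x + 2 * pi) - H x) 0.
  apply: (derE (derB (@der_comp _ H (fun x => x + 2 * pi) x _ _ (dH (x + 2 * pi)) (derD (der_id x) (der_cst (2 * pi) x)))
    (dH x))).
  by rewrite ph addr0 mulr1 subrr.
move=> x; apply/eqP; rewrite -subr_eq0; apply/eqP.
rewrite (der_global_cst dd x (- pi)).
have -> : - pi + 2 * pi = pi :> R by ring.
by rewrite -(circ_FTC (smooth_cont sh) dH).
Qed.

Lemma circ_length : \int[mu]_(x in circI) (1 : R) = 2 * pi.
Proof.
rewrite (@circ_FTC id (fun=> 1)); first by ring.
by move=> x; exact: cvg_cst.
Qed.

(** A smooth periodic function of mean zero is the derivative of a test function. Subtracting means,
    [g] minus its mean is orthogonal to every smooth periodic function. *)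
Lemma weak_cst_orthogonal g : circ_int g ->
  (forall psi, test_fun psi -> \int[mu]_(x in circI) (g x * derive1n 1 psi x) = 0) ->
  exists c, forall f, smooth f -> periodic2pi f ->
    \int[mu]_(x in circI) ((g x - c) * f x) = 0.
Proof.
move=> gi g0; pose c := (\int[mu]_(x in circI) g x) / (2 * pi); exists c => f sf pf.
pose m := (\int[mu]_(x in circI) f x) / (2 * pi).
have pn : (2 * pi : R) != 0 by rewrite mulf_neq0 // gt_eqF // pi0.
have fi := circ_int_cont (smooth_cont sf).
have ci d : circ_int (fun=> d) by apply: circ_int_cont => x; exact: cvg_cst.
have Ic d : \int[mu]_(x in circI) d = d * (2 * pi).
  rewrite -circ_length -circ_RintZ //; apply: eq_Rintegral => x _; by rewrite mulr1.
have [||psi tpsi dpsi] := test_primitive (@smooth_subc f m sf).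
- by move=> x; rewrite pf.
- by rewrite circ_RintB // Ic /m divfK // subrr.
have := g0 psi tpsi; rewrite dpsi => E.
have gf := circ_int_mul gi (smooth_cont sf).
have E1 : \int[mu]_(x in circI) (g x * f x) = m * \int[mu]_(x in circI) g x.
  apply/eqP; rewrite -subr_eq0 -circ_RintZ // -circ_RintB //; last exact: circ_intZ.
  by rewrite -[X in _ == X]E; apply/eqP/eq_Rintegral => x _; ring.
transitivity (\int[mu]_(x in circI) (g x * f x - c * f x)).
  by apply: eq_Rintegral => x _; rewrite mulrBl.
rewrite circ_RintB //; last exact: circ_intZ.
by rewrite circ_RintZ // E1 /c /m; ring.
Qed.

(** Closed under differentiation, with just enough constructors to contain [soft_step]. *)
Inductive trig_exp : (R -> R) -> Prop :=
| TrigExpCst c : trig_exp (fun=> c)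
| TrigExpSin a : trig_exp (fun x => sin (a - x))
| TrigExpCos a : trig_exp (fun x => cos (a - x))
| TrigExpExp f : trig_exp f -> trig_exp (fun x => expR (f x))
| TrigExpD f g : trig_exp f -> trig_exp g -> trig_exp (fun x => f x + g x)
| TrigExpM f g : trig_exp f -> trig_exp g -> trig_exp (fun x => f x * g x).

Lemma trig_exp_smooth f : trig_exp f -> smooth f.
Proof.
apply: smooth_class => {}f; elim => {f}.
- by move=> c; exists (fun=> 0); [exact: TrigExpCst | move=> x; exact: der_cst].
- move=> a; exists (fun x => (-1) * cos (a - x)).
    exact: (TrigExpM (TrigExpCst _) (TrigExpCos _)).
  move=> x; apply: (derE (@der_comp _ sin (fun x => a - x) x _ _ (is_derive_sin (a - x)) (derB (der_cst a x) (der_id x)))).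
  by rewrite sub0r mulrC.
- move=> a; exists (fun x => sin (a - x)); first exact: TrigExpSin.
  move=> x; apply: (derE (@der_comp _ cos (fun x => a - x) x _ _ (is_derive_cos (a - x)) (derB (der_cst a x) (der_id x)))).
  by rewrite sub0r mulrN1 opprK.
- move=> f tf [g tg d]; exists (fun x => expR (f x) * g x).
    exact: (TrigExpM (TrigExpExp tf) tg).
  by move=> x; exact: (@der_comp _ expR f x _ _ (is_derive_expR (f x)) (d x)).
- move=> f1 f2 t1 [g1 tg1 d1] t2 [g2 tg2 d2]; exists (fun x => g1 x + g2 x).
    exact: TrigExpD.
  by move=> x; exact: derD.
- move=> f1 f2 t1 [g1 tg1 d1] t2 [g2 tg2 d2]; exists (fun x => g1 x * f2 x + f1 x * g2 x).
    exact: (TrigExpD (TrigExpM tg1 t2) (TrigExpM t1 tg2)).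
  by move=> x; exact: derM.
Qed.

(* Equal to [2 * sin ((b - x) / 2) * cos (x / 2)], so that on [(-pi, pi)] it has the
   sign of [b - x]. *)
Definition arc_height b x : R := sin (b / 2) + sin (b / 2 - x).

(** The double exponential turns the sign of [arc_height] into the limits 1 and 0 as [k] grows, with
    values in [0, 1]. *)
Definition soft_step b (k : nat) x : R := expR (- expR (- (k%:R * arc_height b x))).

Lemma soft_step_test b k : test_fun (soft_step b k).
Proof.
split.
  rewrite /soft_step /arc_height.
  have -> : (fun x => expR (- expR (- (k%:R * (sin (b / 2) + sin (b / 2 - x)))))) =
    (fun x => expR ((-1) * expR ((-1) * (k%:R * (sin (b / 2) + sin (b / 2 - x)))))).
    by apply/funext => x; rewrite !mulN1r.
  apply: trig_exp_smooth; apply: TrigExpExp; apply: TrigExpM; first exact: TrigExpCst.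
  apply: TrigExpExp; apply: TrigExpM; first exact: TrigExpCst.
  apply: TrigExpM; first exact: TrigExpCst.
  by apply: TrigExpD; [exact: TrigExpCst | exact: TrigExpSin].
move=> x; rewrite /soft_step /arc_height.
have -> : b / 2 - x = b / 2 - (x + 2 * pi) + pi *+ 2 by rewrite mulr_natl; ring.
by rewrite sinD2pi.
Qed.

Lemma soft_step_bounds b k x : 0 <= soft_step b k x <= 1.
Proof. by rewrite expR_ge0 expR_le1 oppr_le0 expR_ge0. Qed.

(** The soft step is exp(-r^k) with r = exp(-arc_height); [r < 1] before [b] and [r > 1] after
    it. *)
Lemma soft_step_cvg b x : -pi < b < pi -> -pi < x < pi -> x != b ->
  soft_step b ^~ x @ \oo --> (if x <= b then 1 else 0 : R).
Proof.
move=> /andP[b1 b2] /andP[x1 x2] xb.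
have hE : arc_height b x = 2 * sin ((b - x) / 2) * cos (x / 2).
  rewrite /arc_height; have -> : sin (b / 2) = sin ((b - x) / 2 + x / 2) by congr sin; ring.
  have -> : sin (b / 2 - x) = sin ((b - x) / 2 - x / 2) by congr sin; lra.
  by rewrite sinD sinB; ring.
have c0 : 0 < cos (x / 2) by apply: cos_gt0_pihalf; move: x1 x2; clear; lra.
pose r := expR (- arc_height b x).
have sE k : soft_step b k x = expR (- r ^+ k) by rewrite /soft_step -mulrN expRM_natl.
have r0 : 0 < r by exact: expR_gt0.
have -> : soft_step b ^~ x = (fun k => expR (- r ^+ k)) by apply/funext.
have [xb'|xb'] := leP x b.
  have r1 : `|r| < 1.
    rewrite ger0_norm ?(ltW r0) // expR_lt1 oppr_lt0 hE !mulr_gt0 //.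
    apply: sin_gt0_pi; have : x < b by rewrite lt_neqAle xb.
    by move: x1 x2 b1 b2; clear; lra.
  have <- : expR (- 0) = 1 :> R by rewrite oppr0 expR0.
  apply: continuous_cvg; first exact: continuous_expR.
  by apply: cvgN; exact: cvg_expr.
have r1 : 1 < r.
  rewrite expR_gt1 oppr_gt0 hE -mulrA mulrCA pmulr_llt0 ?mulr_gt0 //.
  rewrite -oppr_gt0 -sinN; apply: sin_gt0_pi.
  by move: x1 x2 b1 b2 xb'; clear; lra.
have ri : `|r^-1| < 1 by rewrite ger0_norm ?invr_ge0 ?(ltW r0) // invf_lt1.
apply: (@squeeze_cvgr _ _ _ _ (fun=> 0) (fun k => r^-1 ^+ k)); last 2 first.
- exact: cvg_cst.
- exact: cvg_expr.
apply: nearW => k; rewrite expR_ge0 /= expRN exprVn.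
have rk : 0 < r ^+ k by exact: exprn_gt0.
rewrite lef_pV2 ?posrE ?expR_gt0 //.
by apply: le_trans (expR_ge1Dx _); rewrite lerDr.
Qed.

(* Du Bois-Reymond's lemma: the soft steps converge boundedly to indicators of
   arcs starting at [-pi]. *)
Lemma weak_cst g : circ_int g ->
  (forall psi, test_fun psi -> \int[mu]_(x in circI) (g x * derive1n 1 psi x) = 0) ->
  exists c, {ae mu, forall x, circI x -> g x = c}.
Proof.
move=> gi g0; have [c gc] := weak_cst_orthogonal gi g0; exists c.
pose f x := g x - c.
have fi : circ_int f by apply: circ_intB => //; apply: circ_int_cont => x; exact: cvg_cst.
have fi' : mu.-integrable `[- pi, pi] (EFin \o f) by rewrite -circI_itv.
suff H : forall b, - pi < b < pi -> \int[mu]_(x in `[- pi, b]) f x = 0.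
  have h := ae_and (integral_zero_ae fi' H) (ae_and (ae_neq (- pi)) (ae_neq pi)).
  apply: ae_imp h => x [fx [n1 n2]] /andP[h1 h2]; apply/eqP; rewrite -subr_eq0; apply/eqP.
  by apply: fx; rewrite !lt_neqAle h1 h2 eq_sym n1 n2.
move=> b bpi; have /andP[b1 b2] := bpi.
have mI : measurable (`[- pi, b]%classic : set (measurableTypeR R)) by exact: measurable_itv.
pose F k x := (f x * soft_step b k x)%:E.
have Fi k : circ_int (fun x => f x * soft_step b k x).
  by apply: circ_int_mul => //; apply: smooth_cont; exact: (soft_step_test b k).1.
pose L := (EFin \o f) \_ `[- pi, b].
have [||||| _ _] := @dominated_convergence _ _ _ mu circI measurable_circI F L (fun x => `|f x|%:E).
- by move=> k; exact: measurable_int (Fi k).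
- apply/measurable_restrict => //; first exact: measurable_circI.
  apply: measurable_funS (measurable_int _ fi); first exact: measurable_circI.
  by move=> x [].
- have h := ae_and (ae_neq b) (ae_and (ae_neq (- pi)) (ae_neq pi)).
  apply: ae_imp h => x [nb [n1 n2]] /andP[h1 h2].
  have xpi : - pi < x < pi by rewrite !lt_neqAle h1 h2 eq_sym n1 n2.
  have cv := soft_step_cvg bpi xpi nb.
  have -> : L x = (f x * (if x <= b then 1 else 0))%:E.
    rewrite /L patchE; case: ifPn => [|].
      by rewrite inE /= in_itv /= h1 /= => ->; rewrite mulr1.
    by rewrite notin_setE /= in_itv /= h1 /= => /negP/negbTE ->; rewrite mulr0.
  apply: cvg_EFin; first by apply: nearW.
  by apply: cvgMr.
- exact: integrable_norm fi.
- apply: aeW => x k _; rewrite lee_fin normrM ler_piMr //.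
  by have /andP[s0 s1] := soft_step_bounds b k x; rewrite ger0_norm.
have Z : [sequence (\int[mu]_(x in circI) F k x)%E]_k = (fun=> 0%:E).
  apply/funext => k; have : \int[mu]_(x in circI) (f x * soft_step b k x) = 0.
    by apply: gc; case: (soft_step_test b k).
  rewrite /Rintegral => <-; rewrite fineK //.
  exact: (integrable_fin_num measurable_circI (Fi k)).
rewrite Z => cv; have := cvg_unique _ cv (cvg_cst _) => LE.
have <- : fine (\int[mu]_(x in circI) L x)%E = 0 by rewrite LE.
rewrite /L -integral_mkcondr; congr fine; congr (integral _ _ _).
rewrite circI_itv; apply/seteqP; split => x /=; rewrite !in_itv /=.
  by move=> /andP[-> xb]; rewrite (le_trans xb) // ltW.
by case.
Qed.

End TestFunctions.

(** * Piecewise functions on the circle and their weak derivatives *)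

Section PiecewiseCircle.
Context {R : realType}.
Notation mu := (@lebesgue_measure R).
Implicit Types (f g h psi : R -> R) (F G H : bool -> R -> R) (a b c x y z p : R) (i : bool).

(** Each branch is a function on the whole line, so one-sided derivatives never occur; 0 itself is
    assigned to the branch [false]. *)
Definition pw F x : R := F (0 < x) x.

Definition half_circle i x : bool := if i then 0 <= x <= pi else - pi <= x <= 0.

Lemma half_circle_side x : circI x -> half_circle (0 < x) x.
Proof. by rewrite /circI /half_circle /= => /andP[h1 h2]; case: ltP => x0; rewrite ?h1 ?h2 ?(ltW x0). Qed.

Lemma pw_circ_int F : (forall i, continuous (F i)) -> circ_int (pw F).
Proof.
move=> cF; have mF : measurable_fun setT (pw F).
  have -> : pw F = fun x => if 0 < x then F true x else F false x.
    by apply/funext => x; rewrite /pw; case: (0 < x).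
  apply: measurable_fun_ifT; first exact: measurable_fun_ltr.
  - exact: continuous_measurable_fun.
  - exact: continuous_measurable_fun.
apply: measurable_bounded_integrable; [exact: measurable_circI | exact: circI_fin | | ].
  exact: measurable_funTS.
have [M [Mr MP]] := cont_bounded_circ (cF true); have [K [Kr KP]] := cont_bounded_circ (cF false).
exists (Num.max M K); split; first exact: num_real.
move=> y; rewrite gt_max => /andP[My Ky] x Ix; rewrite /pw /=.
by case: (0 < x); [exact: (MP y My) | exact: (KP y Ky)].
Qed.

Lemma pw_FTC F (f : bool -> R -> R) : (forall i, continuous (f i)) ->
  (forall i x, is_derive x 1 (F i) (f i x)) ->
  \int[mu]_(x in circI) pw f x = F true pi - F true 0 + (F false 0 - F false (- pi)).
Proof.
move=> cf d; have p0 := @pi0 R; have fi := pw_circ_int cf.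
have fi' : mu.-integrable `[- pi, pi] (EFin \o pw f) by rewrite -circI_itv.
have E := @Rintegral_itvB R (pw f) (BLeft (- pi)) (BRight pi) 0 fi'.
have E0 : \int[mu]_(x in `[- pi, 0]) pw f x = F false 0 - F false (- pi).
  rewrite -(Rintegral_FTC (f := f false)) //; last by rewrite lerNl oppr0 ltW.
  apply: eq_Rintegral => x; rewrite inE /= in_itv /= => /andP[_ x0].
  by rewrite /pw ltNge x0.
have E1 : \int[mu]_(x in `]0, pi]) pw f x = F true pi - F true 0.
  rewrite -(Rintegral_FTC (f := f true)) ?(ltW p0) //.
  rewrite -Rintegral_itv_obnd_cbnd; last first.
    apply: integrableS (continuous_itv_integrable 0 pi (cf true)) => // x /=.
    by rewrite !in_itv /= => /andP[/ltW -> ->].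
  apply: eq_Rintegral => x; rewrite inE /= in_itv /= => /andP[x0 _].
  by rewrite /pw x0.
rewrite circI_itv -E1 -E0 -E ?subrK // bnd_simp; by [exact: ltW | rewrite lerNl oppr0 ltW].
Qed.

(** The jumps at [pi] and 0 appear as boundary terms: they are the Dirac masses of the
    distributional derivative. *)
Lemma pw_parts F (f : bool -> R -> R) psi : (forall i, continuous (f i)) ->
  (forall i x, is_derive x 1 (F i) (f i x)) -> test_fun psi ->
  \int[mu]_(x in circI) (pw F x * derive1n 1 psi x) =
  (F true pi - F false (- pi)) * psi pi - (F true 0 - F false 0) * psi 0
    - \int[mu]_(x in circI) (pw f x * psi x).
Proof.
move=> cf d [sp pp]; have dp := smooth_der sp; have cp := smooth_cont sp.
have cp1 := smooth_cont (smooth_derive1n sp).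
have cF i : continuous (F i) by move=> x; exact: der_cont (d i x).
have D := @pw_FTC (fun i x => F i x * psi x)
  (fun i x => f i x * psi x + F i x * derive1n 1 psi x) _ (fun i x => derM (d i x) (dp x)).
have I : \int[mu]_(x in circI) (pw f x * psi x + pw F x * derive1n 1 psi x) =
    \int[mu]_(x in circI) (pw f x * psi x) + \int[mu]_(x in circI) (pw F x * derive1n 1 psi x).
  by apply: circ_RintD; apply: circ_int_mul => //; exact: pw_circ_int.
rewrite -(addrK (\int[mu]_(x in circI) (pw f x * psi x)) (\int[mu]_(x in circI) (pw F x * _))).
rewrite [X in X - _]addrC -I; congr (_ - _).
have -> : \int[mu]_(x in circI) (pw f x * psi x + pw F x * derive1n 1 psi x) =
  \int[mu]_(x in circI) pw (fun i x => f i x * psi x + F i x * derive1n 1 psi x) x by [].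
rewrite D; last first.
  move=> i x; apply: (@continuousD _ _ _ (fun x => f i x * psi x) (fun x => F i x * derive1n 1 psi x)).
  - by apply: (@continuousM _ _ (f i) psi); [exact: cf | exact: cp].
  - by apply: (@continuousM _ _ (F i) (derive1n 1 psi)); [exact: cF | exact: cp1].
have -> : psi (- pi) = psi pi by rewrite -pp; congr psi; ring.
ring.
Qed.

Lemma weak_deriv_pw F (f : bool -> R -> R) : (forall i, continuous (f i)) ->
  (forall i x, is_derive x 1 (F i) (f i x)) -> F true 0 = F false 0 ->
  F true pi = F false (- pi) -> weak_deriv (pw F) (pw f).
Proof.
move=> cf d e0 epi psi tp; rewrite (pw_parts cf d tp) e0 epi !subrr !mul0r subrr.
by rewrite sub0r.
Qed.

Lemma test_cst c : test_fun (fun=> c : R).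
Proof. by split; [exact: smooth_cst |]. Qed.

Lemma derive1n1_cst c x : derive1n 1 (fun=> c : R) x = 0.
Proof. by rewrite (@derive1n1_funext _ _ (fun=> 0)) // => y; exact: der_cst. Qed.

Lemma weak_deriv_mean0 f g : weak_deriv f g -> \int[mu]_(x in circI) g x = 0.
Proof.
move=> /(_ _ (test_cst 1)) E.
have E1 : \int[mu]_(x in circI) (f x * derive1n 1 (fun=> 1 : R) x) = 0.
  transitivity (\int[mu]_(x in @circI R) (0 : R)).
    by apply: eq_Rintegral => x _; rewrite derive1n1_cst mulr0.
  by rewrite Rintegral_cst ?mul0r //; exact: measurable_circI.
move: E; rewrite E1 => /esym/eqP; rewrite oppr_eq0 => /eqP E.
by rewrite -[RHS]E; apply: eq_Rintegral => x _; rewrite mulr1.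
Qed.

(** Primitives of [h] that vanish at 0 also agree at the other junction, because a weak derivative
    has mean zero. They have the same weak derivative as [f], hence differ from it by a constant. *)
Lemma weak_primitive f g (h : bool -> R -> R) : circ_int f -> circ_int g -> (forall i, continuous (h i)) ->
  {ae mu, forall x, circI x -> g x = pw h x} -> weak_deriv f g ->
  exists F, [/\ forall i x, is_derive x 1 (F i) (h i x), F true 0 = F false 0,
    F true pi = F false (- pi) & {ae mu, forall x, circI x -> f x = pw F x}].
Proof.
move=> fi gi ch gh fg.
have [G GP] := @choice _ _ (fun i (K : R -> R) => K 0 = 0 /\ forall x, is_derive x 1 K (h i x))
  (fun i => antiderivative (ch i)).
have dG i x : is_derive x 1 (G i) (h i x) by case: (GP i).
have G0 i : G i 0 = 0 by case: (GP i).
have cG i : continuous (G i) by move=> x; exact: der_cont (dG i x).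
have hi := pw_circ_int ch.
have Gpi : G true pi = G false (- pi).
  have := weak_deriv_mean0 fg; rewrite (circ_int_ae gi hi gh) (pw_FTC ch dG) !G0.
  by clear; lra.
have [|psi tp|c cP] := @weak_cst R (fun x => f x - pw G x).
- by apply: circ_intB => //; exact: pw_circ_int.
- have cp1 := smooth_cont (smooth_derive1n tp.1); have cp := smooth_cont tp.1.
  transitivity (\int[mu]_(x in circI) (f x * derive1n 1 psi x - pw G x * derive1n 1 psi x)).
    by apply: eq_Rintegral => x _; rewrite mulrBl.
  rewrite circ_RintB; [ | exact: circ_int_mul | apply: circ_int_mul => //; exact: pw_circ_int].
  rewrite (fg psi tp) (weak_deriv_pw ch dG _ Gpi tp) ?G0 //.
  rewrite (@circ_int_ae _ (fun x => g x * psi x) (fun x => pw h x * psi x)) ?subrr //.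
  - exact: circ_int_mul.
  - exact: circ_int_mul.
  - by apply: ae_imp gh => x gx Ix; rewrite gx.
exists (fun i x => G i x + c); split.
- by move=> i x; apply: (derE (derD (dG i x) (der_cst c x))); rewrite addr0.
- by rewrite !G0.
- by rewrite Gpi.
- by apply: ae_imp cP => x fx Ix; rewrite /pw -(fx Ix) /pw addrC subrK.
Qed.

Lemma ae_dense (P : R -> Prop) a b : {ae mu, forall x, P x} -> a < b ->
  exists2 x, a < x < b & P x.
Proof.
move=> aeP ab; apply: contrapT => nP.
have : mu.-negligible (`]a, b[%classic : set R).
  apply: negligibleS aeP => x /=; rewrite in_itv /= => xab Px.
  by apply: nP; exists x.
move=> ng; have mI : measurable (`]a, b[%classic : set (measurableTypeR R)) by exact: measurable_itv.
have := measure_negligible mI ng.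
rewrite /= lebesgue_measure_itv /= lte_fin ab.
rewrite -EFinB => /eqP; rewrite eqe subr_eq0 => /eqP ba.
by rewrite ba ltxx in ab.
Qed.

Lemma ae_zero_cont f a b : a < b -> continuous f ->
  {ae mu, forall x, a < x < b -> f x = 0} -> forall x, a <= x <= b -> f x = 0.
Proof.
move=> ab cf f0 x xab; apply/eqP; apply/negPn; rewrite -normr_gt0; apply/negP => fx.
have cn : {for x, continuous (fun x => `|f x|)}.
  by apply: (@continuous_comp _ _ _ f Num.norm); [exact: cf | exact: norm_continuous].
have [e e0 H] := near_pos cn fx.
have [|y] := @ae_dense _ (Num.max a (x - e)) (Num.min b (x + e)) f0.
  by rewrite lt_min !gt_max; move: xab ab e0; clear; lra.
rewrite gt_max lt_min => /andP[/andP[ya xe] /andP[yb yx]] fy.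
have := H y; rewrite fy ?ya // normr0 ltxx => /(_ _) h; apply: notF; apply: h.
by rewrite ltr_norml; move: xe yx; clear; lra.
Qed.

Lemma cont_ae_eq_pw f F : continuous f -> (forall i, continuous (F i)) ->
  {ae mu, forall x, circI x -> f x = pw F x} -> forall i x, half_circle i x -> f x = F i x.
Proof.
move=> cf cF fF i x; have p0 := @pi0 R.
have cd : continuous (fun x => f x - F i x).
  by move=> y; apply: (@continuousB _ _ _ f (F i)); [exact: cf | exact: cF].
move=> hx; apply/eqP; rewrite -subr_eq0; apply/eqP.
case: i cd hx => cd hx.
  apply: (ae_zero_cont p0 cd _ hx).
  apply: ae_imp fF => y fy /andP[y0 yp].
  by rewrite fy ?/pw ?y0 ?subrr // /circI /=; move: y0 yp p0; clear; lra.
have p0' : - pi < 0 :> R by rewrite oppr_lt0.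
apply: (ae_zero_cont p0' cd _ hx).
apply: ae_imp fF => y fy /andP[y0 yp].
rewrite fy ?/pw ?subrr // 1?ltNge ?(ltW yp) ?subrr //.
by rewrite /circI /=; move: y0 yp p0; clear; lra.
Qed.

Lemma periodic_reduce x : exists2 y, circI y & forall f, periodic2pi f -> f x = f y.
Proof.
have p0 := @pi0 R; have p2 : 0 < 2 * pi :> R by rewrite mulr_gt0.
have per f (n : int) y : periodic2pi f -> f (y + 2 * pi * n%:~R) = f y.
  move=> pf; have pn (m : nat) z : f (z + 2 * pi * m%:R) = f z.
    elim: m z => [|m IH] z; first by rewrite mulr0 addr0.
    by rewrite -[m.+1%:R]natr1 mulrDr mulr1 addrA pf IH.
  case: n => m; first by rewrite -pmulrn pn.
  rewrite NegzE -(pn m.+1 (y + _)); congr f.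
  by rewrite mulrNz mulrN -addrA -pmulrn addNr addr0.
pose k := Num.floor ((x + pi) / (2 * pi)).
exists (x - 2 * pi * k%:~R); last first.
  by move=> f pf; rewrite -(per f k (x - 2 * pi * k%:~R) pf) subrK.
have h1 : k%:~R * (2 * pi) <= x + pi by rewrite -ler_pdivlMr //; exact: Num.Theory.floor_le.
have h2 : x + pi < (k%:~R + 1) * (2 * pi).
  by rewrite -ltr_pdivrMr // -[1]/(1%:~R) -intrD; exact: floorD1_gt.
by rewrite /circI /=; move: h1 h2; clear; lra.
Qed.

Lemma periodic_eq f g : periodic2pi f -> periodic2pi g ->
  (forall x, circI x -> f x = g x) -> f = g.
Proof.
move=> pf pg H; apply/funext => x; have [y Iy E] := periodic_reduce x.
by rewrite (E f) // (E g) // H.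
Qed.

Lemma acos_cos_itv x : 0 <= acos (cos x) <= (pi : R).
Proof. by rewrite acos_ge0 ?acos_lepi ?cos_geN1 ?cos_le1. Qed.

Lemma cos_acos_cos x : cos (acos (cos x)) = cos x :> R.
Proof. by rewrite acosK // in_itv /= cos_geN1 cos_le1. Qed.

Lemma continuous_acos_cos : continuous (fun x : R => acos (cos x)).
Proof.
move=> x; apply/cvgrPdist_lt => e e0.
pose A y : R := acos (cos y).
have AI y : A y \in `[0, pi] by rewrite in_itv /= acos_cos_itv.
have lo : \forall y \near x, A x - e < A y.
  have [h|h] := leP 0 (A x - e); last first.
    by apply/nbhs_ballP; exists 1 => //= y _; apply: (lt_le_trans h); case/andP: (acos_cos_itv y).
  have hI : A x - e \in `[0, pi].
    by rewrite in_itv /= h; have := AI x; rewrite in_itv /=; move: e0; clear; lra.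
  have : \forall y \near x, cos y < cos (A x - e).
    apply: (cvgr_lt (cos x) (@continuous_cos R x)).
    by rewrite -[cos x]cos_acos_cos ltr_cos ?AI //; move: e0; rewrite /A; clear; lra.
  by apply: (@filterS _ (nbhs x)) => y; rewrite -[cos y]cos_acos_cos ltr_cos ?AI.
have hi : \forall y \near x, A y < A x + e.
  have [h|h] := leP (A x + e) pi; last first.
    by apply/nbhs_ballP; exists 1 => //= y _; apply: (le_lt_trans _ h); case/andP: (acos_cos_itv y).
  have hI : A x + e \in `[0, pi].
    by rewrite in_itv /= h andbT; have := AI x; rewrite in_itv /=; move: e0; clear; lra.
  have : \forall y \near x, cos (A x + e) < cos y.
    apply: (cvgr_gt (cos x) (@continuous_cos R x)).
    by rewrite -[cos x]cos_acos_cos ltr_cos ?AI //; move: e0; rewrite /A; clear; lra.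
  by apply: (@filterS _ (nbhs x)) => y; rewrite -[cos y]cos_acos_cos ltr_cos ?AI.
near=> y; rewrite ltr_norml.
have h1 : A x - e < A y by near: y.
have h2 : A y < A x + e by near: y.
by move: h1 h2; rewrite /A; clear; lra.
Unshelve. all: by end_near. Qed.

Lemma continuous_if f g h : continuous f -> continuous g -> continuous h ->
  (forall x, f x = 0 -> g x = h x) -> continuous (fun x => if 0 < f x then g x else h x).
Proof.
move=> cf cg ch E x; apply/cvgrPdist_lt => e e0.
have ng : \forall y \near x, `|g x - g y| < e by move/cvgrPdist_lt: (cg x); exact.
have nh : \forall y \near x, `|h x - h y| < e by move/cvgrPdist_lt: (ch x); exact.
have [fx|fx|fx] := ltgtP (f x) 0.
- have nf : \forall y \near x, f y < 0 by apply: (cvgr_lt (f x) (cf x)).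
  near=> y; have fy : f y < 0 by near: y.
  rewrite [0 < f y]ltNge (ltW fy) /=; near: y; exact: nh.
- have nf : \forall y \near x, 0 < f y by apply: (cvgr_gt (f x) (cf x)).
  near=> y; have fy : 0 < f y by near: y.
  rewrite fy; near: y; exact: ng.
- near=> y.
  have [_|_] := ltP 0 (f y); last by near: y; exact: nh.
  by rewrite -(E x fx); near: y; exact: ng.
Unshelve. all: by end_near. Qed.

Lemma periodic_glue F : (forall i x, half_circle i x -> {for x, continuous (F i)}) ->
  F true 0 = F false 0 -> F true pi = F false (- pi) ->
  exists f, [/\ periodic2pi f, continuous f, forall x, circI x -> f x = pw F x &
    forall i x, half_circle i x -> f x = F i x].
Proof.
move=> cF e0 epi; have p0 := @pi0 R.
(* [acos (cos x)] folds the line onto [[0, pi]] and the sign of [sin] selects the half circle; where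
   [sin] vanishes the two branches agree. *)
pose f x := if 0 < sin x then F true (acos (cos x)) else F false (- acos (cos x)).
have fx i x : half_circle i x -> f x = F i x.
  rewrite /f /half_circle; case: i => /andP[h1 h2].
    have aE : acos (cos x) = x by rewrite cosK // in_itv /= h1.
    rewrite aE; case: ltP => // s0; have [x0|x0] := leP x 0.
      by have -> : x = 0 by [apply/le_anti/andP]; rewrite oppr0.
    have [xp|xp] := ltP x pi.
      by have := @sin_gt0_pi R x; rewrite x0 xp ltNge s0 => /(_ isT).
    by have -> : x = pi by [apply/le_anti/andP].
  rewrite cosKN ?h1 // opprK ltNge; have : 0 <= sin (- x) by apply: sin_ge0_pi; lra.
  by rewrite sinN oppr_ge0 => ->.
exists f; split => //.
- move=> x; rewrite /f.
  have -> : x + 2 * pi = x + pi *+ 2 by rewrite mulr_natl.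
  by rewrite sinD2pi cosD2pi.
- have cA := continuous_acos_cos.
  apply: continuous_if.
  + exact: continuous_sin.
  + move=> x; apply: (@continuous_comp _ _ _ (fun x => acos (cos x)) (F true)); first exact: cA.
    by apply: cF; exact: acos_cos_itv.
  + move=> x; apply: (@continuous_comp _ _ _ (fun x => - acos (cos x)) (F false)).
      by apply: continuousN; exact: cA.
    by apply: cF; rewrite /half_circle oppr_le0 lerN2; case/andP: (acos_cos_itv x) => -> ->.
  + move=> x s0; have := cos2Dsin2 x; rewrite s0 expr0n addr0 => /eqP.
    rewrite sqrf_eq1 => /orP[] /eqP ->; first by rewrite acos1 oppr0.
    by rewrite acosN1.
- by move=> x Ix; exact: (fx _ _ (half_circle_side Ix)).
Qed.

End PiecewiseCircle.

(** * Solutions on the circle and their arms *)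

Section SolutionArms.
Context {R : realType}.
Implicit Types (u v : bool -> R -> R) (N f g phi w psi : R -> R)
  (x y z a b c l q t gam eta mu Z p : R) (i : bool) (n : nat).

Lemma qexp_bounds n : (3 <= n)%N -> 2 < @qexp R n <= 6.
Proof.
move=> n3; have h : 3 <= n%:R :> R by rewrite ler_nat.
have d : 0 < n%:R - 2 :> R by move: h; clear; lra.
by rewrite /qexp ltr_pdivlMr // ler_pdivrMr //; move: h; clear; lra.
Qed.

Lemma kappa_gt0 n : (3 <= n)%N -> 0 < @kappa R n.
Proof.
move=> n3; have h : 3 <= n%:R :> R by rewrite ler_nat.
by rewrite /kappa divr_gt0 //; move: h; clear; lra.
Qed.

Lemma lam_side x : - pi < x < pi -> x != 0 -> lam x = sgb (0 < x).
Proof.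
move=> /andP[x1 x2] xn; rewrite /lam /sgb; have [x0|x0] := ltP 0 x.
  have s : 0 < sin x by apply: sin_gt0_pi; rewrite x0.
  by rewrite ltNge (ltW s) /= s.
have s : 0 < sin (- x).
  by apply: sin_gt0_pi; rewrite oppr_gt0 lt_neqAle xn x0 ltrNl.
by rewrite sinN oppr_gt0 in s; rewrite s.
Qed.

Lemma lam_ae : {ae leb, forall x : R, circI x -> lam x = sgb (0 < x)}.
Proof.
have h := ae_and (ae_neq (- pi)) (ae_and (ae_neq (pi : R)) (ae_neq 0)).
apply: ae_imp h => x [n1 [n2 n0]] /andP[h1 h2]; apply: lam_side => //.
by rewrite !lt_neqAle h1 h2 eq_sym n1 n2.
Qed.

Lemma lam_le1 x : `|lam x| <= 1.
Proof. by rewrite /lam; case: ifP => _; [rewrite normrN1|case: ifP; rewrite ?normr1 ?normr0]. Qed.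

Lemma lam_circ_int N : continuous N -> circ_int (fun x => lam x * N x).
Proof.
move=> cN; have ml : measurable_fun setT (@lam R).
  have ms : measurable_fun setT (@sin R).
    by apply: continuous_measurable_fun; exact: continuous_sin.
  apply: measurable_fun_ifT; [exact: measurable_fun_ltr | exact: measurable_cst | ].
  by apply: measurable_fun_ifT; [exact: measurable_fun_ltr | exact: measurable_cst |].
have mN : measurable_fun setT N by exact: continuous_measurable_fun.
apply: (le_integrable (@measurable_circI R) _ _ (circ_int_cont cN)).
  by apply/measurable_EFinP; apply: measurable_funTS; exact: measurable_funM.
by move=> x _ /=; rewrite lee_fin normrM ler_piMl // lam_le1.
Qed.

Lemma gammaN_primitive N : continuous N -> (forall x, 0 < N x) ->
  exists M, [/\ forall x, is_derive x 1 M (N x), 0 < M pi - M 0, 0 < M 0 - M (- pi) &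
    gammaN N = ((M 0 - M (- pi)) - (M pi - M 0)) / (M pi - M (- pi))].
Proof.
move=> cN N0; have p0 := @pi0 R; have [M [_ dM]] := antiderivative cN.
have lt x y : x < y -> 0 < M y - M x.
  by move=> xy; rewrite subr_gt0; exact: (@der_gt0_lt _ M x y N).
exists M; split; [exact: dM | exact: lt | by apply: lt; rewrite oppr_lt0 |].
rewrite /gammaN (circ_FTC cN dM).
have -> : \int[leb]_(x in circI) (lam x * N x) = M pi - M 0 - (M 0 - M (- pi)).
  transitivity (\int[leb]_(x in circI) pw (fun i x => sgb i * N x) x).
    apply: circ_int_ae; first exact: lam_circ_int.
      by apply: pw_circ_int => i x; apply: cvgMr; exact: cN.
    by apply: ae_imp lam_ae => x lx Ix; rewrite /pw lx.
  rewrite (pw_FTC (F := fun i x => sgb i * M x)).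
  - by rewrite /sgb; ring.
  - by move=> i x; apply: cvgMr; exact: cN.
by rewrite -[LHS]mulNr; congr (_ / _); ring.
Qed.

Lemma gammaN_lt1 N : continuous N -> (forall x, 0 < N x) -> `|gammaN N| < 1.
Proof.
move=> cN N0; have [M [_ h1 h2 ->]] := gammaN_primitive cN N0.
have d : 0 < M pi - M (- pi) by move: h1 h2; clear; lra.
by rewrite ltr_norml ltr_pdivlMr // ltr_pdivrMr //; move: h1 h2; clear; lra.
Qed.

Lemma far_t_gt1 N t : continuous N -> (forall x, 0 < N x) -> 2 < `|t - gammaN N| -> 1 < `|t|.
Proof.
move=> cN N0 far; have g1 := gammaN_lt1 cN N0.
by have := ler_normB t (gammaN N); move: far g1; clear; lra.
Qed.

(** Testing with 1 gives [b = c]. As b times the sign has derivative 2 b (delta_0 - delta_pi), it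
    differs from [w1 / (2 * N)] by a constant, which the vanishing mean of [w1] identifies as
    [b * gammaN N]. *)
Lemma second_equation N b phi w w1 c : smooth N -> (forall x, 0 < N x) ->
  circ_int w1 -> weak_deriv w w1 ->
  (forall psi, test_fun psi ->
     - (\int[leb]_(x in circI) (w1 x / (2 * N x) * derive1n 1 psi x))
     - (2 * b * psi 0 - 2 * c * psi pi) = 0) ->
  b = c /\ {ae leb, forall x, circI x -> w1 x / (2 * N x) = b * (sgb (0 < x) + gammaN N)}.
Proof.
move=> sN N0 w1i ww E; have cN := smooth_cont sN.
have bc : b = c.
  have := E _ (test_cst 1).
  have -> : \int[leb]_(x in circI) (w1 x / (2 * N x) * derive1n 1 (fun=> 1 : R) x) = 0.
    transitivity (\int[leb]_(x in @circI R) (0 : R)).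
      by apply: eq_Rintegral => x _; rewrite derive1n1_cst mulr0.
    by rewrite Rintegral_cst ?mul0r //; exact: measurable_circI.
  by clear; lra.
rewrite -bc in E *; split=> //.
have cinv : continuous (fun x => (2 * N x)^-1).
  move=> x; apply: cvgV; first by rewrite mulf_neq0 // gt_eqF.
  by apply: cvgMr; exact: cN.
have gi : circ_int (fun x => w1 x / (2 * N x)) by exact: circ_int_mul.
pose F i (x : R) := b * sgb i; pose F0 (i : bool) (x : R) := 0 : R.
have cF0 i : continuous (F0 i) by move=> x; exact: cvg_cst.
have cF i : continuous (F i) by move=> x; exact: cvg_cst.
have dF i x : is_derive x 1 (F i) (F0 i x) by exact: der_cst.
have Fi := pw_circ_int cF.
have [|psi tp|d dP] := @weak_cst R (fun x => w1 x / (2 * N x) - pw F x).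
- exact: circ_intB.
- have cp1 := smooth_cont (smooth_derive1n tp.1).
  transitivity (\int[leb]_(x in circI) (w1 x / (2 * N x) * derive1n 1 psi x -
      pw F x * derive1n 1 psi x)).
    by apply: eq_Rintegral => x _; rewrite mulrBl.
  rewrite circ_RintB; [ | exact: circ_int_mul | exact: circ_int_mul].
  have E0 : \int[leb]_(x in circI) (pw F0 x * psi x) = 0.
    transitivity (\int[leb]_(x in @circI R) (0 : R)).
      by apply: eq_Rintegral => x _; rewrite /pw mul0r.
    by rewrite Rintegral_cst ?mul0r //; exact: measurable_circI.
  have := E psi tp; rewrite (pw_parts cF0 dF tp) E0 /F /sgb.
  by clear; lra.
have [M [dM h1 h2 gE]] := gammaN_primitive cN N0.
have := weak_deriv_mean0 ww.
pose W i x := (2 * (b * sgb i + d)) * N x.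
have cW i : continuous (W i) by move=> x; apply: cvgMr; exact: cN.
rewrite (@circ_int_ae _ _ (pw W)) //; last 2 first.
- exact: pw_circ_int.
- apply: ae_imp dP => x xd Ix; have := xd Ix; rewrite /pw /F /W => xE.
  have Nn : N x != 0 by rewrite gt_eqF.
  have -> : w1 x = w1 x / (2 * N x) * (2 * N x) by rewrite divfK // mulf_neq0.
  have -> : w1 x / (2 * N x) = b * sgb (0 < x) + d by rewrite -xE addrC subrK.
  by ring.
rewrite (pw_FTC (F := fun i x => (2 * (b * sgb i + d)) * M x)) //.
rewrite /sgb => dE.
have dn : M pi - M (- pi) != 0 by rewrite gt_eqF //; move: h1 h2; clear; lra.
have {}dE : d = b * gammaN N.
  apply: (mulIf dn); rewrite gE -mulrA divfK //.
  by move: dE; clear; lra.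
by apply: ae_imp dP => x xd Ix; rewrite mulrDr -dE -(xd Ix) /pw /F addrC subrK.
Qed.

Lemma first_equation n t eta mu b gam s (r lx f f2 : R) : (3 <= n)%N -> 0 < f ->
  r = b * (s + gam) -> lx = s ->
  - 2 * kappa n * qexp n * f2 - 2 * eta ^+ 2 * f `^ (- qexp n - 1)
    - kappa n * (mu + r) ^+ 2 * f `^ (- qexp n - 1)
    + kappa n * (t + lx) ^+ 2 * f `^ (qexp n - 1) = 0 <->
  f2 = lichF (qexp n) ((t + s) ^+ 2) (2 * eta ^+ 2 / kappa n + (mu + b * (s + gam)) ^+ 2) f.
Proof.
move=> n3 f0 -> ->; have k0 : @kappa R n != 0 by rewrite gt_eqF // kappa_gt0.
have q0 : @qexp R n != 0.
  by have /andP[h _] := qexp_bounds n3; rewrite gt_eqF //; move: h; clear; lra.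
rewrite /lichF; set A := f `^ (qexp n - 1); set B := f `^ _; set X := (mu + _) ^+ 2.
set Y := (t + s) ^+ 2; split => [E|->].
  have kq : 2 * kappa n * @qexp R n != 0 by rewrite mulf_neq0 // mulf_neq0 // pnatr_eq0.
  apply: (mulfI kq); transitivity (- 2 * eta ^+ 2 * B - kappa n * X * B + kappa n * Y * A).
    by move: E; clear; lra.
  by field; rewrite k0 q0.
by field; rewrite k0 q0.
Qed.

(** The odd part about [c] vanishes at the centre and at the end, and it and its negative are convex
    where positive because [F] increases; so it is zero. *)
Lemma symmetric_profile (F : R -> R) f g c l : 0 < l ->
  (forall x y, 0 < x -> x < y -> F x < F y) ->
  (forall x, c - l <= x <= c + l -> is_derive x 1 f (g x)) ->
  (forall x, c - l <= x <= c + l -> is_derive x 1 g (F (f x))) ->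
  (forall x, c - l <= x <= c + l -> 0 < f x) -> f (c - l) = f (c + l) ->
  g c = 0 /\ forall z, 0 <= z <= l -> f (c - z) = f (c + z).
Proof.
move=> l0 Fi df dg fp fe.
have I1 z : 0 <= z <= l -> c - l <= c - z <= c + l by clear -l0; lra.
have I2 z : 0 <= z <= l -> c - l <= c + z <= c + l by clear -l0; lra.
have dm z : is_derive z 1 (fun z => c - z) (-1).
  by apply: (derE (derB (der_cst c z) (der_id z))); rewrite sub0r.
have dp z : is_derive z 1 (fun z => c + z) 1.
  by apply: (derE (derD (der_cst c z) (der_id z))); rewrite add0r.
have d1 z : 0 <= z <= l -> is_derive z 1 (fun z => f (c + z) - f (c - z))
    (g (c + z) + g (c - z)).
  move=> zl; apply: (derE (derB
    (@der_comp _ f (fun z => c + z) z _ _ (df _ (I2 z zl)) (dp z))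
    (@der_comp _ f (fun z => c - z) z _ _ (df _ (I1 z zl)) (dm z)))).
  by ring.
have d2 z : 0 <= z <= l -> is_derive z 1 (fun z => g (c + z) + g (c - z))
    (F (f (c + z)) - F (f (c - z))).
  move=> zl; apply: (derE (derD
    (@der_comp _ g (fun z => c + z) z _ _ (dg _ (I2 z zl)) (dp z))
    (@der_comp _ g (fun z => c - z) z _ _ (dg _ (I1 z zl)) (dm z)))).
  by ring.
have le z : 0 <= z <= l -> f (c + z) - f (c - z) <= 0.
  apply: (convex_dirichlet l0 d1 d2).
  - by move=> y yl; rewrite !subr_gt0 => h; apply: Fi => //; exact: (fp _ (I1 y yl)).
  - by right; rewrite addr0 subr0 subrr.
  - by rewrite fe subrr.
have ge z : 0 <= z <= l -> - (f (c + z) - f (c - z)) <= 0.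
  apply: (convex_dirichlet l0 (fun z zl => derN (d1 z zl)) (fun z zl => derN (d2 z zl))).
  - move=> y yl; rewrite !oppr_gt0 !subr_lt0 => h; apply: Fi => //; exact: (fp _ (I2 y yl)).
  - by right; rewrite addr0 subr0 subrr oppr0.
  - by rewrite fe subrr oppr0.
have sym z : 0 <= z <= l -> f (c - z) = f (c + z).
  by move=> zl; have := le z zl; have := ge z zl; clear; lra.
split=> //; have l00 : 0 <= (0 : R) <= l by rewrite lexx ltW.
have D := d1 0 l00; rewrite addr0 subr0 in D.
have [gc|gc|//] := ltgtP (g c) 0.
- have [|e e0 H] := der_pos_local (derN D); first by move: gc; clear; lra.
  pose z := Num.min (e / 2) l.
  have z0 : 0 < z by rewrite lt_min l0 divr_gt0.
  have ze : z < e by rewrite gt_min; apply/orP; left; move: e0; clear; lra.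
  have zl : 0 <= z <= l by rewrite (ltW z0) ge_min lexx orbT.
  have [|_] := H z; first by rewrite z0.
  by rewrite add0r (sym z zl) subrr addr0 subr0 subrr ltxx.
- have [|e e0 H] := der_pos_local D; first by move: gc; clear; lra.
  pose z := Num.min (e / 2) l.
  have z0 : 0 < z by rewrite lt_min l0 divr_gt0.
  have ze : z < e by rewrite gt_min; apply/orP; left; move: e0; clear; lra.
  have zl : 0 <= z <= l by rewrite (ltW z0) ge_min lexx orbT.
  have [|_] := H z; first by rewrite z0.
  by rewrite add0r (sym z zl) subrr addr0 subr0 subrr ltxx.
Qed.

(** On [circI], the distance to the midpoint pi/2 or -pi/2 on the same side. *)
Definition arm_position x : R := `|pi / 2 - `|x| |.

(** [weak_primitive], applied to [f1] and then to [phi], makes the equation classical on each closed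
    half circle. Since phi(0)^q = phi(pi)^q, the end values agree and each half folds at its
    midpoint. *)
Lemma solution_arms n N eta mu t p phi w : (3 <= n)%N -> smooth N -> (forall x, 0 < N x) ->
  2 < `|t - gammaN N| -> is_solution n N eta mu t p phi w ->
  exists b u v, [/\ 0 < b,
    arms (qexp n) (pi / 2) t (gammaN N) mu (2 * eta ^+ 2 / kappa n) b u v,
    u true (pi / 2) `^ qexp n = b,
    forall x, circI x -> phi x = u (0 < x) (arm_position x) &
    exists w1, [/\ circ_int w1, weak_deriv w w1 &
      {ae leb, forall x, circI x -> w1 x = 2 * N x * (b * (sgb (0 < x) + gammaN N))}]].
Proof.
move=> n3 sN N0 far [p1 [_ [cphi [phi0 [_ [_ [Lphi [_]]]]]]]].
move=> [f1 [f2 [w1 [L1 [L2 [Lw1 [wd1 [wd2 [wdw [eq1 eq2]]]]]]]]]].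
have p0 := @pi0 R; have cN := smooth_cont sN.
have t1 := far_t_gt1 cN N0 far; have /andP[q2 q6] := @qexp_bounds n n3.
set q := qexp n in q2 q6 *; set gam := gammaN N; set Z := 2 * eta ^+ 2 / kappa n.
have Z0 : 0 <= Z by apply: divr_ge0; [apply: mulr_ge0 => //; exact: sqr_ge0 | apply/ltW; exact: kappa_gt0].
have iw1 := Lp_circ_int p1 Lw1; have if1 := Lp_circ_int p1 L1.
have if2 := Lp_circ_int p1 L2; have iphi := circ_int_cont cphi.
pose b := phi 0 `^ q.
have [|bE w1E] := @second_equation N b phi w w1 (phi pi `^ q) sN N0 iw1 wdw.
  by move=> psi tp; rewrite -[RHS](eq2 psi tp).
have b0 : 0 < b by exact: powR_gt0.
pose F i := lichF q (acoef t i) (ccoef Z mu gam b i).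
pose h i x := F i (phi x).
have ch i : continuous (h i).
  move=> x; apply: (@continuous_comp _ _ _ phi (F i)); first exact: cphi.
  exact: lichF_cont.
have fh : {ae leb, forall x, circI x -> f2 x = pw h x}.
  apply: ae_imp (ae_and eq1 (ae_and w1E (@lam_ae))) => x [e1 [e2 e3]] Ix.
  rewrite /pw /h /F /acoef /ccoef.
  have [H _] := first_equation t eta mu (f2 x) n3 (phi0 x) (e2 Ix) (e3 Ix).
  exact: (H (e1 Ix)).
have [V [dV V0 Vpi fV]] := weak_primitive if1 if2 ch fh wd2.
have cV i : continuous (V i) by move=> x; exact: der_cont (dV i x).
have [J [dJ J0 Jpi fJ]] := weak_primitive iphi if1 cV fV wd1.
have cJ i : continuous (J i) by move=> x; exact: der_cont (dJ i x).
have phiJ := cont_ae_eq_pw cphi cJ fJ.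
have Fi i x y : 0 < x -> x < y -> F i x < F i y.
  by move=> x0 xy; apply: lichF_incr => //; [exact: acoef_gt0 | exact: ccoef_ge0].
have phi0pi : phi 0 = phi pi.
  have qn : q != 0 by rewrite gt_eqF //; move: q2; clear; lra.
  have E y : 0 < y -> y = (y `^ q) `^ q^-1.
    by move=> y0; rewrite -[RHS]powRrM mulfV // powRr1 // ltW.
  by rewrite (E _ (phi0 0)) (E _ (phi0 pi)) -bE.
have l0 : 0 < pi / 2 :> R by rewrite divr_gt0.
pose m i : R := sgb i * (pi / 2).
have mI i x : m i - pi / 2 <= x <= m i + pi / 2 -> half_circle i x.
  by rewrite /m /sgb /half_circle; case: i; clear; lra.
have Je i : J i (m i - pi / 2) = J i (m i + pi / 2).
  rewrite -!phiJ; [ | apply: mI; move: l0; clear; lra | apply: mI; move: l0; clear; lra].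
  rewrite /m /sgb; case: i.
    have -> : 1 * (pi / 2) - pi / 2 = 0 :> R by ring.
    by have -> : 1 * (pi / 2) + pi / 2 = pi :> R by field.
  have -> : -1 * (pi / 2) + pi / 2 = 0 :> R by ring.
  have -> : -1 * (pi / 2) - pi / 2 = - pi :> R by field.
  rewrite phi0pi (phiJ true pi) ?(phiJ false (- pi)) ?Jpi // /half_circle ?lexx ?(ltW p0) //.
  by rewrite oppr_le0 ltW.
have sym i : V i (m i) = 0 /\ forall z, 0 <= z <= pi / 2 -> J i (m i - z) = J i (m i + z).
  have d1 x : m i - pi / 2 <= x <= m i + pi / 2 -> is_derive x 1 (J i) (V i x).
    by move=> _; exact: dJ.
  have d2 x : m i - pi / 2 <= x <= m i + pi / 2 -> is_derive x 1 (V i) (F i (J i x)).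
    by move=> xI; rewrite -(phiJ i x (mI i x xI)); exact: dV.
  have J_gt0 x : m i - pi / 2 <= x <= m i + pi / 2 -> 0 < J i x.
    by move=> xI; rewrite -(phiJ i x (mI i x xI)); exact: phi0.
  exact: (symmetric_profile l0 (Fi i) d1 d2 J_gt0 (Je i)).
(* Both arms run from a midpoint to the junction 0; the quarters ending at [pi] and [- pi] are their
   mirror images. *)
pose u i z := J i (m i - sgb i * z); pose v i z := - sgb i * V i (m i - sgb i * z).
have zI i z : 0 <= z <= pi / 2 -> m i - pi / 2 <= m i - sgb i * z <= m i + pi / 2.
  by rewrite /m /sgb; case: i; clear; lra.
have dz i z : is_derive z 1 (fun z => m i - sgb i * z) (- sgb i).
  by apply: (derE (derB (der_cst (m i) z) (derZ (sgb i) (der_id z)))); rewrite sub0r mulr1.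
have ml i : m i - sgb i * (pi / 2) = 0 by rewrite /m subrr.
exists b, u, v; split => //.
- split; last first.
    by move=> i z zl; rewrite /u -(phiJ i _ (mI i _ (zI i z zl))); exact: phi0.
  split.
  + move=> i z zl; apply: (derE (@der_comp _ (J i) _ z _ _ (dJ i _) (dz i z))).
    by rewrite mulrC.
  + move=> i z zl.
    apply: (derE (derZ (- sgb i) (@der_comp _ (V i) _ z _ _ (dV i _) (dz i z)))).
    rewrite /u -(phiJ i _ (mI i _ (zI i z zl))) /h /F /sgb.
    by case: (i); ring.
  + by move=> i; rewrite /v mulr0 subr0 (sym i).1 mulr0.
  + by rewrite /u !ml.
  + by rewrite /v !ml V0 /sgb; ring.
- rewrite /u ml -(phiJ true 0) // /half_circle lexx; exact: ltW.
- move=> x Ix; have hx := half_circle_side Ix; rewrite (phiJ _ _ hx) /u /arm_position.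
  move: Ix hx; rewrite /circI /half_circle /=; case: ltP => x0 /andP[x1 x2] _.
    have := (sym true).2; rewrite /m /sgb !mul1r (gtr0_norm x0) => sy.
    have [h1|h1] := leP 0 (pi / 2 - x); first by rewrite (ger0_norm h1); congr (J _ _); ring.
    rewrite (ltr0_norm h1) opprB.
    have := sy (x - pi / 2); have -> : pi / 2 + (x - pi / 2) = x by ring.
    by move=> <- //; move: h1 x2; clear; lra.
  have := (sym false).2; rewrite /m /sgb (ler0_norm x0) opprK => sy.
  have [h1|h1] := leP 0 (pi / 2 + x); first by rewrite (ger0_norm h1); congr (J _ _); ring.
  rewrite (ltr0_norm h1).
  have := sy (- (pi / 2 + x)).
  have -> : -1 * (pi / 2) - - (pi / 2 + x) = x by ring.
  move=> ->; first by congr (J _ _); ring.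
  by move: h1 x1; clear; lra.
exists w1; split => //; apply: ae_imp w1E => x wx Ix.
by rewrite -(wx Ix) mulrC divfK // mulf_neq0 // gt_eqF.
Qed.

End SolutionArms.

(** * From arms back to a solution on the circle *)

Section ArmsSolution.
Context {R : realType}.
Implicit Types (u v F : bool -> R -> R) (N f g phi w psi : R -> R)
  (x y z a b c l q t gam eta mu Z p : R) (i : bool) (n : nat).

Lemma pw_Lp2 F : (forall i, continuous (F i)) -> Lp 2 (pw F).
Proof.
move=> cF; split; first exact: circ_int_measurable (pw_circ_int cF).
have : circ_int (pw (fun i x => F i x * F i x)).
  by apply: pw_circ_int => i x; apply: (@continuousM _ _ (F i) (F i)); exact: cF.
move=> /integrableP[_]; apply: le_lt_trans; rewrite le_eqVlt; apply/orP; left; apply/eqP.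
apply: eq_integral => x _ /=; congr EFin.
by rewrite powR_mulrn // real_normK ?num_real // expr2 /pw [RHS]ger0_norm // -expr2 sqr_ge0.
Qed.

Lemma cont_Lp2 f : continuous f -> Lp 2 f.
Proof. by move=> cf; exact: (@pw_Lp2 (fun=> f)). Qed.

Lemma continuous_arm_position : continuous (@arm_position R).
Proof.
apply: (@lipschitz_cont _ _ 1) => x y; rewrite mul1r /arm_position.
apply: (le_trans (ler_dist_dist _ _)).
have -> : pi / 2 - `|x| - (pi / 2 - `|y|) = `|y| - `|x| by ring.
by rewrite (distrC x); exact: ler_dist_dist.
Qed.

Definition arm_center i : R := sgb i * (pi / 2).

Lemma arm_position_half i x : half_circle i x -> arm_position x = `|x - arm_center i|.
Proof.
rewrite /half_circle /arm_position /arm_center /sgb; case: i => /andP[h1 h2].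
  by rewrite (ger0_norm h1) mul1r distrC.
by rewrite (ler0_norm h2) mulN1r !opprK addrC.
Qed.

Lemma arm_position_itv i x : half_circle i x -> 0 <= arm_position x <= pi / 2.
Proof.
move=> hx; rewrite (arm_position_half hx) normr_ge0 ler_norml /=.
by move: hx; rewrite /half_circle /arm_center /sgb; case: i; clear; lra.
Qed.

Lemma half_center i (s z : R) : s ^+ 2 = 1 -> 0 <= z <= pi / 2 ->
  half_circle i (arm_center i + s * z).
Proof.
move=> /eqP; rewrite sqrf_eq1 => /orP[] /eqP ->; rewrite /half_circle /arm_center /sgb;
  by case: i; clear; lra.
Qed.

Lemma arm_position_center i (s z : R) : s ^+ 2 = 1 -> 0 <= z <= pi / 2 ->
  arm_position (arm_center i + s * z) = z.
Proof.
move=> s1 zl; rewrite (arm_position_half (half_center i s1 zl)) addrC addKr normrM.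
have -> : `|s| = 1 by move: s1 => /eqP; rewrite sqrf_eq1 => /orP[] /eqP ->; rewrite ?normrN1 ?normr1.
by rewrite mul1r ger0_norm //; case/andP: zl.
Qed.

(** [phi] is glued first. [V] and [Phi] are then successive primitives on the whole line, started at
    the midpoints, so the branches are differentiable everywhere; [VE] and [PE] identify them with
    the arms. *)
Lemma arms_unfold q t gam mu Z b u v : arms q (pi / 2) t gam mu Z b u v ->
  exists phi (Phi V : bool -> R -> R),
  let h i x := lichF q (acoef t i) (ccoef Z mu gam b i) (phi x) in
  [/\ periodic2pi phi /\ continuous phi, forall x, 0 < phi x,
      forall i x, half_circle i x -> phi x = Phi i x,
      (forall i x, is_derive x 1 (Phi i) (V i x)) /\ (forall i x, is_derive x 1 (V i) (h i x)) &
      [/\ V true 0 = V false 0, V true pi = V false (- pi), phi 0 = u true (pi / 2) &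
          phi pi = u true (pi / 2)]].
Proof.
move=> [[du dv v0 ul vl] up]; have p0 := @pi0 R.
have l0 : 0 <= pi / 2 :> R by rewrite divr_ge0 // ltW.
have ll : is_true (0 <= (pi : R) / 2 <= pi / 2) by rewrite l0 lexx.
have pos0 : arm_position 0 = pi / 2 :> R by rewrite /arm_position normr0 subr0 ger0_norm.
have posp : arm_position pi = pi / 2 :> R.
  rewrite /arm_position (ger0_norm (ltW p0)) distrC ger0_norm; by [field | lra].
have posm : arm_position (- pi) = pi / 2 :> R by rewrite -posp /arm_position normrN.
have [||| phi [pphi cphi _ phiE]] := @periodic_glue R (fun i x => u i (arm_position x)).
- move=> i x hx; apply: (@continuous_comp _ _ _ (@arm_position R) (u i)).
    exact: continuous_arm_position.
  exact: der_cont (du i _ (arm_position_itv hx)).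
- by rewrite pos0.
- by rewrite posp posm.
have phi_gt0 x : 0 < phi x.
  have [y Iy E] := periodic_reduce x; rewrite (E _ pphi) (phiE _ _ (half_circle_side Iy)).
  by apply: up; exact: (arm_position_itv (half_circle_side Iy)).
pose G i := lichF q (acoef t i) (ccoef Z mu gam b i).
have ch i : continuous (fun x => G i (phi x)).
  move=> x; apply: (@continuous_comp _ _ _ phi (G i)); first exact: cphi.
  exact: lichF_cont.
have prim (k : R -> R) c y : continuous k -> exists K, K c = y /\ forall x, is_derive x 1 K (k x).
  move=> ck; have [K [_ dK]] := antiderivative ck; exists (fun x => K x + (y - K c)).
  split; first by rewrite addrC subrK.
  by move=> x; apply: (derE (derD (dK x) (der_cst (y - K c) x))); rewrite addr0.
have [V VP] := @choice _ _ (fun i (K : R -> R) => K (arm_center i) = 0 /\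
  forall x, is_derive x 1 K (G i (phi x))) (fun i => prim _ _ _ (ch i)).
have dV i : forall x, is_derive x 1 (V i) (G i (phi x)) by exact: (VP i).2.
have cV i : continuous (V i) by move=> x; exact: der_cont (dV i x).
have [Phi PP] := @choice _ _ (fun i (K : R -> R) => K (arm_center i) = u i 0 /\
  forall x, is_derive x 1 K (V i x)) (fun i => prim _ _ _ (cV i)).
have dP i : forall x, is_derive x 1 (Phi i) (V i x) by exact: (PP i).2.
have dz i (s z : R) : is_derive z 1 (fun z => arm_center i + s * z) s.
  by apply: (derE (derD (der_cst (arm_center i) z) (derZ s (der_id z)))); rewrite add0r mulr1.
(* The sign [s] is the direction in which the half circle is followed from its midpoint. *)
have VE i (s z : R) : s ^+ 2 = 1 -> 0 <= z <= pi / 2 -> s * V i (arm_center i + s * z) = v i z.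
  move=> s1 zl; have d y : 0 <= y <= z ->
      is_derive y 1 (fun y => s * V i (arm_center i + s * y) - v i y) 0.
    move=> yz; have yl : 0 <= y <= pi / 2 by move: yz zl; clear; lra.
    apply: (derE (derB (derZ s (@der_comp _ (V i) _ y _ _ (dV i _) (dz i s y))) (dv i y yl))).
    rewrite (phiE i _ (half_center i s1 yl)) (arm_position_center i s1 yl) -/(G i) mulrCA -expr2.
    by rewrite s1 mulr1 subrr.
  have z0 : 0 <= z by case/andP: zl.
  have := der_eq0_cst z0 d (fun _ _ => erefl).
  by rewrite mulr0 addr0 (VP i).1 mulr0 v0 subrr => /esym/eqP; rewrite subr_eq0 => /eqP.
have PE i (s z : R) : s ^+ 2 = 1 -> 0 <= z <= pi / 2 -> Phi i (arm_center i + s * z) = u i z.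
  move=> s1 zl; have d y : 0 <= y <= z ->
      is_derive y 1 (fun y => Phi i (arm_center i + s * y) - u i y) 0.
    move=> yz; have yl : 0 <= y <= pi / 2 by move: yz zl; clear; lra.
    apply: (derE (derB (@der_comp _ (Phi i) _ y _ _ (dP i _) (dz i s y)) (du i y yl))).
    by rewrite mulrC (VE i s y s1 yl) subrr.
  have z0 : 0 <= z by case/andP: zl.
  have := der_eq0_cst z0 d (fun _ _ => erefl).
  by rewrite mulr0 addr0 (PP i).1 subrr => /esym/eqP; rewrite subr_eq0 => /eqP.
have s1 : 1 ^+ 2 = 1 :> R by rewrite expr1n.
have sm : (-1) ^+ 2 = 1 :> R by rewrite sqrrN expr1n.
have [e1 e2] : arm_center true + -1 * (pi / 2) = 0 /\ arm_center false + 1 * (pi / 2) = 0 :> R.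
  by rewrite /arm_center /sgb; split; ring.
have [e3 e4] : arm_center true + 1 * (pi / 2) = pi /\
    arm_center false + -1 * (pi / 2) = - pi :> R.
  by rewrite /arm_center /sgb; split; field.
have vE : v false (pi / 2) = - v true (pi / 2) by apply/eqP; rewrite -addr_eq0 addrC vl.
exists phi, Phi, V; split => //.
- move=> i x hx; rewrite (phiE i x hx); have zl := arm_position_itv hx.
  rewrite (arm_position_half hx) in zl *.
  have [h|h] := leP 0 (x - arm_center i).
    rewrite (ger0_norm h) in zl *; rewrite -(PE i 1 _ s1 zl); congr (Phi i _); ring.
  rewrite (ltr0_norm h) in zl *; rewrite -(PE i (-1) _ sm zl); congr (Phi i _); ring.
- have := VE true (-1) _ sm ll; have := VE false 1 _ s1 ll; have := VE true 1 _ s1 ll.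
  have := VE false (-1) _ sm ll; rewrite e1 e2 e3 e4 vE => h1 h2 h3 h4; split.
  + by move: h3 h4; clear; lra.
  + by move: h1 h2; clear; lra.
  + by rewrite (phiE true) ?pos0 // /half_circle lexx ltW.
  + by rewrite (phiE true) ?posp // /half_circle lexx ltW.
Qed.

Lemma arms_solution n N eta mu t b u v : (3 <= n)%N -> smooth N -> periodic2pi N ->
  (forall x, 0 < N x) -> 0 < b ->
  arms (qexp n) (pi / 2) t (gammaN N) mu (2 * eta ^+ 2 / kappa n) b u v ->
  u true (pi / 2) `^ qexp n = b -> exists phi w, is_solution n N eta mu t 2 phi w.
Proof.
move=> n3 sN pN N0 b0 ar uE; have cN := smooth_cont sN.
have [phi [Phi [V [[pphi cphi] phi0 phiE [dP dV] [V0 Vpi phi_0 phi_pi]]]]] := arms_unfold ar.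
have ul : u true (pi / 2) = u false (pi / 2) by case: ar => -[].
set q := qexp n in uE dV; set gam := gammaN N in dV; set Z := _ / _ in dV.
pose h i x := lichF q (acoef t i) (ccoef Z mu gam b i) (phi x).
have ch i : continuous (h i).
  move=> x; apply: (@continuous_comp _ _ _ phi (lichF q (acoef t i) (ccoef Z mu gam b i))).
    exact: cphi.
  exact: lichF_cont.
have cV i : continuous (V i) by move=> x; exact: der_cont (dV i x).
have p0 := @pi0 R.
have hf i : half_circle i (0 : R) by rewrite /half_circle; case: i; rewrite lexx ?oppr_le0 ltW.
have hp : half_circle true (pi : R) by rewrite /half_circle lexx ltW.
have hm : half_circle false (- pi : R) by rewrite /half_circle lexx oppr_le0 ltW.
have phi_m : phi (- pi) = phi pi by rewrite -pphi; congr phi; ring.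
have [M [dM A0 B0 gE]] := gammaN_primitive cN N0.
pose k i x := (2 * (b * (sgb i + gam))) * N x.
pose W i x := (2 * (b * (sgb i + gam))) * (M x - M 0).
have ck i : continuous (k i) by move=> x; apply: cvgMr; exact: cN.
have dW i x : is_derive x 1 (W i) (k i x).
  by apply: (derE (derZ _ (derB (dM x) (der_cst (M 0) x)))); rewrite subr0.
have W0 i : W i 0 = 0 by rewrite /W subrr mulr0.
(* Periodicity of [w] is exactly the condition that defines [gammaN]. *)
have Wpi : W true pi = W false (- pi).
  have dn : M pi - M (- pi) != 0 by rewrite gt_eqF //; move: A0 B0; clear; lra.
  rewrite /W /sgb /gam gE; field.
  by [].
have [|||w [pw_ cw wE _]] := @periodic_glue R W.
- by move=> i x _; exact: der_cont (dW i x).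
- by rewrite !W0.
- exact: Wpi.
have phipw x : circI x -> phi x = pw Phi x.
  by move=> Ix; exact: phiE (half_circle_side Ix).
have wd1 : weak_deriv phi (pw V).
  move=> psi tp; rewrite -(@weak_deriv_pw R Phi V cV dP _ _ psi tp).
  - by apply: eq_Rintegral => x; rewrite inE => Ix; rewrite phipw.
  - by rewrite -!phiE.
  - by rewrite -!phiE.
have wdw : weak_deriv w (pw k).
  move=> psi tp; rewrite -(@weak_deriv_pw R W k ck dW _ Wpi psi tp) ?W0 //.
  by apply: eq_Rintegral => x; rewrite inE => Ix; rewrite wE.
have kE x : pw k x / (2 * N x) = b * (sgb (0 < x) + gam).
  by rewrite /pw /k; field; rewrite gt_eqF.
exists phi, w; split; first by clear; lra.
split; first exact: pphi.
split; first exact: cphi.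
split; first exact: phi0.
split; first exact: pw_.
split; first exact: cw.
split; first exact: cont_Lp2.
split; first exact: cont_Lp2.
exists (pw V), (pw h), (pw k).
do 3 (split; first exact: pw_Lp2).
split => //; split; first exact: weak_deriv_pw ch dV V0 Vpi.
split => //; split.
  apply: ae_imp (@lam_ae R) => x lx Ix.
  have [_ H] := first_equation t eta mu (pw h x) n3 (phi0 x) (kE x) (lx Ix).
  by apply: H.
move=> psi tp; rewrite phi_0 phi_pi uE.
pose F i (x : R) := b * (sgb i + gam); pose F0 (i : bool) (x : R) := 0 : R.
have cF0 i : continuous (F0 i) by move=> x; exact: cvg_cst.
have dF i x : is_derive x 1 (F i) (F0 i x) by exact: der_cst.
have -> : \int[leb]_(x in circI) (pw k x / (2 * N x) * derive1n 1 psi x) =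
    \int[leb]_(x in circI) (pw F x * derive1n 1 psi x).
  by apply: eq_Rintegral => x _; rewrite kE.
have E0 : \int[leb]_(x in circI) (pw F0 x * psi x) = 0.
  transitivity (\int[leb]_(x in @circI R) (0 : R)).
    by apply: eq_Rintegral => x _; rewrite /pw mul0r.
  by rewrite Rintegral_cst ?mul0r //; exact: measurable_circI.
by rewrite (pw_parts cF0 dF tp) E0 /F /sgb; ring.
Qed.

End ArmsSolution.

Section Uniqueness.
Context {R : realType}.
Implicit Types (w f g : R -> R) (x c : R).

Lemma weak_deriv_unique w g w' g' : periodic2pi w -> continuous w -> periodic2pi w' ->
  continuous w' -> circ_int g -> circ_int g' -> weak_deriv w g -> weak_deriv w' g' ->
  {ae leb, forall x, circI x -> g x = g' x} -> exists c, forall x, w' x = w x + c.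
Proof.
move=> pw0 cw pw1 cw' gi gi' wg wg' gg.
have iw := circ_int_cont cw; have iw' := circ_int_cont cw'.
have [|psi tp|c cP] := @weak_cst R (fun x => w' x - w x).
- exact: circ_intB.
- have cp1 := smooth_cont (smooth_derive1n tp.1); have cp := smooth_cont tp.1.
  transitivity (\int[leb]_(x in circI) (w' x * derive1n 1 psi x - w x * derive1n 1 psi x)).
    by apply: eq_Rintegral => x _; rewrite mulrBl.
  rewrite circ_RintB; [ | exact: circ_int_mul | exact: circ_int_mul].
  rewrite (wg psi tp) (wg' psi tp) (@circ_int_ae _ (fun x => g' x * psi x) (fun x => g x * psi x)).
  + by rewrite subrr.
  + exact: circ_int_mul.
  + exact: circ_int_mul.
  + by apply: ae_imp gg => x gx Ix; rewrite gx.
exists c; have cd : continuous (fun x => w' x - w x).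
  by move=> x; apply: (@continuousB _ _ _ w' w); [exact: cw' | exact: cw].
have cc (i : bool) : continuous (fun _ : R => c) by move=> x; exact: cvg_cst.
have H := @cont_ae_eq_pw R _ (fun (_ : bool) _ => c) cd cc cP.
have -> : w' = (fun x => w x + c); last by [].
apply: periodic_eq => //; first by move=> x; rewrite pw0.
by move=> x Ix; rewrite -(H _ x (half_circle_side Ix)) addrC subrK.
Qed.

End Uniqueness.

Unset Implicit Arguments.
Set Strict Implicit.
Set Printing Implicit Defensive.

Theorem theorem3p1 (R : realType) (n : nat) (N : R -> R) (eta mu t : R) :
  (3 <= n)%N ->
  smooth N -> periodic2pi N -> (forall x, 0 < N x) ->
  2 < `|t - gammaN N| ->
  ((exists (p : R) (phi w : R -> R), is_solution n N eta mu t p phi w)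
     <-> (eta != 0 \/ mu != 0)) /\
  (mu = 0 ->
   forall (p1 p2 : R) (phi1 w1 phi2 w2 : R -> R),
     is_solution n N eta mu t p1 phi1 w1 ->
     is_solution n N eta mu t p2 phi2 w2 ->
     phi2 = phi1 /\ exists c : R, forall x, w2 x = w1 x + c).
Proof.
move=> n3 sN pN N0 far; have cN := smooth_cont sN.
have t1 := far_t_gt1 cN N0 far; have g1 := gammaN_lt1 cN N0.
have /andP[q2 q6] := @qexp_bounds R n n3; have k0 := @kappa_gt0 R n n3.
have l0 : 0 < pi / 2 :> R by rewrite divr_gt0 // pi_gt0.
have Z_ge0 : 0 <= 2 * eta ^+ 2 / kappa n.
  by apply: divr_ge0; [apply: mulr_ge0 => //; exact: sqr_ge0 | exact: ltW].
have Z_gt0 : eta != 0 -> 0 < 2 * eta ^+ 2 / kappa n.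
  by move=> e0; rewrite divr_gt0 // mulr_gt0 // exprn_even_gt0.
split; first split.
- move=> [p [phi [w sol]]].
  have [eta0|] := eqVneq eta 0; last by left.
  have [mu0|] := eqVneq mu 0; last by right.
  have [b [u [v [b0 ar uE _ _]]]] := solution_arms n3 sN N0 far sol.
  exfalso; rewrite eta0 expr0n mulr0 mul0r mu0 in ar.
  exact: arms_no_fixed_point q2 l0 t1 g1 b0 ar uE.
- move=> em; have Zmu : 0 < 2 * eta ^+ 2 / kappa n \/ mu != 0.
    by case: em => [/Z_gt0|]; [left | right].
  have [b [u [v [b0 ar uE]]]] := arms_fixed_point q2 l0 t1 g1 Z_ge0 Zmu.
  have [phi [w sol]] := arms_solution n3 sN pN N0 b0 ar uE.
  (* The derivatives constructed are piecewise continuous, so the exponent is immaterial; 2 turns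
     the integrals into integrals of squares. *)
  by exists 2, phi, w.
move=> mu0 p1 p2 phi1 w1 phi2 w2 sol1 sol2; rewrite mu0 in sol1 sol2.
have [b1 [u1 [v1 [b10 ar1 uE1 phiE1 [d1 [id1 wd1 dE1]]]]]] := solution_arms n3 sN N0 far sol1.
have [b2 [u2 [v2 [b20 ar2 uE2 phiE2 [d2 [id2 wd2 dE2]]]]]] := solution_arms n3 sN N0 far sol2.
(* With [mu = 0], a vanishing [eta] would exclude solutions altogether, so the coefficient of [eta]
   may be taken positive. *)
have [eta0|/Z_gt0 Z0] := eqVneq eta 0.
  exfalso; rewrite eta0 expr0n mulr0 mul0r in ar1.
  exact: arms_no_fixed_point q2 l0 t1 g1 b10 ar1 uE1.
have bE := arms_fixed_point_unique q2 q6 l0 t1 g1 far Z0 b10 b20 ar1 uE1 ar2 uE2.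
rewrite -bE in ar2 dE2.
have [_ [pphi1 [_ [_ [pw1 [cw1 _]]]]]] := sol1.
have [_ [pphi2 [_ [_ [pw2 [cw2 _]]]]]] := sol2.
split.
  apply: periodic_eq => // x Ix; rewrite phiE1 // phiE2 //.
  by rewrite (arms_unique q2 l0 t1 Z_ge0 ar1 ar2) //; exact: arm_position_itv (half_circle_side Ix).
apply: (weak_deriv_unique pw1 cw1 pw2 cw2 id1 id2 wd1 wd2).
by apply: ae_imp (ae_and dE1 dE2) => x [e1 e2] Ix; rewrite e1 ?e2.
Qed.
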